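(* Let $\pi$ be a fixed meta-prior on $\mathcal{A}$, let $\mathfrak{P}(A)$, $A\in\mathcal{A}$, be a fixed (data-independent) family as below, and let $\delta>0$. Then with probability at least $1-\delta$ over the sampling of the training tasks and datasets, simultaneously for all meta-posteriors $\rho$ and all hyper-posteriors $\mathcal{Q}(A)$, $$\mathcal{R}^S_M(\rho)\;\le\;\mathrm{kl}^{-1}_n\!\left(\frac{M}{n\,m_{\max}}\,\mathrm{kl}^{-1}_M\Big(\widehat{\mathcal{R}}^S(\rho)\,\Big|\,C(\rho)+c_2\Big)\,\Big|\,\mathrm{KL}(\rho\|\pi)+\log\frac{4\sqrt n}{\delta}\right),$$ where $M=\sum_{i=1}^n m_i$, $C(\rho)=\mathrm{KL}(\rho\|\pi)+\mathbb{E}_{A\sim\rho}\big[\mathrm{KL}(\mathfrak{Q}(A)\|\mathfrak{P}(A))\big]+\log\frac2\delta$ and $c_2=\log(2\sqrt M)$.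
   Context: Meta-learning setting: $\tau$ is an unknown environment distribution over triples $(D,m,S)$, where $D$ is a distribution on $\mathcal{Z}$, $m\in\{1,\dots,m_{\max}\}$ and, given $(D,m)$, $S$ consists of $m$ i.i.d. samples from $D$. Training tasks $(D_i,m_i,S_i)$, $i=1,\dots,n$, are i.i.d. from $\tau$. A loss $\ell:\mathcal{F}\times\mathcal{Z}\to[0,1]$ is fixed; for a distribution $Q$ on $\mathcal{F}$, $\ell(z,Q)=\mathbb{E}_{f\sim Q}\ell(f,z)$. $\mathcal{A}$ is a set of algorithms; each $A\in\mathcal{A}$ maps a dataset $S$ to a posterior $A(S)\in\mathcal{M}(\mathcal{F})$. A meta-prior $\pi$ (data-independent) and meta-posterior $\rho$ are distributions on $\mathcal{A}$. For each $A$: $\mathcal{P}(A)$ is a data-independent hyper-prior (distribution on $\mathcal{M}(\mathcal{F})$) and $\mathcal{Q}(A)$ a data-dependent hyper-posterior; $\mathfrak{Q}(A)=\mathcal{Q}(A)\times A(S_1)\times\cdots\times A(S_n)$ on $\mathcal{M}(\mathcal{F})\times\mathcal{F}^n$, and $\mathfrak{P}(A)$ is generated by $P\sim\mathcal{P}(A)$, then $f_1,\dots,f_n$ i.i.d. $\sim P$. Sample-centric empirical risk: $\widehat{\mathcal{R}}^S(\rho)=\mathbb{E}_{A\sim\rho}\frac1M\sum_{i=1}^n\sum_{z\in S_i}\ell(z,A(S_i))$. Sample-centric meta-risk: $\mathcal{R}^S_M(\rho)=\mathbb{E}_{A\sim\rho}\mathbb{E}_{(D,m,S)\sim\tau}\mathbb{E}_{z\sim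 D}\frac{m}{m_{\max}}\ell(z,A(S))$. $\mathrm{kl}(q|p)=q\log\frac qp+(1-q)\log\frac{1-q}{1-p}$; for an integer $N$, $\mathrm{kl}^{-1}_N(q|b)=\sup\{p\in[0,1]:N\,\mathrm{kl}(q|p)\le b\}$. $\mathrm{KL}$ is the Kullback–Leibler divergence. *)

(* Defs.v *)
From HB Require Import structures.
From mathcomp Require Import all_boot all_order all_algebra.
From mathcomp Require Import all_classical all_reals all_analysis.
From mathcomp Require Import giry charge.

Set Implicit Arguments.
Unset Strict Implicit.
Unset Printing Implicit Defensive.

Import Order.TTheory GRing.Theory Num.Theory.
Local Open Scope classical_set_scope.
Local Open Scope ring_scope.

Definition xlogxy (R : realType) (a b : R) : \bar R :=
  if a == 0 then 0%E else if b == 0 then +oo%E else (a * ln (a / b))%:E.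

Definition klbin (R : realType) (q p : R) : \bar R :=
  (xlogxy q p + xlogxy (1 - q) (1 - p))%E.

Definition klinv (R : realType) (N : nat) (q : R) (b : \bar R) : R :=
  sup [set p : R | 0 <= p <= 1 /\ ((N%:R)%:E * klbin q p <= b)%E].

Definition KL d (T : measurableType d) (R : realType)
    (mu nu : probability T R) : \bar R :=
  if pselect (mu `<< nu) then
    (\int[mu]_x (ln (fine (Radon_Nikodym (charge_of_finite_measure mu) nu x)))%:E)%E
  else +oo%E.

Definition lossQ d (F : measurableType d) dZ (Z : measurableType dZ)
    (R : realType) (loss : F -> Z -> R) (z : Z) (Q : giry F R) : \bar R :=
  (\int[Q]_f (loss f z)%:E)%E.

Definition tbox d (T : measurableType d) (n : nat) (B : 'I_n -> set T)
  : set (n.-tuple T) := [set t | forall i, B i (tnth t i)].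

(* A task is an abstract point t of a measurable space Tsk, carrying the
   distribution tD t, the sample size tm t and the (infinite) i.i.d. sample
   stream tS j t, j : nat; its dataset is the first (tm t) samples. *)
Definition dataset dT (Tsk : measurableType dT) dZ (Z : measurableType dZ)
    (tm : Tsk -> nat) (tS : nat -> Tsk -> Z) (t : Tsk) : seq Z :=
  mkseq (fun j => tS j t) (tm t).

Definition Mtot dT (Tsk : measurableType dT) n (tm : Tsk -> nat)
    (tr : n.-tuple Tsk) : nat := (\sum_(i < n) tm (tnth tr i))%N.

Definition emp_risk dA (Alg : measurableType dA) dF (F : measurableType dF)
    dZ (Z : measurableType dZ) dT (Tsk : measurableType dT) (R : realType)
    (loss : F -> Z -> R) (algo : Alg -> seq Z -> giry F R)
    (tm : Tsk -> nat) (tS : nat -> Tsk -> Z) n (tr : n.-tuple Tsk)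
    (rho : probability Alg R) : \bar R :=
  (\int[rho]_A
     ((Mtot tm tr)%:R^-1%:E *
      \sum_(i < n) \sum_(z <- dataset tm tS (tnth tr i))
          lossQ loss z (algo A (dataset tm tS (tnth tr i)))))%E.

Definition meta_risk dA (Alg : measurableType dA) dF (F : measurableType dF)
    dZ (Z : measurableType dZ) dT (Tsk : measurableType dT) (R : realType)
    (loss : F -> Z -> R) (algo : Alg -> seq Z -> giry F R)
    (tau : probability Tsk R) (tD : Tsk -> giry Z R)
    (tm : Tsk -> nat) (tS : nat -> Tsk -> Z) (mmax : nat)
    (rho : probability Alg R) : \bar R :=
  (\int[rho]_A \int[tau]_t \int[tD t]_z
     (((tm t)%:R / mmax%:R)%:E * lossQ loss z (algo A (dataset tm tS t))))%E.

(* Main.v *)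
Require Import Defs.
From HB Require Import structures.
From mathcomp Require Import all_boot all_order all_algebra.
From mathcomp Require Import all_classical all_reals all_analysis.
From mathcomp Require Import giry charge measurable_realfun.
From mathcomp Require Import ring lra zify.

(** The loss is first shrunk into [[r/2, 1 - r/2]], so that every kl term is
    finite and bounded; r tends to 0 at the end, along the event that the bounds
    hold for infinitely many values of r.

    Both levels rest on E exp(M kl(mean of X | mean of mu)) <= 2 sqrt M for
    independent [0,1]-valued X_j with means mu_j.  Writing c = q/p and
    d = (1-q)/(1-p), the exponential is prod_j c^(x_j) d^(1-x_j), which is at
    most the multi-affine function prod_j (x_j c + (1-x_j) d), i.e. an
    expectation over Bernoulli(x_j) trials, and q^k (1-q)^(M-k) is at most
    2 sqrt M times the Krichevsky-Trofimov probability KT(k, M-k).  This bound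
    no longer involves q, so the X_j may be replaced by their conditional means
    mu_j; Hoeffding's comparison replaces the mu_j by their average p, and the
    Krichevsky-Trofimov probabilities of the binary sequences sum to 1.

    Markov's inequality and two nested Donsker-Varadhan inequalities (over the
    algorithm A, then over the hypotheses) give the sample-level bound, and a
    single one gives the task-level bound.  Convexity of kl enters only through
    its affine minorants, which commute with expectations and with the limit in
    r, and which determine the inverse kl. *)

Import Order.TTheory GRing.Theory Num.Theory.
Import numFieldNormedType.Exports.
Local Open Scope classical_set_scope.
Local Open Scope ring_scope.

(** * The moment bound for sums of [0,1]-valued variables *)

(** One event has to serve all [rho] and all hyper-posteriors, so the exceptional sets may involve
    only [pi] and [fP]. Markov's inequality is therefore applied to mixtures over these, under which
    algorithms and hypotheses are independent of the data. Each level spends [delta / 2]: the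
    threshold [2 sqrt M * (2 / delta)] yields [c2] and [log (2 / delta)], and
    [2 sqrt n * (2 / delta)] yields the [4 sqrt n / delta] of the outer bound.

    The sample level is the delicate one, because both M and the true mean p are random there. M is
    treated by summing over the finitely many vectors of sample sizes and by dividing by [2 sqrt M]
    inside the expectation. As for p, conditional independence is given only on measurable
    rectangles. Expanding the moment bound into finitely many products of one-sample factors, with
    coefficients that depend on p alone, brings it within reach of rectangles and limits of step
    functions. *)

Lemma expn_fact_mode (k j : nat) : (k ^ j * k`! <= k ^ k * j`!)%N.
Proof.
have [kj|jk] := leqP k j.
  rewrite -(subnKC kj); elim: (j - k)%N => [|i IH]; first by rewrite addn0.
  rewrite addnS expnS factS.
  have : (k * (k ^ (k + i) * k`!) <= (k + i).+1 * (k ^ k * (k + i)`!))%N.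
    by apply: leq_mul => //; rewrite leqW// leq_addr.
  lia.
have -> : (k ^ k = k ^ j * k ^ (k - j))%N by rewrite -expnD subnKC// ltnW.
suff H : (k`! <= k ^ (k - j) * j`!)%N.
  by rewrite -mulnA leq_mul2l H orbT.
have -> : (k`! = (k ^_ (k - j)) * j`!)%N.
  by rewrite -(ffact_fact (leq_subr j k)) subKn// ltnW.
rewrite leq_mul2r; apply/orP; right.
rewrite ffact_prod -[X in (_ <= _ ^ X)%N]card_ord -prod_nat_const.
by apply: leq_prod => i _; rewrite leq_subr.
Qed.

(** The binomial weights with success probability [k / (k + b)] peak at [k]: up to a common factor
    they are products of Poisson weights [k ^ j / j!] and [b ^ i / i!], each of which peaks at its
    own parameter. *)
Lemma bin_mode (k b j : nat) : (j <= k + b)%N ->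
  ('C(k + b, j) * (k ^ j * b ^ (k + b - j)) <= 'C(k + b, k) * (k ^ k * b ^ b))%N.
Proof.
move=> jN.
have H1 := bin_fact jN.
have H2 := bin_fact (leq_addr b k); rewrite addKn in H2.
have Hk := expn_fact_mode k j.
have Hb := expn_fact_mode b (k + b - j).
have P : (0 < j`! * (k + b - j)`! * (k`! * b`!))%N by rewrite !muln_gt0 !fact_gt0.
rewrite -(leq_pmul2r P).
have := leq_mul Hk Hb.
set x := (k ^ j)%N; set y := (b ^ _)%N; set u := (k ^ k)%N; set v := (b ^ b)%N.
move=> Hm.
rewrite (_ : _ * _ = (k + b)`! * (x * k`! * (y * b`!)))%N; last by rewrite -H1; ring.
rewrite [leqRHS](_ : _ = (k + b)`! * (u * j`! * (v * (k + b - j)`!)))%N; last by rewrite -H2; ring.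
by rewrite leq_mul2l Hm orbT.
Qed.

(** With [N = k + b] and [p = k / N], multiplication by [k^k b^b / N^(2N)] gives P(Bin(2N, p) = 2k)
    <= P(Bin(N, p) = k). A convolution has no larger weight than the largest weight of one factor,
    which [bin_mode] identifies. *)
Lemma bin_double (k b : nat) :
  ('C((k + b).*2, k.*2) * (k ^ k * b ^ b) <= 'C(k + b, k) * (k + b) ^ (k + b))%N.
Proof.
set N := (k + b)%N.
(* [0 ^ 0 = 1] keeps this factor positive when [k] or [b] is zero. *)
have W : (0 < k ^ k * b ^ b)%N by rewrite muln_gt0 !expn_gt0; case: k {N} => [|?]; case: b => [|?].
rewrite -(leq_pmul2r W) -addnn -binomial.Vandermonde -/N ?addnn !big_distrl/=.
have EN : ((k + b) ^ N = \sum_(i < N.+1) 'C(N, i) * (b ^ (N - i) * k ^ i))%N by rewrite addnC expnDn.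
rewrite EN.
rewrite [leqRHS](_ : _ = \sum_(0 <= i < N.+1) ('C(N, i) * (b ^ (N - i) * k ^ i)) * ('C(N, k) * (k ^ k * b ^ b)))%N; last first.
  by rewrite big_mkord mulnAC mulnC big_distrl.
rewrite -(big_mkord xpredT (fun j => 'C(N, j) * 'C(N, k.*2 - j) * (k ^ k * b ^ b) * (k ^ k * b ^ b))%N).
have T j : (j <= N)%N -> (j <= k.*2)%N -> ('C(N, j) * 'C(N, k.*2 - j) * (k ^ k * b ^ b) * (k ^ k * b ^ b) <=
   'C(N, j) * (b ^ (N - j) * k ^ j) * ('C(N, k) * (k ^ k * b ^ b)))%N.
  move=> jN jk.
  have [NN|NN] := leqP (k.*2 - j)%N N; last by rewrite (bin_small NN) muln0 !mul0n.
  have := bin_mode k b _ NN; rewrite -/N.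
  have E : (k ^ k * b ^ b * (k ^ k * b ^ b) = (b ^ (N - j) * k ^ j) * (k ^ (k.*2 - j) * b ^ (N - (k.*2 - j))))%N.
    transitivity (k ^ (j + (k.*2 - j)) * b ^ ((N - j) + (N - (k.*2 - j))))%N.
      rewrite subnKC// -addnn (_ : N - j + _ = b + b)%N; last by rewrite /N; lia.
      rewrite !expnD; ring.
    rewrite !expnD; ring.
  move=> H; rewrite -mulnA E.
  rewrite (_ : _ * _ = ('C(N, j) * (b ^ (N - j) * k ^ j)) * ('C(N, k.*2 - j) * (k ^ (k.*2 - j) * b ^ (N - (k.*2 - j)))))%N; last ring.
  by rewrite leq_mul2l H orbT.
have T0 j : (N < j)%N -> ('C(N, j) * 'C(N, k.*2 - j) * (k ^ k * b ^ b) * (k ^ k * b ^ b) = 0)%N.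
  by move=> Nj; rewrite bin_small.
(* The Vandermonde sum runs to [2k], the binomial expansion to [N]: terms past [N] vanish in the
   former, terms past [2k] are dropped from the latter. *)
have [le|lt] := leqP k.*2 N.
  rewrite [leqRHS](@big_cat_nat _ _ _ (k.*2).+1)//=.
  apply: leq_trans (leq_addr _ _); rewrite big_nat_cond [leqRHS]big_nat_cond.
  by apply: leq_sum => j /andP[/andP[_ jk] _]; apply: T => //; apply: leq_trans le.
rewrite (@big_cat_nat _ _ _ N.+1)//=; last exact: leqW.
rewrite [X in (_ + X)%N]big_nat_cond [X in (_ + X)%N]big1 ?addn0; last first.
  by move=> j /andP[/andP[Nj _] _]; apply: T0.
rewrite big_nat_cond [leqRHS]big_nat_cond.
by apply: leq_sum => j /andP[/andP[_ jk] _]; apply: T => //; apply: leq_trans (ltnW lt).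
Qed.

(** * Expectations over independent trials and Hoeffding's comparison *)

Section pb.
Context {R : realType}.
Implicit Types (a : nat -> nat -> R) (s : seq R) (k b N : nat) (p q c d x : R).

(* The expectation of a (#successes) (#failures) over independent trials with
   success probabilities s. *)
Fixpoint pb a s : R :=
  if s is x :: s' then
    x * pb (fun k b => a k.+1 b) s' + (1 - x) * pb (fun k b => a k b.+1) s'
  else a 0%N 0%N.

Definition in01 : {pred R} := [pred x | 0 <= x <= 1].

Lemma pb_le a a' s : all in01 s ->
  (forall k b, (k + b)%N = size s -> a k b <= a' k b) -> pb a s <= pb a' s.
Proof.
elim: s a a' => [|x s IH] a a' /=; first by move=> _; apply.
move=> /andP[/andP[x0 x1] s01] aa'.
rewrite lerD// ler_wpM2l ?subr_ge0//; apply: IH => // k b kb; apply: aa'; lia.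
Qed.

Lemma pb_lin (u v : R) a a' s :
  pb (fun k b => u * a k b + v * a' k b) s = u * pb a s + v * pb a' s.
Proof. by elim: s a a' => [//|x s IH] a a' /=; rewrite !IH; ring. Qed.

Lemma pb_ge0 a s : all in01 s -> (forall k b, 0 <= a k b) -> 0 <= pb a s.
Proof.
elim: s a => [|x s IH] a /=; first by move=> _; apply.
by move=> /andP[/andP[x0 x1] s01] a0; rewrite addr_ge0// mulr_ge0 ?subr_ge0 ?IH.
Qed.

Lemma pb_swap a x y s : pb a (x :: y :: s) = pb a (y :: x :: s).
Proof. by rewrite /=; ring. Qed.

Lemma pb_rem a s x : x \in s -> pb a s = pb a (x :: rem x s).
Proof.
elim: s a => [//|z s IH] a; rewrite inE /= [x == z]eq_sym; have [->//|zx] := eqVneq z x.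
move=> /= xs; rewrite -[RHS]/(pb a (x :: z :: rem x s)) pb_swap.
by rewrite -[LHS]/(pb a (z :: s)) [LHS]/= !IH.
Qed.

Lemma pb_prod c d s : pb (fun k b => c ^+ k * d ^+ b) s = \prod_(x <- s) (x * c + (1 - x) * d).
Proof.
(* The factor [u] collects the power of [c] or [d] that a trial contributes, so that the induction
   closes. *)
suff H (u : R) : pb (fun k b => u * (c ^+ k * d ^+ b)) s = u * \prod_(x <- s) (x * c + (1 - x) * d).
  by rewrite -[RHS]mul1r -H; congr pb; apply/funext => k; apply/funext => b; rewrite mul1r.
elim: s u => [|x s IH] u /=; first by rewrite big_nil !expr0 !mulr1.
rewrite big_cons.
rewrite (_ : (fun k b => u * (c ^+ k.+1 * d ^+ b)) = (fun k b => (u * c) * (c ^+ k * d ^+ b))); last first.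
  by apply/funext => k; apply/funext => b; rewrite exprS; ring.
rewrite (_ : (fun k b => u * (c ^+ k * d ^+ b.+1)) = (fun k b => (u * d) * (c ^+ k * d ^+ b))); last first.
  by apply/funext => k; apply/funext => b; rewrite exprS; ring.
by rewrite !IH; ring.
Qed.

(** Convexity along the antidiagonals, i.e. in the number of successes for a fixed number of
    trials. *)
Definition dconvex a := forall k b, 2 * a k.+1 b.+1 <= a k.+2 b + a k b.+2.

(* Replacing a pair x < p < y by p, x + y - p keeps the sum and increases x y,
   whose coefficient in pb is a second difference of a. *)
Lemma pb_hoeffding a s p : dconvex a -> all in01 s -> in01 p ->
  \sum_(x <- s) x = (size s)%:R * p -> pb a s <= pb a (nseq (size s) p).
Proof.
have [N sN] : exists N, size s = N by exists (size s).
rewrite sN; elim: N a s sN => [|N IH] a s sN ca s01 p01 sums.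
  by rewrite (size0nil sN).
have IHp s' : size s' = N -> all in01 s' -> \sum_(x <- s') x = N%:R * p ->
    pb a (p :: s') <= pb a (nseq N.+1 p).
  move=> s'N s'01 sums'; have /andP[p0 p1] := p01; rewrite /=; rewrite -s'N lerD// ler_wpM2l ?subr_ge0//.
  - by rewrite s'N; apply: IH => // k b; apply: ca.
  - by rewrite s'N; apply: IH => // k b; apply: ca.
case: s sN s01 sums => [//|x s] /= [sN] /andP[x01 s01]; rewrite big_cons => sums.
have [xp|xp] := eqVneq x p.
  by rewrite xp; apply: (IHp s) => //; apply: (addrI p); rewrite -{1}xp sums -natr1; ring.
(* The deviations from [p] over [s] sum to [p - x], so they cannot all have the strict sign of
   [x - p]. *)
have [y ys yp] : exists2 y, y \in s & 0 <= (p - x) * (y - p).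
  apply/not_exists2P => H.
  have {}H y : y \in s -> (p - x) * (y - p) < 0.
    by move=> ys; have [//|h] := H y; rewrite ltNge; apply/negP.
  have : (p - x) * (\sum_(y <- s) (y - p)) <= 0.
    by rewrite mulr_sumr big_seq; apply: sumr_le0 => y /H /ltW.
  rewrite sumrB big_const_seq count_predT iter_addr_0 sN -mulr_natl.
  have -> : \sum_(y <- s) y = N.+1%:R * p - x by rewrite -sums; ring.
  rewrite -natr1 [X in _ * X](_ : _ = p - x); last by ring.
  rewrite leNgt (_ : _ * _ = (p - x) ^+ 2); last by ring.
  by rewrite exprn_even_gt0//= subr_eq0 eq_sym xp.
rewrite (pb_rem _ _ _ ys) (pb_rem (fun k b => a k b.+1) _ _ ys).
set t := rem y s.
have tN : (size t).+1 = N by rewrite size_rem// prednK//; move: ys; case: (s).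
have y01 : in01 y by move/allP: s01; apply.
have t01 : all in01 t by apply/allP => z /mem_rem; move/allP: s01; apply.
have ts : x + y + \sum_(z <- t) z = N.+1%:R * p.
  by rewrite -sums (perm_big _ (perm_to_rem ys)) big_cons addrA.
rewrite -[X in X <= _]/(pb a (x :: y :: t)).
(* [x + y - p] lies between [x] and [y] because [p] does. *)
have z01 : in01 (x + y - p).
  move: x01 y01 p01; rewrite /in01 !inE /= => /andP[? ?] /andP[? ?] /andP[? ?].
  by apply/andP; split; nra.
apply: le_trans (IHp ((x + y - p) :: t) _ _ _); last 3 first.
- by rewrite /= tN.
- by rewrite /= t01 andbT.
- by rewrite big_cons; move: ts; rewrite -natr1 mulrDl mul1r => /eqP; rewrite -subr_eq => /eqP <-; ring.
have C : 0 <= pb (fun k b => a k.+2 b + a k b.+2 - 2 * a k.+1 b.+1) t.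
  by apply: pb_ge0 => // k b; rewrite subr_ge0.
have E : pb (fun k b => a k.+2 b + a k b.+2 - 2 * a k.+1 b.+1) t =
    pb (fun k b => a k.+2 b) t + pb (fun k b => a k b.+2) t - 2 * pb (fun k b => a k.+1 b.+1) t.
  rewrite (_ : (fun k b => _) = (fun k b => 1 * (1 * a k.+2 b + 1 * a k b.+2) + (-2) * a k.+1 b.+1)).
    by rewrite !pb_lin; ring.
  by apply/funext => k; apply/funext => b; ring.
rewrite /= -subr_ge0.
set A := pb (fun k b => a k.+2 b) t in E *; set B := pb (fun k b => a k b.+2) t in E *.
set D := pb (fun k b => a k.+1 b.+1) t in E *.
rewrite (_ : _ - _ = (p - x) * (y - p) * (A + B - 2 * D)); last by ring.
by rewrite mulr_ge0// -E.
Qed.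

End pb.

(** * Krichevsky-Trofimov probabilities against Bernoulli likelihoods *)

Section krichevsky_trofimov.
Context {R : realType}.
Implicit Types (k b N : nat) (p q c d x y : R) (s : seq R).

(** The Pochhammer symbol (1/2)_k = Gamma(k + 1/2) / Gamma(1/2). *)
Definition hrise k : R := \prod_(i < k) (i%:R + 2^-1).

(* The Beta(1/2,1/2) mixture of the probabilities p^k (1-p)^b of a binary
   sequence with k ones and b zeros (Krichevsky-Trofimov). *)
Definition KT k b : R := hrise k * hrise b / (k + b)`!%:R.

Lemma hriseS k : hrise k.+1 = hrise k * (k%:R + 2^-1).
Proof. by rewrite /hrise big_ord_recr. Qed.

Lemma hrise_gt0 k : 0 < hrise k.
Proof. by apply: prodr_gt0 => i _; rewrite ltr_wpDl. Qed.

Lemma factR_gt0 k : 0 < k`!%:R :> R.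
Proof. by rewrite ltr0n fact_gt0. Qed.

Lemma hrise_fact k : hrise k * 4 ^+ k * k`!%:R = (k.*2)`!%:R.
Proof.
elim: k => [|k IH]; first by rewrite /hrise big_ord0 fact0 expr0 !mulr1.
rewrite doubleS !factS !natrM -IH hriseS exprS -muln2.
by rewrite -!natr1 natrM; field.
Qed.

(** Turns the Pochhammer product in [KT] into binomial coefficients, where [bin_double] applies. *)
Lemma hrise_bin k b :
  hrise k * hrise b * 'C((k + b).*2, k.*2)%:R = hrise (k + b) * 'C(k + b, k)%:R.
Proof.
have H1 := bin_fact (leq_addr b k); rewrite addKn in H1.
have H2 : ('C((k + b).*2, k.*2) * ((k.*2)`! * (b.*2)`!) = ((k + b).*2)`!)%N.
  by rewrite -(bin_fact (_ : k.*2 <= (k + b).*2)%N) -?doubleB ?addKn// leq_double leq_addr.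
have {H1}H1 : 'C(k + b, k)%:R * (k`!%:R * b`!%:R) = (k + b)`!%:R :> R by rewrite -!natrM H1.
have {H2} : 'C((k + b).*2, k.*2)%:R * ((k.*2)`!%:R * (b.*2)`!%:R) = ((k + b).*2)`!%:R :> R.
  by rewrite -!natrM H2.
rewrite -!hrise_fact -H1 exprD => H2.
have P : k`!%:R * b`!%:R * (4 ^+ k * 4 ^+ b) != 0 :> R.
  by rewrite !mulf_neq0 ?expf_neq0 ?(gt_eqF (factR_gt0 _))// pnatr_eq0.
by apply: (mulIf P); rewrite [RHS](_ : _ = hrise (k + b) * (4 ^+ k * 4 ^+ b) * ('C(k + b, k)%:R * (k`!%:R * b`!%:R))); [rewrite -H2; ring | ring].
Qed.

(** The constant [2 sqrt N] originates here: [hrise N / N!] is the central binomial probability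
    C(2N, N) / 4^N, which is at least [1 / (2 sqrt N)]. The squared inequality is an equality at N =
    1 and propagates since (N + 1/2)^2 exceeds N (N + 1) by 1/4. *)
Lemma hrise_sqrt N : (0 < N)%N -> N`!%:R <= 2 * Num.sqrt N%:R * hrise N.
Proof.
move=> N0; rewrite -(@ler_pXn2r _ 2%N)// ?nnegrE ?ler0n//; last first.
  by rewrite !mulr_ge0 ?sqrtr_ge0 ?(ltW (hrise_gt0 _)).
rewrite !exprMn sqr_sqrtr ?ler0n//.
case: N N0 => [//|N _]; elim: N => [|N IH].
  rewrite hriseS /hrise big_ord0 factS fact0 !mul1r expr1n add0r.
  by rewrite mulr1 -exprMn mulfV ?expr1n.
rewrite factS natrM exprMn hriseS exprMn.
apply: le_trans (ler_wpM2l (sqr_ge0 _) IH) _.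
set h := hrise _ ^+ 2; have h0 : 0 <= h by rewrite sqr_ge0.
rewrite -subr_ge0.
rewrite -[N.+2%:R]natr1 -[N.+1%:R]natr1; set u := N%:R.
have u0 : 0 <= u :> R by rewrite ler0n.
rewrite (_ : _ - _ = (u + 2) * h); last by field.
by rewrite mulr_ge0// addr_ge0.
Qed.

Lemma expn_le_KT k b : (0 < k + b)%N ->
  k%:R ^+ k * b%:R ^+ b <= 2 * Num.sqrt (k + b)%:R * KT k b * (k + b)%:R ^+ (k + b).
Proof.
move=> N0; set N := (k + b)%N.
have B : 0 < 'C(N.*2, k.*2)%:R :> R.
  by rewrite ltr0n bin_gt0 leq_double leq_addr.
rewrite -(ler_pM2l B).
apply: (@le_trans _ _ ('C(N, k)%:R * N%:R ^+ N)).
  by have := bin_double k b; rewrite -(ler_nat R) !natrM !natrX.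
have E : 'C(N.*2, k.*2)%:R * KT k b = hrise N / N`!%:R * 'C(N, k)%:R.
  by rewrite /KT -/N mulrC mulrAC hrise_bin mulrAC.
rewrite [leRHS](_ : _ = 2 * Num.sqrt N%:R * ('C(N.*2, k.*2)%:R * KT k b) * N%:R ^+ N); last by ring.
rewrite E -subr_ge0.
rewrite (_ : _ - _ = (2 * Num.sqrt N%:R * hrise N / N`!%:R - 1) * ('C(N, k)%:R * N%:R ^+ N)); last by ring.
rewrite mulr_ge0// ?mulr_ge0// ?exprn_ge0// subr_ge0 ler_pdivlMr ?factR_gt0// mul1r.
exact: hrise_sqrt.
Qed.

(** This is [1 + t <= e^t] at [t = x / k - 1]. Used for both factors of a likelihood with [x = N q]
    and [x = N (1 - q)], the exponents cancel, which shows that [q = k / N] maximises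
    [q^k (1 - q)^b]. *)
Lemma expr_le_expR k x : 0 <= x -> x ^+ k <= k%:R ^+ k * expR (x - k%:R).
Proof.
move=> x0; case: k => [|k]; first by rewrite !expr0 subr0 mul1r -expR0 ler_expR.
have k0 : 0 < k.+1%:R :> R by rewrite ltr0n.
have H : x / k.+1%:R <= expR (x / k.+1%:R - 1).
  by have := expR_ge1Dx (x / k.+1%:R - 1); rewrite addrC subrK.
have {H} : (x / k.+1%:R) ^+ k.+1 <= expR (x / k.+1%:R - 1) ^+ k.+1.
  by rewrite lerXn2r// ?nnegrE ?divr_ge0// ?expR_ge0// ltW.
rewrite -expRM_natl exprMn exprVn ler_pdivrMr ?exprn_gt0// mulrC.
by rewrite -mulr_natl mulrBr mulr1 mulrCA mulfV ?mulr1// gt_eqF.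
Qed.

Lemma bernoulli_le_KT k b q : (0 < k + b)%N -> 0 <= q <= 1 ->
  q ^+ k * (1 - q) ^+ b <= 2 * Num.sqrt (k + b)%:R * KT k b.
Proof.
move=> N0 /andP[q0 q1]; set N := (k + b)%N.
have NR : 0 < N%:R :> R by rewrite ltr0n.
have P : 0 < N%:R ^+ N :> R by rewrite exprn_gt0.
rewrite -(ler_pM2r P); apply: le_trans (expn_le_KT _ _ N0).
rewrite [leLHS](_ : _ = (N%:R * q) ^+ k * (N%:R * (1 - q)) ^+ b); last by rewrite !exprMn /N exprD; ring.
have H1 := expr_le_expR k (N%:R * q) (mulr_ge0 (ltW NR) q0).
have H2 : (N%:R * (1 - q)) ^+ b <= b%:R ^+ b * expR (N%:R * (1 - q) - b%:R).
  by apply: expr_le_expR; rewrite mulr_ge0 ?(ltW NR) ?subr_ge0.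
apply: (@le_trans _ _ (k%:R ^+ k * expR (N%:R * q - k%:R) * (b%:R ^+ b * expR (N%:R * (1 - q) - b%:R)))).
  by apply: ler_pM => //; rewrite exprn_ge0// mulr_ge0 ?subr_ge0 ?(ltW NR).
rewrite mulrACA -expRD (_ : _ + _ = 0); last by rewrite /N natrD; ring.
by rewrite expR0 mulr1.
Qed.

(** Consistency of a sequential predictor: after [k] ones and [b] zeros the next symbol is a one
    with probability [(k + 1/2) / (k + b + 1)] and a zero with the complementary probability. *)
Lemma KT_split k b : KT k.+1 b + KT k b.+1 = KT k b.
Proof.
rewrite /KT !addnS addSn factS natrM !hriseS.
have H : (k + b).+1%:R = (k%:R + 2^-1) + (b%:R + 2^-1) :> R by rewrite -natr1 natrD; field.
have NZ : (k%:R + 2^-1) + (b%:R + 2^-1) != 0 :> R by rewrite -H pnatr_eq0.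
have FZ : (k + b)`!%:R != 0 :> R by rewrite gt_eqF// factR_gt0.
rewrite H; field; rewrite FZ/=.
by rewrite (_ : _ + _ = 2 * ((k%:R + 2^-1) + (b%:R + 2^-1))) ?mulf_neq0//; field.
Qed.

(** The likelihood ratio of the Krichevsky-Trofimov mixture to Bernoulli(p) trials. *)
Definition KTratio p k b : R := KT k b / (p ^+ k * (1 - p) ^+ b).

Lemma KT_ge0 k b : 0 <= KT k b.
Proof. by rewrite /KT !mulr_ge0 ?invr_ge0 ?ler0n// ltW// hrise_gt0. Qed.

Lemma KTratio_ge0 p k b : 0 <= p <= 1 -> 0 <= KTratio p k b.
Proof. by move=> /andP[p0 p1]; rewrite divr_ge0 ?KT_ge0// mulr_ge0// exprn_ge0// subr_ge0. Qed.

Lemma pb_KTratio p N : 0 < p < 1 -> pb (KTratio p) (nseq N p) = 1.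
Proof.
move=> /andP[p0 p1].
have p0' : p != 0 by rewrite gt_eqF. have q0' : 1 - p != 0 by rewrite gt_eqF// subr_gt0.
(* Generalised to a start after [k] ones and [b] zeros, so that [KT_split] supplies the induction
   step. *)
suff H k b : pb (fun i j => KT (k + i) (b + j) / (p ^+ i * (1 - p) ^+ j)) (nseq N p) = KT k b.
  by rewrite /KTratio [LHS](H 0%N 0%N) /KT /hrise !big_ord0 fact0 !mulr1 divr1.
elim: N k b => [|N IH] k b /=; first by rewrite !addn0 !expr0 mulr1 divr1.
rewrite -KT_split -(IH k.+1 b) -(IH k b.+1).
set A := pb _ _; set B := pb _ _; set A' := pb _ _; set B' := pb _ _.
have -> : A' = p * A.
  (* The zero term only brings the scalar multiple into the two-term form of [pb_lin]. *)
  rewrite [RHS](_ : _ = p * A + 0 * A); last by rewrite mul0r addr0.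
  rewrite -pb_lin; congr pb.
  apply/funext => i; apply/funext => j; rewrite addSnnS exprS; field.
  by rewrite p0' !expf_neq0.
have -> // : B' = (1 - p) * B.
rewrite [RHS](_ : _ = (1 - p) * B + 0 * B); last by rewrite mul0r addr0.
rewrite -pb_lin; congr pb.
apply/funext => i; apply/funext => j; rewrite addSnnS exprS; field.
by rewrite q0' !expf_neq0.
Qed.

Lemma dconvex_KTratio p : 0 < p < 1 -> dconvex (KTratio p).
Proof.
move=> /andP[p0 p1] k b; rewrite -subr_ge0 /KTratio /KT !hriseS !addnS !addSn.
have q0 : 0 < 1 - p by rewrite subr_gt0.
have h0 : 0 <= hrise k * hrise b / ((k + b).+2)`!%:R / (p ^+ k * (1 - p) ^+ b).
  by rewrite !mulr_ge0 ?invr_ge0 ?mulr_ge0 ?ler0n ?(ltW (hrise_gt0 _)) ?exprn_ge0// ltW.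
set u := k%:R; set v := b%:R; rewrite -[k.+1%:R]natr1 -[b.+1%:R]natr1 -/u -/v.
have u0 : 0 <= u :> R by rewrite ler0n.
have v0 : 0 <= v :> R by rewrite ler0n.
set c := (2^-1 : R). have c0 : 0 < c by rewrite /c invr_gt0.
set P := p^-1. set Q := (1 - p)^-1.
have P0 : 0 < P by rewrite invr_gt0. have Q0 : 0 < Q by rewrite invr_gt0.
(* The second difference, divided by its common positive factor, is a square plus two non-negative
   terms; these come from [(u + c)(u + c + 1) = (u + c)^2 + (u + c)]. *)
rewrite [X in 0 <= X](_ : _ = hrise k * hrise b / ((k + b).+2)`!%:R / (p ^+ k * (1 - p) ^+ b) *
  (((u + c) * P - (v + c) * Q) ^+ 2 + (u + c) * P ^+ 2 + (v + c) * Q ^+ 2)).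
  by rewrite mulr_ge0// !addr_ge0 ?sqr_ge0 ?mulr_ge0 ?sqr_ge0// ?addr_ge0// ltW.
rewrite /P /Q !exprS !invfM; ring.
Qed.

Definition klr q p : R := q * ln (q / p) + (1 - q) * ln ((1 - q) / (1 - p)).

(** Weighted AM-GM, from the tangent line of [ln] at the mean [m]. *)
Lemma expR_convex x c d : 0 <= x <= 1 -> 0 < c -> 0 < d ->
  expR (x * ln c + (1 - x) * ln d) <= x * c + (1 - x) * d.
Proof.
move=> /andP[x0 x1] c0 d0; set m := x * c + (1 - x) * d.
have m0 : 0 < m.
  have [x_0|xn0] := eqVneq x 0; first by rewrite /m x_0; lra.
  by rewrite ltr_pwDl ?mulr_gt0 ?mulr_ge0 ?subr_ge0// ?lt_def ?xn0// ltW.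
have H c' : 0 < c' -> ln c' <= ln m + (c' / m - 1).
  move=> c'0; rewrite -lerBlDl -ln_div ?posrE//.
  have := @le_ln1Dx R (c' / m - 1); rewrite addrCA subrr addr0; apply.
  by rewrite ltrBrDl subrr divr_gt0.
rewrite -[leRHS]lnK ?posrE// ler_expR.
have h1 := ler_wpM2l x0 (H c c0).
have h2 : (1 - x) * ln d <= (1 - x) * (ln m + (d / m - 1)) by rewrite ler_wpM2l ?subr_ge0// H.
apply: le_trans (lerD h1 h2) _; rewrite le_eqVlt; apply/orP; left; apply/eqP.
have mE : x * c + (1 - x) * d = m by [].
have E : x * (ln m + (c / m - 1)) + (1 - x) * (ln m + (d / m - 1)) = ln m + ((x * c + (1 - x) * d) / m - 1).
  by clearbody m; ring.
by rewrite E mE mulfV ?subrr ?addr0// gt_eqF.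
Qed.

Lemma expR_klr_le s q p : (0 < size s)%N -> all in01 s ->
  \sum_(x <- s) x = (size s)%:R * q -> 0 < q < 1 -> 0 < p < 1 ->
  expR ((size s)%:R * klr q p) <= 2 * Num.sqrt (size s)%:R * pb (KTratio p) s.
Proof.
move=> s0 s01 sums /andP[q0 q1] /andP[p0 p1].
set c := q / p; set d := (1 - q) / (1 - p).
have c0 : 0 < c by rewrite divr_gt0. have d0 : 0 < d by rewrite divr_gt0 ?subr_gt0.
apply: (@le_trans _ _ (\prod_(x <- s) (x * c + (1 - x) * d))).
  have -> : (size s)%:R * klr q p = \sum_(x <- s) (x * ln c + (1 - x) * ln d).
    rewrite big_split/= -!mulr_suml sumrB sums big_const_seq count_predT iter_addr_0.
    by rewrite -mulr_natl /klr -/c -/d; ring.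
  rewrite expR_sum !big_seq; apply: ler_prod => x xs; rewrite expR_ge0/=.
  by apply: expR_convex => //; move/allP: s01 => /(_ _ xs).
rewrite -pb_prod.
rewrite [leRHS](_ : _ = pb (fun k b => (2 * Num.sqrt (size s)%:R) * KTratio p k b + 0 * KTratio p k b) s); last first.
  by rewrite pb_lin mul0r addr0.
apply: pb_le => // k b kb; rewrite mul0r addr0.
have N0 : (0 < k + b)%N by rewrite kb.
rewrite /c /d !exprMn !exprVn mulrACA -invfM /KTratio mulrA.
rewrite ler_wpM2r ?invr_ge0 ?mulr_ge0 ?exprn_ge0 ?subr_ge0 ?(ltW p0) ?(ltW p1)//.
by rewrite -kb; apply: bernoulli_le_KT => //; rewrite !ltW.
Qed.

Lemma pb_KTratio_le1 s p : all in01 s -> 0 < p < 1 ->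
  \sum_(x <- s) x = (size s)%:R * p -> pb (KTratio p) s <= 1.
Proof.
move=> s01 p01 sums; rewrite -(pb_KTratio _ (size s) p01).
apply: pb_hoeffding => //; first exact: dconvex_KTratio.
by case/andP: p01 => *; rewrite /in01 inE/= !ltW.
Qed.

End krichevsky_trofimov.

(** * Finite expansion of [pb], affine minorants of kl and the inverse kl *)

Section kl_affine.
Context {R : realType}.
Implicit Types (N : nat) (p q c d : R).

(** Integrals can then be taken term by term and each factor replaced by its mean. The list [L] is
    chosen before [a] and [x], both of which will depend on the random tasks. *)
Lemma pb_expand (T : eqType) (r : seq T) : uniq r ->
  exists L : seq (nat * nat * (T -> bool)),
    {in L, forall l, (l.1.1 + l.1.2 = size r)%N} /\
    forall (a : nat -> nat -> R) (x : T -> R),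
    pb a [seq x j | j <- r] =
    \sum_(l <- L) a l.1.1 l.1.2 * \prod_(j <- r) (if l.2 j then x j else 1 - x j).
Proof.
elim: r => [|i r IH] /=.
  move=> _; exists [:: (0%N, 0%N, xpredT)]; split=> [l|a x]; first by rewrite inE => /eqP ->.
  by rewrite big_seq1 big_nil mulr1.
move=> /andP[ir ur]; have [L [Lr LE]] := IH ur.
pose upd (e : T -> bool) v := fun j => if j == i then v else e j.
exists ([seq (l.1.1.+1, l.1.2, upd l.2 true) | l <- L] ++
        [seq (l.1.1, l.1.2.+1, upd l.2 false) | l <- L]); split.
  move=> l; rewrite mem_cat => /orP[] /mapP[l' l'L ->] /=; rewrite ?addnS ?addSn; congr S; exact: Lr.
move=> a x; rewrite big_cat !big_map/= !LE !mulr_sumr.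
have E e v : \prod_(j <- i :: r) (if upd e v j then x j else 1 - x j) =
    (if v then x i else 1 - x i) * \prod_(j <- r) (if e j then x j else 1 - x j).
  rewrite big_cons {1}/upd eqxx; congr (_ * _).
  apply: eq_big_seq => j jr; rewrite /upd; case: eqP => // ji.
  by move: ir; rewrite -ji jr.
by congr (_ + _); apply: eq_bigr => l _; rewrite E mulrCA.
Qed.

(* For fixed c, d > 0 this is an affine minorant of (q, p) |-> kl(q|p), and kl
   is the supremum of these minorants. *)
Definition kl_aff c d q p := q * ln c - c * p + (1 - q) * ln d - d * (1 - p) + 1.

(** [ln z <= z - 1] at [z = c p / q] and at [z = d (1 - p) / (1 - q)]; equality holds for
    [c = q / p] and [d = (1 - q) / (1 - p)]. *)
Lemma kl_aff_le_klr c d q p : 0 < c -> 0 < d -> 0 < q < 1 -> 0 < p < 1 ->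
  kl_aff c d q p <= klr q p.
Proof.
move=> c0 d0 /andP[q0 q1] /andP[p0 p1].
have H (c' x y : R) : 0 < c' -> 0 < x -> 0 < y -> x * ln c' + x - c' * y <= x * ln (x / y).
  move=> c'0 x0 y0; rewrite -subr_ge0.
  have [xn0 yn0] : x != 0 /\ y != 0 by rewrite !gt_eqF.
  have z0 : 0 < c' * y / x by rewrite divr_gt0 ?mulr_gt0.
  have : ln (c' * y / x) <= c' * y / x - 1.
    by have := @le_ln1Dx R (c' * y / x - 1); rewrite addrCA subrr addr0; apply; rewrite ltrBrDl subrr.
  have -> : ln (c' * y / x) = ln c' - ln (x / y).
    by rewrite -ln_div ?posrE ?divr_gt0//; congr ln; field; rewrite xn0 yn0.
  move=> /(ler_wpM2l (ltW x0)); rewrite [X in _ <= X](_ : _ = c' * y - x) => [h|]; last by field.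
  by rewrite -(lerD2l (x * (ln c' - ln (x / y)))) addr0; apply: le_trans h _;
    rewrite le_eqVlt; apply/orP; left; apply/eqP; ring.
have h1 := H c q p c0 q0 p0.
have h2 : (1 - q) * ln d + (1 - q) - d * (1 - p) <= (1 - q) * ln ((1 - q) / (1 - p)).
  by apply: H; rewrite ?subr_gt0.
by rewrite /kl_aff /klr; lra.
Qed.

Lemma klbin_diag q : 0 <= q <= 1 -> klbin q q = 0%E.
Proof.
move=> /andP[q0 q1]; have H x : 0 <= x -> xlogxy x x = 0%E :> \bar R.
  rewrite /xlogxy => x0; have [//|xn0] := eqVneq x 0.
  by rewrite divff// ln1 mulr0.
by rewrite /klbin !H ?subr_ge0// adde0.
Qed.

(** Only [p > q'] needs an argument, and there the optimal slopes satisfy [c <= 1 <= d]. For such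
    slopes the minorant decreases in [q], so [q] may be raised to [q']; this is what allows one
    inverse kl to be inserted into another. *)
Lemma le_klinv N q q' p (b : \bar R) : (0 < N)%N -> 0 <= q -> q <= q' -> q' <= 1 ->
  0 <= p <= 1 -> (0 <= b)%E ->
  (forall c d, 0 < c <= 1 -> 1 <= d -> ((N%:R * kl_aff c d q p)%:E <= b)%E) ->
  p <= klinv N q' b.
Proof.
move=> N0 q0 qq' q'1 /andP[p0 p1] b0 H.
have q'0 : 0 <= q' by apply: le_trans qq'.
have NR : 0 < N%:R :> R by rewrite ltr0n.
set S := [set p : R | 0 <= p <= 1 /\ (N%:R%:E * klbin q' p <= b)%E].
have hS : has_sup S.
  split; first by exists q'; rewrite /S /= q'0 q'1 klbin_diag ?q'0// mule0.
  by exists 1 => x [/andP[]].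
have ubS x : S x -> x <= sup S by move=> Sx; apply: sup_upper_bound.
(* [q'] itself belongs to the set because kl(q'|q') = 0, which settles [p <= q']. *)
rewrite /klinv -/S; have [pq'|q'p] := leP p q'.
  by apply: le_trans pq' _; apply: ubS; rewrite /S /= q'0 q'1 klbin_diag ?q'0// mule0.
apply: ubS; split; first by rewrite p0 p1.
case: b b0 H S hS => [r|//|//] r0 H _ _; last by rewrite leey.
have {}H c d : 0 < c <= 1 -> 1 <= d -> N%:R * kl_aff c d q' p <= r.
  move=> cc dd; move: (H c d cc dd); rewrite lee_fin; apply: le_trans.
  rewrite ler_pM2l// -subr_ge0 /kl_aff.
  rewrite [X in 0 <= X](_ : _ = (q' - q) * (ln d - ln c)); last by ring.
  case/andP: cc => c0 c1.
  by rewrite mulr_ge0 ?subr_ge0// ler_ln ?posrE ?(lt_le_trans ltr01 dd)// (le_trans c1).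
have q'lt1 : q' < 1 by apply: lt_le_trans p1.
have pp : 0 < p by apply: le_lt_trans q'p.
have q1 : 0 < 1 - q' by rewrite subr_gt0.
rewrite lee_fin in r0.
(* At [p = 1] and [c = 1] the scaled minorant is [N (1 - q') ln d]; the chosen [d] makes it [r + 1],
   above the bound [r]. *)
have p1' : p < 1.
  rewrite lt_neqAle p1 andbT; apply/eqP => pE.
  have := H 1 (expR ((r + 1) / (N%:R * (1 - q')))).
  rewrite ltr01 lexx -{1}expR0 ler_expR divr_ge0 ?addr_ge0 ?mulr_ge0 ?(ltW NR) ?(ltW q1)// => /(_ erefl erefl).
  rewrite /kl_aff expRK pE ln1 (_ : _ * _ = r + 1); first by lra.
  by field; rewrite !gt_eqF.
rewrite /klbin {2}/xlogxy !gt_eqF ?subr_gt0//.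
set d := (1 - q') / (1 - p).
have d1 : 1 <= d by rewrite ler_pdivlMr ?subr_gt0// mul1r lerB// ltW.
(* For [q' = 0] the optimal slope [c = q' / p] is zero and not admissible; a small [c] loses at most
   [e]. *)
have [q'E|q'N] := eqVneq q' 0.
  rewrite /xlogxy q'E eqxx add0e -EFinM lee_fin subr0 mul1r.
  apply/ler_addgt0Pr => e e0.
  pose c := Num.min 1 (e / N%:R).
  have c0 : 0 < c by rewrite lt_min ltr01 divr_gt0.
  have := H c d; rewrite c0 ge_min lexx d1 => /(_ erefl erefl).
  rewrite /kl_aff q'E subr0 mul0r mul1r {2}/d q'E subr0 mul1r mulVf ?gt_eqF ?subr_gt0//.
  rewrite /d q'E subr0 => h.
  have : N%:R * (c * p) <= e.
    have : c <= e / N%:R by rewrite ge_min lexx orbT.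
    rewrite ler_pdivlMr// mulrC => h'; apply: le_trans h'.
    by rewrite ler_pM2l// ler_piMr// ltW.
  by move: h; rewrite mulrDr; lra.
rewrite /xlogxy (negbTE q'N) gt_eqF// -EFinD -EFinM lee_fin.
have q'pos : 0 < q' by rewrite lt_def q'N.
have := H (q' / p) d; rewrite divr_gt0//= ler_pdivrMr// mul1r (ltW q'p) d1 => /(_ erefl erefl).
apply: le_trans; rewrite ler_pM2l// /kl_aff.
rewrite {2}/d !mulfVK ?gt_eqF ?subr_gt0//.
by rewrite /d; lra.
Qed.

End kl_affine.

(** * Bounded measurable functions and the Donsker-Varadhan inequality *)

Section bounded_measurable.
Context d (T : measurableType d) (R : realType).
Implicit Types (f g : T -> R).

(** Closed under the algebra used below and integrable against every finite measure, so real-valued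
    integrals can be manipulated without separate integrability conditions. *)
Definition bmf f := measurable_fun [set: T] f /\ exists c, forall x, `|f x| <= c.

Lemma bmf_cst (c : R) : bmf (fun=> c).
Proof. by split; [exact: measurable_cst|exists `|c|]. Qed.

Lemma bmf01 f : measurable_fun [set: T] f -> (forall x, 0 <= f x <= 1) -> bmf f.
Proof.
move=> mf f01; split=> //; exists 1 => x; have /andP[f0 f1] := f01 x.
by rewrite ger0_norm.
Qed.

Lemma bmfD f g : bmf f -> bmf g -> bmf (fun x => f x + g x).
Proof.
move=> [mf [c fc]] [mg [c' gc]]; split; first exact: measurable_funD.
by exists (c + c') => x; rewrite (le_trans (ler_normD _ _))// lerD.
Qed.

Lemma bmfM f g : bmf f -> bmf g -> bmf (fun x => f x * g x).
Proof.
move=> [mf [c fc]] [mg [c' gc]]; split; first exact: measurable_funM.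
by exists (c * c') => x; rewrite normrM ler_pM.
Qed.

Lemma bmfZ (c : R) f : bmf f -> bmf (fun x => c * f x).
Proof. by move=> bf; apply: bmfM => //; exact: bmf_cst. Qed.

Lemma bmfB f g : bmf f -> bmf g -> bmf (fun x => f x - g x).
Proof.
move=> bf bg; have := bmfD _ _ bf (bmfZ (-1) _ bg).
by under eq_fun do rewrite mulN1r.
Qed.

Lemma bmf_sum I (r : seq I) (P : pred I) (F : I -> T -> R) :
  (forall i, bmf (F i)) -> bmf (fun x => \sum_(i <- r | P i) F i x).
Proof.
move=> bF; elim: r => [|i r IH].
  by under eq_fun do rewrite big_nil; exact: bmf_cst.
by under eq_fun do rewrite big_cons; case: (P i) => //; exact: bmfD.
Qed.

Lemma bmf_prod I (r : seq I) (P : pred I) (F : I -> T -> R) :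
  (forall i, bmf (F i)) -> bmf (fun x => \prod_(i <- r | P i) F i x).
Proof.
move=> bF; elim: r => [|i r IH].
  by under eq_fun do rewrite big_nil; exact: bmf_cst.
by under eq_fun do rewrite big_cons; case: (P i) => //; exact: bmfM.
Qed.

Lemma bmf_indic (A : set T) : measurable A -> bmf (fun x => \1_A x).
Proof. by move=> mA; apply: bmf01 => [|x]; rewrite ?indicE ?ler0n ?lern1 ?leq_b1//; exact: measurable_indic. Qed.

Lemma bmf_expR f : bmf f -> bmf (fun x => expR (f x)).
Proof.
move=> [mf [c fc]]; split; first exact: measurableT_comp.
by exists (expR c) => x; rewrite ger0_norm ?expR_ge0// ler_expR (le_trans (ler_norm _)).
Qed.

End bounded_measurable.

Arguments bmf {d T R} f.

Lemma bmf_comp d1 d2 (X : measurableType d1) (Y : measurableType d2) (R : realType)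
  (f : Y -> R) (g : X -> Y) : bmf f -> measurable_fun [set: X] g -> bmf (f \o g).
Proof. by move=> [mf [c fc]] mg; split; [exact: measurableT_comp|exists c => x /=]. Qed.

Section expectation.
Context d (T : measurableType d) (R : realType) (mu : {finite_measure set T -> \bar R}).
Implicit Types (f g : T -> R).

Lemma bmf_integrable f : bmf f -> mu.-integrable setT (EFin \o f).
Proof.
move=> [mf [c fc]]; apply: measurable_bounded_integrable => //.
  exact: fin_num_fun_lty (fin_num_measure mu).
exists c; split; first by rewrite num_real.
by move=> M cM x _; apply: le_trans (ltW cM).
Qed.

Lemma EFin_Rint f : bmf f -> (\int[mu]_x f x)%:E = (\int[mu]_x (f x)%:E)%E.
Proof.
move=> bf; rewrite /Rintegral fineK//; by apply: (integrable_fin_num measurableT (bmf_integrable _ bf)).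
Qed.

Lemma RintD f g : bmf f -> bmf g ->
  \int[mu]_x (f x + g x) = \int[mu]_x f x + \int[mu]_x g x.
Proof. by move=> bf bg; apply: RintegralD => //; exact: bmf_integrable. Qed.

Lemma RintB f g : bmf f -> bmf g ->
  \int[mu]_x (f x - g x) = \int[mu]_x f x - \int[mu]_x g x.
Proof. by move=> bf bg; apply: RintegralB => //; exact: bmf_integrable. Qed.

Lemma RintZ (c : R) f : bmf f -> \int[mu]_x (c * f x) = c * \int[mu]_x f x.
Proof. by move=> bf; apply: RintegralZl => //; exact: bmf_integrable. Qed.

Lemma Rint_le f g : bmf f -> bmf g -> (forall x, f x <= g x) ->
  \int[mu]_x f x <= \int[mu]_x g x.
Proof. by move=> bf bg fg; apply: le_Rintegral => //; exact: bmf_integrable. Qed.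

Lemma Rint_sum I (r : seq I) (P : pred I) (F : I -> T -> R) : (forall i, bmf (F i)) ->
  \int[mu]_x (\sum_(i <- r | P i) F i x) = \sum_(i <- r | P i) \int[mu]_x F i x.
Proof.
move=> bF; elim: r => [|i r IH].
  rewrite big_nil; under eq_Rintegral do rewrite big_nil.
  by rewrite Rintegral_cst// mul0r.
rewrite big_cons; under eq_Rintegral do rewrite big_cons.
by case: (P i) => //; rewrite RintD ?IH//; exact: bmf_sum.
Qed.

Lemma Rint_indic (A : set T) : measurable A -> \int[mu]_x \1_A x = fine (mu A).
Proof. by move=> mA; rewrite /Rintegral integral_indic// setIT. Qed.

Lemma bounded_cvg_Rint (f_ : nat -> T -> R) f (c : R) :
  (forall n, measurable_fun setT (f_ n)) -> measurable_fun setT f ->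
  (forall n x, `|f_ n x| <= c) -> (forall x, f_ n x @[n --> \oo] --> f x) ->
  \int[mu]_x f_ n x @[n --> \oo] --> \int[mu]_x f x.
Proof.
move=> mf_ mf f_c f_f.
have [|||||_ _ cv] := @dominated_convergence _ _ _ mu setT measurableT
  (fun n x => (f_ n x)%:E) (EFin \o f) (cst c%:E).
- by move=> n; exact/measurable_EFinP.
- exact/measurable_EFinP.
- by apply: aeW => /= x _; apply: cvg_EFin; [exact: nearW|exact: f_f].
- exact: (bmf_integrable _ (bmf_cst _ _ _ c)).
- by apply: aeW => /= x n _; rewrite lee_fin.
have bf : bmf f.
  split => //; exists c => x; have cv' : `|f_ n x| @[n --> \oo] --> `|f x| by apply: cvg_norm; exact: f_f.
  rewrite -(cvg_lim _ cv')//; apply: limr_le; first by apply/cvg_ex; eexists; exact: cv'.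
  exact: nearW.
rewrite /Rintegral; apply: fine_cvg; rewrite fineK//.
by rewrite -EFin_Rint.
Qed.

End expectation.

Section subprobability_expectation.
Context d (T : measurableType d) (R : realType) (mu : subprobability T R).

Lemma Rint01 (f : T -> R) : measurable_fun setT f -> (forall x, 0 <= f x <= 1) ->
  0 <= \int[mu]_x f x <= 1.
Proof.
move=> mf f01; apply/andP; split; first by apply: Rintegral_ge0 => x _; case/andP: (f01 x).
apply: (@le_trans _ _ (\int[mu]_x (cst 1 x))).
  by apply: Rint_le => [||x]; [exact: bmf01|exact: bmf_cst|case/andP: (f01 x)].
rewrite Rintegral_cst// mul1r -[leRHS]/(fine 1%E) fine_le//; last exact: sprobability_setT.
exact: fin_num_measure.
Qed.

End subprobability_expectation.

Lemma Rint_cst_prob d (T : measurableType d) (R : realType) (mu : probability T R) (c : R) :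
  \int[mu]_x c = c.
Proof.
rewrite Rintegral_cst// -[RHS]mulr1; congr (_ * _).
by rewrite -[RHS]/(fine 1%E); congr fine; exact: probability_setT. Qed.
(** The integral is built from suprema over simple functions below the positive and negative parts,
    so monotonicity holds without measurability. This matters for the average of [KL (fQ A) (fP A)],
    whose measurability in [A] is not established. *)
Lemma le_integral_total d (T : measurableType d) (R : realType) (mu : {measure set T -> \bar R})
  (f g : T -> \bar R) : (forall x, (f x <= g x)%E) -> (\int[mu]_x f x <= \int[mu]_x g x)%E.
Proof.
move=> fg; rewrite /integral; apply: leeB.
  apply: le_ereal_sup => _ [h /= hf <-]; exists h => //= x.
  by apply: le_trans (hf x) _; rewrite !patch_setT; rewrite !funeposE ge_max le_max fg/= le_max lexx orbT.
apply: le_ereal_sup => _ [h /= hf <-]; exists h => //= x.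
by apply: le_trans (hf x) _; rewrite !patch_setT; rewrite !funenegE ge_max le_max leeN2 fg/= le_max lexx orbT.
Qed.

(** The integral is that of [g] against the product of the Dirac mass at [x] with [kappa x];
    measurability in [x] then follows from that of the Giry product, unit and integral. *)
Lemma bmf_kernel_Rint d1 d2 (X : measurableType d1) (Y : measurableType d2) (R : realType)
  (kappa : X -> giry Y R) (g : X * Y -> R) : measurable_fun [set: X] kappa ->
  bmf g -> (forall z, 0 <= g z) ->
  bmf (fun x => \int[kappa x]_y g (x, y)).
Proof.
move=> mk bg g0; have [mg [c gc]] := bg.
have bgx x : bmf (fun y => g (x, y)).
  by split; [exact: measurableT_comp|exists c].
split; last first.
  exists c => x; have c0 : 0 <= c := le_trans (normr_ge0 _) (gc (x, point)).
  rewrite ger0_norm ?Rintegral_ge0//.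
  apply: (@le_trans _ _ (\int[kappa x]_y (cst c y))).
    by apply: Rint_le => [||y]; [exact: bgx|exact: bmf_cst|rewrite (le_trans (ler_norm _))].
  rewrite Rintegral_cst// ler_piMr// -[leRHS]/(fine 1%E) fine_le//; last exact: sprobability_setT.
  exact: fin_num_measure.
have -> : (fun x => \int[kappa x]_y g (x, y)) =
    fine \o (fun x => giry_int (giry_prod (giry_ret x : giry X R, kappa x)) (EFin \o g)).
  have mgE : measurable_fun [set: X * Y] (EFin \o g) by exact/measurable_EFinP.
  have gE0 z : (0 <= (EFin \o g) z)%E by rewrite lee_fin.
  apply/funext => x /=; rewrite (giry_int_prod1 _ _ mgE gE0).
  have -> : giry_int (giry_ret x : giry X R) = fun f => (\int[\d_x]_z f z)%E by [].
  rewrite integral_dirac//; first by rewrite diracT mul1e.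
  have := @measurable_fun_fubini_tonelli_F _ _ X Y R (kappa x) (EFin \o g).
  apply; first exact/measurable_EFinP.
  by move=> z; rewrite lee_fin.
apply: measurableT_comp => //.
apply: (@measurableT_comp _ _ _ _ _ _ (fun m => giry_int m (EFin \o g))).
  apply: measurable_giry_int; first exact/measurable_EFinP.
  by move=> z; rewrite lee_fin.
apply: (@measurableT_comp _ _ _ _ _ _ (@giry_prod _ _ X Y R)); first exact: measurable_giry_prod.
by apply/measurable_fun_pairP; split => //=; exact: measurable_giry_ret.
Qed.

Section donsker_varadhan.
Context d (T : measurableType d) (R : realType) (mu nu : probability T R).
Implicit Types phi : T -> R.

Lemma Rint_expR_gt0 phi : bmf phi -> 0 < \int[nu]_x expR (phi x).
Proof.
move=> [mphi [c phic]].
apply: (@lt_le_trans _ _ (\int[nu]_x expR (- c))).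
  by rewrite Rint_cst_prob expR_gt0.
apply: Rint_le; [exact: bmf_cst|by apply: bmf_expR; split => //; exists c|].
by move=> x; rewrite ler_expR lerNl (le_trans _ (phic x))// -normrN ler_norm.
Qed.

(** With [f] the density of [mu] with respect to [nu], integrate [ln t <= t - 1] at
    [t = e^phi / (f Z)] against [mu]. The integral of [t] is at most 1 since [e^phi / Z] has
    [nu]-integral 1, which leaves [phi - ln Z] as a lower bound for the integral of [ln f], possibly
    infinite. *)
Lemma donsker_varadhan phi : bmf phi ->
  ((\int[mu]_x phi x)%:E <= KL mu nu + (ln (\int[nu]_x expR (phi x)))%:E)%E.
Proof.
move=> bphi; have Z0 := Rint_expR_gt0 _ bphi.
set Z := \int[nu]_x expR (phi x) in Z0 *.
rewrite /KL; destruct (pselect (mu `<< nu)) as [numu|?]; last by rewrite addye// leey.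
pose g := Radon_Nikodym_SigmaFinite.f mu nu.
have g0 := Radon_Nikodym_SigmaFinite.f_ge0 numu.
have gfin := Radon_Nikodym_SigmaFinite.f_fin_num numu.
have ig := Radon_Nikodym_SigmaFinite.f_integrable numu.
rewrite -/g in g0 gfin ig.
have mg : measurable_fun setT g := measurable_int _ ig.
pose f x := fine (g x).
have f0 x : 0 <= f x by rewrite fine_ge0.
have mf : measurable_fun setT f by exact: measurableT_comp.
have cov h : (forall x, 0 <= h x)%E -> measurable_fun setT h ->
    (\int[nu]_x (h x * (f x)%:E) = \int[mu]_x h x)%E.
  move=> h0 mh; rewrite -(Radon_Nikodym_SigmaFinite.change_of_variables numu)//.
  by apply: eq_integral => x _; rewrite /f fineK.
(* The derivative in [KL] is that of a charge, determined only almost everywhere; [f] is a finite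
   non-negative version of it. *)
have -> : (\int[mu]_x (ln (fine (Radon_Nikodym (charge_of_finite_measure mu) nu x)))%:E = \int[mu]_x (ln (f x))%:E)%E.
  have m1 : measurable_fun setT (fun x => (ln (fine (Radon_Nikodym (charge_of_finite_measure mu) nu x)))%:E).
    apply/measurable_EFinP; apply: measurableT_comp => //; apply: measurableT_comp => //.
  have m2 : measurable_fun setT (fun x => (ln (f x))%:E).
    by apply/measurable_EFinP; apply: measurableT_comp.
  apply: ae_eq_integral => //; apply: (null_dominates_ae_eq _ numu) => //.
  have := ae_eq_Radon_Nikodym_SigmaFinite numu measurableT.
  by apply: filterS => x /= h _; rewrite /f /g -h.
(* The complement of [D] is [mu]-null. There [t] has no meaning and [ln 0 = 0] by convention, hence
   the indicators in [h] and in [key]. *)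
pose D := [set x | 0 < f x].
have mD : measurable D.
  have := mf measurableT _ (measurable_itv `]0, +oo[); rewrite setTI.
  by congr measurable; apply/seteqP; split => x /=; rewrite in_itv/= andbT.
(* h is the density of the Gibbs measure e^phi nu / Z with respect to mu. *)
pose h x := expR (phi x) * (\1_D x * expR (- ln (f x))) / Z.
have mh : measurable_fun setT h.
  apply: measurable_funM => //; apply: measurable_funM.
    by case: bphi => mphi _; apply: measurableT_comp.
  apply: measurable_funM; first exact: measurable_indic.
  by apply: measurableT_comp => //; apply: measurableT_comp => //; exact: measurableT_comp.
have h0 x : 0 <= h x by rewrite !mulr_ge0 ?expR_ge0 ?invr_ge0 ?indicE ?ler0n// ltW.
have ih1 : (\int[mu]_x (h x)%:E <= 1)%E.
  rewrite -cov; [|by move=> x; rewrite lee_fin|exact/measurable_EFinP].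
  apply: (@le_trans _ _ (\int[nu]_x (Z^-1 * expR (phi x))%:E)%E).
    apply: le_integral_total => x; rewrite -EFinM lee_fin /h mulrC.
    rewrite [leLHS](_ : _ = (\1_D x * (f x * expR (- ln (f x)))) * (Z^-1 * expR (phi x))); last by ring.
    rewrite ler_piMl ?mulr_ge0 ?invr_ge0 ?(ltW Z0) ?expR_ge0// indicE.
    have [|_] := boolP (x \in D); last by rewrite mul0r.
    by rewrite inE /D /= mul1r => fx; rewrite expRN lnK ?posrE// divff ?gt_eqF.
  rewrite -(EFin_Rint _ _ _ nu (fun x => Z^-1 * expR (phi x))); last first.
    by apply: bmfZ; exact: bmf_expR.
  by rewrite RintZ; [rewrite -/Z mulVf ?gt_eqF|exact: bmf_expR].
have ih : mu.-integrable setT (EFin \o h).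
  apply/integrableP; split; first exact/measurable_EFinP.
  under eq_integral => x _ do rewrite /= ger0_norm//.
  by apply: le_lt_trans ih1 _; rewrite ltry.
pose u x := phi x - ln Z + 1.
have bu : bmf u.
  by apply: bmfD; [apply: bmfB => //; exact: bmf_cst|exact: bmf_cst].
have muD : mu (~` D) = 0%E.
  have mDC : measurable (~` D) by exact: measurableC.
  have := cov (EFin \o \1_(~` D)) _ _.
  rewrite integral_indic// setIT => <-.
  - rewrite (_ : (fun x => _) = cst 0%E) ?integral_cst ?mul0e//.
    apply/funext => x /=; rewrite -EFinM; congr EFin.
    rewrite indicE; have [|_] := boolP (x \in ~` D); last by rewrite mul0r.
    by rewrite inE /D /= => /negP; rewrite -leNgt => fx0; rewrite (_ : f x = 0) ?mulr0//; apply/le_anti; rewrite fx0 f0.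
  - by move=> x; rewrite lee_fin indicE ler0n.
  - by apply/measurable_EFinP; exact: measurable_indic.
have key : (\int[mu]_x ((u x - h x)%:E) <= \int[mu]_x (ln (f x))%:E)%E.
  rewrite [leLHS](_ : _ = \int[mu]_x (((u x - h x) * \1_D x)%:E))%E; last first.
    have m1 : measurable_fun setT (fun x => (u x - h x)%:E).
      by apply/measurable_EFinP; apply: measurable_funB => //; exact: bu.1.
    have m2 : measurable_fun setT (fun x => ((u x - h x) * \1_D x)%:E).
      apply/measurable_EFinP; apply: measurable_funM; last exact: measurable_indic.
      by apply: measurable_funB => //; exact: bu.1.
    apply: ae_eq_integral => //.
    exists (~` D); split => //; first exact: measurableC.
    move=> x /= H Dx; apply: H => _; congr EFin.
    by rewrite indicE mem_set// mulr1.
  apply: le_integral_total => x; rewrite lee_fin indicE.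
  have [fx|fx] := pselect (D x); last first.
    rewrite memNset// mulr0 (_ : f x = 0) ?ln0//; apply/le_anti; rewrite f0 andbT leNgt.
    exact/negP.
  rewrite mem_set// mulr1 /u /h indicE mem_set// mul1r expRN lnK ?posrE//.
  have P : 0 < expR (phi x) / f x / Z by rewrite !divr_gt0// expR_gt0.
  have := @le_ln1Dx R (expR (phi x) / f x / Z - 1).
  rewrite addrCA subrr addr0 ltrBrDl subrr => /(_ P).
  rewrite ln_div ?posrE ?divr_gt0 ?expR_gt0// ln_div ?posrE ?expR_gt0// expRK; lra.
rewrite -leeBlDr//; apply: le_trans key.
under eq_integral do rewrite EFinB.
rewrite integralB_EFin//; last exact: bmf_integrable.
rewrite -EFin_Rint// (_ : Rintegral _ _ u = \int[mu]_x phi x - ln Z + 1); last first.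
  rewrite RintD; [|apply: bmfB => //; exact: bmf_cst|exact: bmf_cst].
  by rewrite RintB//; [rewrite !Rint_cst_prob|exact: bmf_cst].
rewrite EFinD -[leLHS]adde0 -addeA leeD2l// leeBrDr ?add0e//.
by rewrite fin_numElt (lt_le_trans (ltNyr 0)) ?(le_lt_trans ih1) ?ltry ?integral_ge0// => x _; rewrite lee_fin.
Qed.

Lemma KL_ge0 : (0 <= KL mu nu)%E.
Proof.
have := donsker_varadhan (cst 0) (bmf_cst _ _ _ 0).
by under [X in ln X]eq_Rintegral do rewrite expR0; rewrite !Rint_cst_prob ln1 adde0.
Qed.

End donsker_varadhan.

(** * Product rules for samples and tasks *)

Section level_approximation.
Context {R : realType}.
Implicit Types (L : nat) (x : R).

Definition lvl L x : R := (Num.truncn (L.+1%:R * x))%:R / L.+1%:R.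

Lemma lvl01 L x : 0 <= x <= 1 -> 0 <= lvl L x <= 1.
Proof.
move=> /andP[x0 x1]; rewrite /lvl divr_ge0//= ler_pdivrMr// mul1r.
by apply: (@le_trans _ _ (L.+1%:R * x)); [rewrite truncn_le ?mulr_ge0|rewrite ler_piMr].
Qed.

Lemma cvg_lvl x : 0 <= x <= 1 -> lvl L x @[L --> \oo] --> x.
Proof.
move=> /andP[x0 x1].
apply: (@squeeze_cvgr _ _ _ _ (fun L => x - L.+1%:R^-1) (cst x)); last exact: cvg_cst.
  apply: nearW => L; have y0 : 0 <= L.+1%:R * x by rewrite mulr_ge0.
  have /andP[tl tu] := truncn_itv y0.
  rewrite /lvl ler_pdivrMr// ler_pdivlMr// [x * _]mulrC tl andbT.
  by rewrite mulrBl mulVf// [x * _]mulrC lerBlDr natr1 ltW.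
rewrite -[X in _ --> X]subr0; apply: cvgB; first exact: cvg_cst.
exact: cvg_harmonic.
Qed.

Lemma lvlE L x : 0 <= x <= 1 ->
  lvl L x = \sum_(l < L.+1) L.+1%:R^-1 * \1_[set y : R | (val l).+1%:R <= L.+1%:R * y] x.
Proof.
move=> /andP[x0 x1]; rewrite -mulr_sumr mulrC; congr (_ * _).
have y0 : 0 <= L.+1%:R * x by rewrite mulr_ge0.
have tL : (Num.truncn (L.+1%:R * x) <= L.+1)%N.
  by rewrite -(ler_nat R); apply: (@le_trans _ _ (L.+1%:R * x)); [rewrite truncn_le|rewrite ler_piMr].
under eq_bigr => l _ do rewrite indicE.
rewrite -natr_sum; congr (_%:R).
rewrite (eq_bigr (fun l : 'I_L.+1 => ((l < Num.truncn (L.+1%:R * x))%N : nat))); last first.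
  move=> l _; congr nat_of_bool; rewrite truncn_gt_nat.
  by apply/idP/idP; rewrite inE.
rewrite (eq_bigr (fun l : 'I_L.+1 => if (l < Num.truncn (L.+1%:R * x))%N then 1%N else 0%N)); last first.
  by move=> l _; case: ifP.
by rewrite -big_mkcond -(big_ord_widen _ (fun=> 1%N) tL) sum1_card card_ord.
Qed.

End level_approximation.

Lemma cvg_prodr (R : realType) I (r : seq I) (u_ : nat -> I -> R) (u : I -> R) :
  (forall i, u_ L i @[L --> \oo] --> u i) ->
  \prod_(i <- r) u_ L i @[L --> \oo] --> \prod_(i <- r) u i.
Proof.
move=> cu; elim: r => [|i r IH].
  by under eq_cvg do rewrite big_nil; rewrite big_nil; exact: cvg_cst.
by under eq_cvg do rewrite big_cons; rewrite big_cons; exact: cvgM.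
Qed.

Lemma cvg_sumr (R : realType) I (r : seq I) (u_ : nat -> I -> R) (u : I -> R) :
  (forall i, u_ L i @[L --> \oo] --> u i) ->
  \sum_(i <- r) u_ L i @[L --> \oo] --> \sum_(i <- r) u i.
Proof.
move=> cu; elim: r => [|i r IH].
  by under eq_cvg do rewrite big_nil; rewrite big_nil; exact: cvg_cst.
by under eq_cvg do rewrite big_cons; rewrite big_cons; exact: cvgD.
Qed.

Section conditional_independence.
Context d (Omega : measurableType d) (R : realType) (P : {finite_measure set Omega -> \bar R}).
Context dZ (Z : measurableType dZ) (T : finType).
Variables (w w' : Omega -> R) (s : T -> Omega -> Z) (D : T -> Omega -> giry Z R).
Hypotheses (bw : bmf w) (bw' : bmf w')
  (ms : forall j, measurable_fun setT (s j)) (mD : forall j, measurable_fun setT (D j)).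

Lemma bmf_Rint_giry (f : Z -> R) j : bmf f -> (forall z, 0 <= f z) ->
  bmf (fun x => \int[D j x]_z f z).
Proof.
move=> [mf [c fc]] f0.
apply: (@bmf_kernel_Rint _ _ Omega Z R (D j) (fun p => f p.2)) => //.
by split; [exact: measurableT_comp|exists c => p].
Qed.

(* Approximating [0,1]-valued functions uniformly by averages of indicators of
   their superlevel sets extends the product rule from sets to functions. *)
Lemma prod_rule_ext :
  (forall C : T -> set Z, (forall j, measurable (C j)) ->
    \int[P]_x (w x * \prod_j \1_(C j) (s j x)) =
    \int[P]_x (w' x * \prod_j fine (D j x (C j)))) ->
  forall h : T -> Z -> R, (forall j, measurable_fun setT (h j)) ->
  (forall j z, 0 <= h j z <= 1) ->
  \int[P]_x (w x * \prod_j h j (s j x)) =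
  \int[P]_x (w' x * \prod_j \int[D j x]_z h j z).
Proof.
move=> H h mh h01.
pose C L (l : 'I_L.+1) j := [set z | (val l).+1%:R <= L.+1%:R * h j z].
have mC L l j : measurable (C L l j).
  have m : measurable_fun setT (fun z => L.+1%:R * h j z) by exact: measurable_funM.
  have := m measurableT _ (measurable_itv `[(val l).+1%:R, +oo[); rewrite setTI.
  by congr measurable; apply/seteqP; split => z /=; rewrite in_itv/= andbT.
have lE L j z : lvl L (h j z) = \sum_(l < L.+1) L.+1%:R^-1 * \1_(C L l j) z.
  by rewrite lvlE.
have blvl L j : bmf (fun z => lvl L (h j z)).
  under eq_fun do rewrite lE; apply: bmf_sum => l; apply: bmfZ; exact: bmf_indic.
have l01 L j z : 0 <= lvl L (h j z) <= 1 by exact: lvl01.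
have i01 (u : Z -> R) j x : measurable_fun setT u -> (forall z, 0 <= u z <= 1) -> 0 <= \int[D j x]_z u z <= 1.
  by move=> mu u01; apply: Rint01.
have HL L : \int[P]_x (w x * \prod_j lvl L (h j (s j x))) =
    \int[P]_x (w' x * \prod_j \int[D j x]_z lvl L (h j z)).
  have E x : \prod_j lvl L (h j (s j x)) = \sum_(e : {ffun T -> 'I_L.+1})
      (\prod_(j : T) L.+1%:R^-1) * \prod_j \1_(C L (e j) j) (s j x).
    under eq_bigr do rewrite lE.
    by rewrite bigA_distr_bigA/=; apply: eq_bigr => e _; rewrite big_split.
  have E' x : \prod_j \int[D j x]_z lvl L (h j z) = \sum_(e : {ffun T -> 'I_L.+1})
      (\prod_(j : T) L.+1%:R^-1) * \prod_j fine (D j x (C L (e j) j)).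
    rewrite (eq_bigr (fun j => \sum_(l < L.+1) L.+1%:R^-1 * fine (D j x (C L l j)))); last first.
      move=> j _; under eq_Rintegral do rewrite lE.
      rewrite Rint_sum; last by move=> l; apply: bmfZ; exact: bmf_indic.
      by apply: eq_bigr => l _; rewrite RintZ ?Rint_indic//; exact: bmf_indic.
    by rewrite bigA_distr_bigA/=; apply: eq_bigr => e _; rewrite big_split.
  under eq_Rintegral do rewrite E mulr_sumr.
  under [RHS]eq_Rintegral do rewrite E' mulr_sumr.
  have b1 e : bmf (fun x => w x * \prod_j \1_(C L (e j) j) (s j x)).
    by apply: bmfM => //; apply: bmf_prod => j; apply: bmf_comp => //; exact: bmf_indic.
  have b2 e : bmf (fun x => w' x * \prod_j fine (D j x (C L (e j) j))).
    apply: bmfM => //; apply: bmf_prod => j.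
    have -> : (fun x => fine (D j x (C L (e j) j))) = fun x => \int[D j x]_z \1_(C L (e j) j) z.
      by apply/funext => x; rewrite Rint_indic.
    by apply: bmf_Rint_giry; [exact: bmf_indic|move=> z; rewrite indicE].
  rewrite !Rint_sum; last 2 first.
  - by move=> e; under eq_fun do rewrite mulrCA; apply: bmfZ.
  - by move=> e; under eq_fun do rewrite mulrCA; apply: bmfZ.
  apply: eq_bigr => e _.
  under eq_Rintegral do rewrite mulrCA; under [RHS]eq_Rintegral do rewrite mulrCA.
  by rewrite !RintZ// H.
have prod01 (u : T -> R) : (forall j, 0 <= u j <= 1) -> `|\prod_j u j| <= 1.
  move=> u01; rewrite ger0_norm ?prodr_ge0// => [|j _]; last by case/andP: (u01 j).
  exact: prodr_ile1.
have [_ [c wc]] := bw; have [_ [c' wc']] := bw'.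
have cvgp (u_ : nat -> T -> R) (u : T -> R) : (forall j, u_ L j @[L --> \oo] --> u j) ->
    \prod_j u_ L j @[L --> \oo] --> \prod_j u j.
  by move=> cu; exact: cvg_prodr.
have c1 : \int[P]_x (w x * \prod_j lvl L (h j (s j x))) @[L --> \oo] -->
    \int[P]_x (w x * \prod_j h j (s j x)).
  apply: (@bounded_cvg_Rint _ _ _ _ _ _ c).
  - move=> L; apply: (bmfM _ _ _ _ _ bw _).1; apply: bmf_prod => j.
    by apply: (bmf_comp _ _ _ _ _ (fun z => lvl L (h j z))).
  - apply: (bmfM _ _ _ _ _ bw _).1; apply: bmf_prod => j.
    by apply: (bmf_comp _ _ _ _ _ (h j)) => //; exact: bmf01.
  - move=> L x; rewrite normrM -[leRHS]mulr1 ler_pM//; exact: prod01.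
  - by move=> x; apply: cvgM; [exact: cvg_cst|apply: cvgp => j; exact: cvg_lvl].
have c2 : \int[P]_x (w' x * \prod_j \int[D j x]_z lvl L (h j z)) @[L --> \oo] -->
    \int[P]_x (w' x * \prod_j \int[D j x]_z h j z).
  apply: (@bounded_cvg_Rint _ _ _ _ _ _ c').
  - move=> L; apply: (bmfM _ _ _ _ _ bw' _).1; apply: bmf_prod => j.
    by apply: bmf_Rint_giry => // z; case/andP: (l01 L j z).
  - apply: (bmfM _ _ _ _ _ bw' _).1; apply: bmf_prod => j.
    by apply: bmf_Rint_giry => [|z]; [exact: bmf01|case/andP: (h01 j z)].
  - move=> L x; rewrite normrM -[leRHS]mulr1 ler_pM//; apply: prod01 => j.
    by apply: i01 => //; exact: (blvl L j).1.
  - move=> x; apply: cvgM; [exact: cvg_cst|apply: cvgp => j].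
    apply: (@bounded_cvg_Rint _ _ _ _ _ _ 1) => //.
    + by move=> L; exact: (blvl L j).1.
    + by move=> L z; have /andP[? ?] := l01 L j z; rewrite ger0_norm.
    + by move=> z; exact: cvg_lvl.
move: c1; under eq_cvg do rewrite HL; move=> c1.
by rewrite -(cvg_lim _ c1)// -(cvg_lim _ c2).
Qed.

End conditional_independence.
Section grid_extension.
Context d (Omega : measurableType d) (R : realType) (P : {finite_measure set Omega -> \bar R}).
Variables (I : finType) (v : I -> Omega -> R) (F F' : Omega -> R) (c : (I -> R) -> R) (K : R).
Hypotheses (mv : forall i, measurable_fun setT (v i)) (v01 : forall i x, 0 <= v i x <= 1)
  (bF : bmf F) (bF' : bmf F')
  (cK : forall u : I -> R, (forall i, 0 <= u i <= 1) -> `|c u| <= K)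
  (cc : forall (u_ : nat -> I -> R) (u : I -> R), (forall L i, 0 <= u_ L i <= 1) ->
    (forall i, 0 <= u i <= 1) -> (forall i, u_ L i @[L --> \oo] --> u i) ->
    c (u_ L) @[L --> \oo] --> c u).

(** Here [c] is a bounded continuous function of the whole vector [v], not a product. On the grid it
    becomes a finite combination of products of cell indicators, to which the hypothesis applies;
    dominated convergence does the rest. The intended [c] is a Krichevsky-Trofimov ratio at the
    random true mean. *)
Lemma grid_ext :
  (forall A : I -> set R, (forall i, measurable (A i)) ->
    \int[P]_x (F x * \prod_i \1_(A i) (v i x)) =
    \int[P]_x (F' x * \prod_i \1_(A i) (v i x))) ->
  measurable_fun setT (fun x => c (v ^~ x)) /\
  \int[P]_x (F x * c (v ^~ x)) = \int[P]_x (F' x * c (v ^~ x)).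
Proof.
move=> H.
pose cell L (l : nat) := [set y : R | l%:R <= L.+1%:R * y < l.+1%:R].
have mcell L l : measurable (cell L l).
  have m : measurable_fun setT (fun y : R => L.+1%:R * y) by exact: measurable_funM.
  have := m measurableT _ (measurable_itv `[l%:R, l.+1%:R[); rewrite setTI.
  by congr measurable; apply/seteqP; split => z /=; rewrite in_itv/=.
have cE L x : c (fun i => lvl L (v i x)) =
    \sum_(l : {ffun I -> 'I_L.+2}) c (fun i => (l i)%:R / L.+1%:R) * \prod_i \1_(cell L (l i)) (v i x).
  (* There are [L + 2] cells because the value 1 is rounded to the level [L + 1]. *)
  have tL i : (Num.truncn (L.+1%:R * v i x) < L.+2)%N.
    have /andP[v0 v1] := v01 i x.
    rewrite ltnS -(ler_nat R); apply: (@le_trans _ _ (L.+1%:R * v i x)).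
      by rewrite truncn_le mulr_ge0.
    by rewrite ler_piMr.
  have one i (m : nat) : \1_(cell L m) (v i x) = (Num.truncn (L.+1%:R * v i x) == m)%:R :> R.
    have /andP[v0 v1] := v01 i x.
    rewrite indicE; congr (nat_of_bool _)%:R; rewrite truncn_eq ?mulr_ge0//.
    by apply/idP/idP; rewrite inE.
  pose l0 := [ffun i => Ordinal (tL i)].
  rewrite (bigD1 l0)//= [X in _ + X]big1 ?addr0; last first.
    move=> l ll0; suff [i li] : exists i, l i != l0 i.
      have h : (Num.truncn (L.+1%:R * v i x) == l i) = false.
        by apply/negbTE; apply: contra li => /eqP li; apply/eqP/val_inj; rewrite ffunE.
      by rewrite (bigD1 i)//= one h mul0r mulr0.
    apply/existsP; rewrite -negb_forall; apply: contra ll0 => /forallP ll0.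
    by apply/eqP/ffunP => i; apply/eqP.
  rewrite big1 ?mulr1; last by move=> i _; rewrite one ffunE eqxx.
  by congr c; apply/funext => i; rewrite ffunE.
have b1 L (l : {ffun I -> 'I_L.+2}) G : bmf G -> bmf (fun x => G x * \prod_i \1_(cell L (l i)) (v i x)).
  by move=> bG; apply: bmfM => //; apply: bmf_prod => j; apply: bmf_comp => //; exact: bmf_indic.
have bc L : bmf (fun x => c (fun i => lvl L (v i x))).
  under eq_fun do rewrite cE; apply: bmf_sum => l.
  apply: bmfM; first exact: bmf_cst.
  by apply: bmf_prod => j; apply: bmf_comp => //; exact: bmf_indic.
have cvc x : c (fun i => lvl L (v i x)) @[L --> \oo] --> c (v ^~ x).
  by apply: cc => [L i||i]; [exact: lvl01|by []|exact: cvg_lvl].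
have mc : measurable_fun setT (fun x => c (v ^~ x)).
  apply: (@measurable_fun_cvg _ _ _ _ (fun L x => c (fun i => lvl L (v i x)))).
    by move=> L; exact: (bc L).1.
  by move=> x _; exact: cvc.
split=> //.
have HL L : \int[P]_x (F x * c (fun i => lvl L (v i x))) = \int[P]_x (F' x * c (fun i => lvl L (v i x))).
  under eq_Rintegral do rewrite cE mulr_sumr.
  under [RHS]eq_Rintegral do rewrite cE mulr_sumr.
  rewrite !Rint_sum; last 2 first.
  - by move=> l; under eq_fun do rewrite mulrCA; apply: bmfZ; exact: b1.
  - by move=> l; under eq_fun do rewrite mulrCA; apply: bmfZ; exact: b1.
  apply: eq_bigr => l _.
  under eq_Rintegral do rewrite mulrCA; under [RHS]eq_Rintegral do rewrite mulrCA.
  by rewrite !RintZ ?H//; exact: b1.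
have C G : bmf G -> \int[P]_x (G x * c (fun i => lvl L (v i x))) @[L --> \oo] --> \int[P]_x (G x * c (v ^~ x)).
  move=> bG; have [mG [k Gk]] := bG.
  apply: (@bounded_cvg_Rint _ _ _ _ _ _ (k * K)).
  - by move=> L; exact: (bmfM _ _ _ _ _ bG (bc L)).1.
  - exact: measurable_funM.
  - by move=> L x; rewrite normrM ler_pM//; apply: cK => i; exact: lvl01.
  - by move=> x; apply: cvgM; [exact: cvg_cst|exact: cvc].
have c1 := C _ bF; have c2 := C _ bF'.
move: c1; under eq_cvg do rewrite HL; move=> c1.
by rewrite -(cvg_lim _ c1)// -(cvg_lim _ c2).
Qed.

End grid_extension.
Section task_sampling.
Context (R : realType) dZ (Z : measurableType dZ) dT (Tsk : measurableType dT).
Variables (tD : Tsk -> giry Z R) (tm : Tsk -> nat) (tS : nat -> Tsk -> Z).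
Hypotheses (mtD : measurable_fun [set: Tsk] tD) (mtm : measurable_fun [set: Tsk] tm)
  (mtS : forall j, measurable_fun [set: Tsk] (tS j)).
Variable tau : probability Tsk R.
Hypothesis tau_iid : forall (B : set (giry Z R * nat)%type) (K : nat)
       (C : 'I_K -> set Z), measurable B -> (forall j, measurable (C j)) ->
     tau ([set t | B (tD t, tm t)] `&` [set t | forall j : 'I_K, C j (tS j t)])
     = (\int[tau]_(t in [set t | B (tD t, tm t)])
          \big[*%E/1%E]_(j < K) tD t (C j))%E.

Lemma prod_indic (T : finType) d (X : measurableType d) (A : T -> set X) x :
  \prod_j \1_(A j) x = \1_[set y | forall j, A j y] x :> R.
Proof.
rewrite [RHS]indicE; have [h|h] := pselect (forall j, A j x).
  by rewrite mem_set// big1// => j _; rewrite indicE mem_set.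
rewrite memNset//; move/existsNP : h => [j Aj].
by rewrite (bigD1 j)//= indicE memNset// mul0r.
Qed.

Lemma fine_prode (T : finType) (a : T -> \bar R) : (forall j, a j \is a fin_num) ->
  (\big[*%E/1%E]_j a j)%E = (\prod_j fine (a j))%:E.
Proof.
by move=> fa; elim/big_rec2: _ => [//|j x y _ ->]; rewrite EFinM fineK.
Qed.

Definition tkey t := (tD t, tm t).

Lemma measurable_tkey : measurable_fun setT tkey.
Proof. exact: measurable_fun_pair. Qed.

(** The indicator of [B] stands for conditioning on the distribution and the sample size: given
    these, samples are replaced by their means. *)
Lemma task_rule (B : set (giry Z R * nat)) K (h : 'I_K -> Z -> R) :
  measurable B -> (forall j, measurable_fun setT (h j)) -> (forall j z, 0 <= h j z <= 1) ->
  \int[tau]_t (\1_B (tkey t) * \prod_j h j (tS j t)) =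
  \int[tau]_t (\1_B (tkey t) * \prod_j \int[tD t]_z h j z).
Proof.
move=> mB mh h01.
have mBk : measurable [set t | B (tkey t)].
  by rewrite -[X in measurable X]setTI; exact: measurable_tkey.
have bB : bmf (fun t => \1_B (tkey t) : R).
  by apply: (@bmf_comp _ _ Tsk _ R (\1_B) tkey); [exact: bmf_indic|exact: measurable_tkey].
apply: (@prod_rule_ext _ Tsk R tau _ Z 'I_K _ _ (fun j t => tS j t) (fun=> tD)) => // C mC.
have E t : \1_B (tkey t) * \prod_j \1_(C j) (tS j t) =
    \1_([set t | B (tkey t)] `&` [set t | forall j : 'I_K, C j (tS j t)]) t :> R.
  rewrite indicI/=; congr (_ * _).
  by rewrite -(prod_indic _ _ _ (fun j : 'I_K => [set t | C j (tS j t)])).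
under eq_Rintegral do rewrite E.
have mCs : measurable [set t | forall j : 'I_K, C j (tS j t)].
  rewrite [X in measurable X](_ : _ = \bigcap_(j in [set: 'I_K]) (tS j @^-1` C j)).
    by apply: fin_bigcap_measurable => // j _; rewrite -[X in measurable X]setTI; exact: mtS.
  by apply/seteqP; split => t /= h' j; [move=> _|]; apply: h'.
rewrite Rint_indic; last exact: measurableI.
transitivity (fine (\int[tau]_(t in [set t | B (tD t, tm t)]) \big[*%E/1%E]_(j < K) tD t (C j))%E).
  by congr fine; exact: tau_iid.
rewrite integral_mkcond; congr fine; apply: eq_integral => t _.
rewrite patchE (fine_prode _ (fun j => tD t (C j))); last by move=> j; exact: fin_num_measure.
 have [h'|h'] := pselect (B (tkey t)).
  by rewrite mem_set// indicE mem_set// mul1r.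
by rewrite memNset// indicE memNset// mul0r.
Qed.

Variables (n : nat) (Ptr : probability (n.-tuple Tsk) R).
Hypothesis Ptr_prod : forall E : 'I_n -> set Tsk, (forall i, measurable (E i)) ->
     Ptr (tbox E) = \big[*%E/1%E]_(i < n) tau (E i).

Lemma tuple_rule (H : 'I_n -> Tsk -> R) : (forall i, measurable_fun setT (H i)) ->
  (forall i t, 0 <= H i t <= 1) ->
  \int[Ptr]_tr \prod_i H i (tnth tr i) = \prod_i \int[tau]_t H i t.
Proof.
move=> mH H01.
have := @prod_rule_ext _ _ R Ptr _ Tsk 'I_n (cst 1) (cst 1)
  (fun i tr => tnth tr i) (fun _ _ => tau : giry Tsk R) (bmf_cst _ _ _ 1) (bmf_cst _ _ _ 1).
have M i : measurable_fun setT (fun tr : n.-tuple Tsk => tnth tr i) by exact: measurable_tnth.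
have M' (i : 'I_n) : measurable_fun setT (fun _ : n.-tuple Tsk => tau : giry Tsk R) by exact: measurable_cst.
move=> /(_ M M') Hx.
transitivity (\int[Ptr]_tr (1 * \prod_i H i (tnth tr i))).
  by apply: eq_Rintegral => tr _; rewrite mul1r.
rewrite [LHS]Hx//; last first.
  move=> C mC; under eq_Rintegral do rewrite mul1r (prod_indic _ _ _ (fun i => [set tr : n.-tuple Tsk | C i (tnth tr i)])).
  rewrite Rint_indic; last first.
    rewrite [X in measurable X](_ : _ = \bigcap_(j in [set: 'I_n]) ((fun tr : n.-tuple Tsk => tnth tr j) @^-1` C j)).
      by apply: fin_bigcap_measurable => // j _; rewrite -[X in measurable X]setTI; exact: M.
    by apply/seteqP; split => t /= h' j; [move=> _|]; apply: h'.
  under [RHS]eq_Rintegral do rewrite mul1r.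
  rewrite [RHS]Rint_cst_prob. transitivity (fine (Ptr (tbox C))); first by [].
  rewrite Ptr_prod// (fine_prode _ (fun i => tau (C i)))//.
  by move=> i; exact: fin_num_measure.
transitivity (\int[Ptr]_tr (\prod_i \int[tau]_t H i t)); last by rewrite [LHS]Rint_cst_prob.
by apply: eq_Rintegral => tr _; rewrite mul1r.
Qed.

Lemma sample_rule K (B : 'I_n -> set (giry Z R * nat)) (h : 'I_n -> 'I_K -> Z -> R) :
  (forall i, measurable (B i)) -> (forall i j, measurable_fun setT (h i j)) ->
  (forall i j z, 0 <= h i j z <= 1) ->
  \int[Ptr]_tr \prod_i (\1_(B i) (tkey (tnth tr i)) * \prod_j h i j (tS j (tnth tr i))) =
  \int[Ptr]_tr \prod_i (\1_(B i) (tkey (tnth tr i)) * \prod_j \int[tD (tnth tr i)]_z h i j z).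
Proof.
move=> mB mh h01.
have b1 i : bmf (fun t => \1_(B i) (tkey t) * \prod_j h i j (tS j t)).
  apply: bmfM; first by apply: (@bmf_comp _ _ Tsk _ R (\1_(B i)) tkey); [exact: bmf_indic|exact: measurable_tkey].
  by apply: bmf_prod => j; apply: (@bmf_comp _ _ _ _ _ (h i j)) => //; exact: bmf01.
have b2 i : bmf (fun t => \1_(B i) (tkey t) * \prod_j \int[tD t]_z h i j z).
  apply: bmfM; first by apply: (@bmf_comp _ _ Tsk _ R (\1_(B i)) tkey); [exact: bmf_indic|exact: measurable_tkey].
  apply: bmf_prod => j; apply: (@bmf_Rint_giry _ Tsk R _ Z unit (fun=> tD) _ (h i j) tt) => //.
    exact: bmf01.
  by move=> z; case/andP: (h01 i j z).
have P01 (a : R) (u : 'I_K -> R) : 0 <= a <= 1 -> (forall j, 0 <= u j <= 1) -> 0 <= a * \prod_j u j <= 1.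
  move=> /andP[a0 a1] u01; rewrite mulr_ge0 ?prodr_ge0//=; last by move=> j _; case/andP: (u01 j).
  by rewrite mulr_ile1 ?prodr_ge0 ?prodr_ile1// => j _; case/andP: (u01 j).
have I01 i t : 0 <= (\1_(B i) (tkey t) : R) <= 1 by rewrite indicE ler0n lern1 leq_b1.
rewrite (tuple_rule (fun i t => \1_(B i) (tkey t) * \prod_j h i j (tS j t))); last 2 first.
- by move=> i; exact: (b1 i).1.
- by move=> i t; exact: P01.
rewrite (tuple_rule (fun i t => \1_(B i) (tkey t) * \prod_j \int[tD t]_z h i j z)); last 2 first.
- by move=> i; exact: (b2 i).1.
- by move=> i t; apply: P01 => // j; apply: Rint01.
by apply: eq_bigr => i _; exact: task_rule.
Qed.

End task_sampling.

(** * Moment bounds at the task and sample levels *)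

Section regularisation.
Context {R : realType}.
Implicit Types (r : R).

(* Shrinking the loss away from 0 and 1 keeps all kl terms finite and bounded. *)
Definition reg r (x : R) : R := (1 - r) * x + r / 2.

Lemma reg_itv r (x : R) : 0 < r < 1 -> 0 <= x <= 1 -> r / 2 <= reg r x <= 1 - r / 2.
Proof. by rewrite /reg => /andP[r0 r1] /andP[x0 x1]; apply/andP; split; nra. Qed.

Lemma reg_gt0 r (x : R) : 0 < r < 1 -> 0 <= x <= 1 -> 0 < reg r x < 1.
Proof. by move=> /[dup] /andP[r0 r1] /reg_itv H /H /andP[a b]; apply/andP; split; lra. Qed.

Lemma reg01 r (x : R) : 0 < r < 1 -> 0 <= x <= 1 -> 0 <= reg r x <= 1.
Proof. by move=> r01 /(reg_gt0 _ _ r01)/andP[a b]; rewrite !ltW. Qed.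

Lemma reg_compl r (x : R) : reg r (1 - x) = 1 - reg r x.
Proof. by rewrite /reg; field. Qed.

Lemma klr_lnE (q p : R) : 0 < q < 1 -> 0 < p < 1 ->
  klr q p = q * (ln q - ln p) + (1 - q) * (ln (1 - q) - ln (1 - p)).
Proof.
by move=> /andP[q0 q1] /andP[p0 p1]; rewrite /klr !ln_div ?posrE ?subr_gt0.
Qed.

Lemma bmf_reg d (T : measurableType d) r (f : T -> R) : bmf f -> bmf (fun x => reg r (f x)).
Proof. by move=> bf; apply: bmfD; [exact: bmfZ|exact: bmf_cst]. Qed.

Lemma bmf_ln_reg d (T : measurableType d) r (f : T -> R) : 0 < r < 1 ->
  bmf f -> (forall x, 0 <= f x <= 1) -> bmf (fun x => ln (reg r (f x))).
Proof.
move=> r01 bf f01; split; first by apply: measurableT_comp => //; exact: (bmf_reg _ _ _ _ bf).1.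
exists (- ln (r / 2)) => x; have /andP[r0 r1] := r01.
have /andP[a0 a1] := reg_itv _ _ r01 (f01 x).
have g0 : 0 < reg r (f x) by apply: lt_le_trans a0; rewrite divr_gt0.
rewrite ler0_norm; first by rewrite lerN2 ler_ln// posrE divr_gt0.
by apply: ln_le0; apply: le_trans a1 _; rewrite lerBlDr lerDl divr_ge0// ltW.
Qed.

Lemma bmf_klr_reg d (T : measurableType d) r (f g : T -> R) : 0 < r < 1 ->
  bmf f -> bmf g -> (forall x, 0 <= f x <= 1) -> (forall x, 0 <= g x <= 1) ->
  bmf (fun x => klr (reg r (f x)) (reg r (g x))).
Proof.
move=> r01 bf bg f01 g01.
under eq_fun => x do rewrite klr_lnE ?reg_gt0// -!reg_compl.
have compl (h : T -> R) : bmf h -> (forall x, 0 <= h x <= 1) ->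
    bmf (fun x => 1 - h x) /\ forall x, 0 <= 1 - h x <= 1.
  move=> bh h01; split; first by apply: bmfB => //; exact: bmf_cst.
  by move=> x; have /andP[h0 h1] := h01 x; rewrite subr_ge0 h1 gerBl.
have [bf' f01'] := compl _ bf f01; have [bg' g01'] := compl _ bg g01.
by apply: bmfD; apply: bmfM; [exact: bmf_reg|apply: bmfB; exact: bmf_ln_reg|exact: bmf_reg|apply: bmfB; exact: bmf_ln_reg].
Qed.

Lemma sum_reg I (s : seq I) (P : pred I) (x : I -> R) r :
  \sum_(i <- s | P i) reg r (x i) = (1 - r) * (\sum_(i <- s | P i) x i) + (\sum_(i <- s | P i) 1) * (r / 2).
Proof. by rewrite mulr_sumr mulr_suml -big_split/=; apply: eq_bigr => i _; rewrite mul1r. Qed.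

Lemma reg_mean (s : seq R) r : (0 < size s)%N ->
  \sum_(x <- [seq reg r x | x <- s]) x = (size s)%:R * reg r ((size s)%:R^-1 * \sum_(x <- s) x).
Proof.
move=> s0; rewrite big_map sum_reg big_const_seq count_predT iter_addr_0 /reg.
by field; rewrite pnatr_eq0 -lt0n.
Qed.

Lemma mean01 (s : seq R) : all in01 s -> 0 <= (size s)%:R^-1 * \sum_(x <- s) x <= 1.
Proof.
move=> s01; have S0 : 0 <= \sum_(x <- s) x.
  by rewrite big_seq; apply: sumr_ge0 => x xs; move/allP: s01 => /(_ _ xs) /andP[].
rewrite mulr_ge0 ?invr_ge0//=.
case: s s01 S0 => [|x s] s01 S0; first by rewrite big_nil mulr0.
rewrite ler_pdivrMl ?ltr0n// mulr1.
rewrite -[leRHS]mulr1 mulr_natl -iter_addr_0 -count_predT -big_const_seq !big_seq.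
by apply: ler_sum => y ys; move/allP: s01 => /(_ _ ys) /andP[].
Qed.

End regularisation.

Section iid_mgf.
Context (R : realType) dT (Tsk : measurableType dT) (tau : probability Tsk R).
Variables (n : nat) (Ptr : probability (n.-tuple Tsk) R).
Hypothesis Ptr_prod : forall E : 'I_n -> set Tsk, (forall i, measurable (E i)) ->
     Ptr (tbox E) = \big[*%E/1%E]_(i < n) tau (E i).

(** The true mean is a constant here, so the Krichevsky-Trofimov coefficients leave the integral and
    the product rule on tuples suffices, with no conditioning. *)
Lemma iid_kl_mgf (r : R) (Y : Tsk -> R) : (0 < n)%N -> 0 < r < 1 ->
  measurable_fun setT Y -> (forall t, 0 <= Y t <= 1) ->
  \int[Ptr]_tr expR (n%:R * klr (reg r (n%:R^-1 * \sum_(i < n) Y (tnth tr i))) (reg r (\int[tau]_t Y t)))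
    <= 2 * Num.sqrt n%:R.
Proof.
move=> n0 r01 mY Y01.
set y := \int[tau]_t Y t.
have y01 : 0 <= y <= 1 by exact: Rint01.
have bY : bmf Y by exact: bmf01.
have by01 := reg_gt0 _ _ r01 y01.
have [e [ue se eprod esum]] : exists e : seq 'I_n, [/\ uniq e, size e = n,
    forall F : 'I_n -> R, \prod_(i <- e) F i = \prod_i F i &
    forall F : 'I_n -> R, \sum_(i <- e) F i = \sum_i F i].
  by exists (enum 'I_n); rewrite enum_uniq size_enum_ord; split => // F; rewrite big_enum.
have [L [Ls LE]] := @pb_expand R _ e ue.
have bX i : bmf (fun tr : n.-tuple Tsk => Y (tnth tr i)).
  by apply: (@bmf_comp _ _ _ _ _ Y) => //; exact: measurable_tnth.
have sumE tr : \sum_(i < n) Y (tnth tr i) = \sum_(x <- [seq Y (tnth tr i) | i <- e]) x.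
  by rewrite big_map esum.
have all01 tr : all in01 [seq Y (tnth tr i) | i <- e].
  by apply/allP => _ /mapP[i _ ->]; rewrite /in01 inE/=.
have m01 tr : 0 <= n%:R^-1 * \sum_(i < n) Y (tnth tr i) <= 1.
  by have := mean01 _ (all01 tr); rewrite size_map se sumE.
pose G tr (l : nat * nat * ('I_n -> bool)) :=
  \prod_i (if l.2 i then reg r (Y (tnth tr i)) else 1 - reg r (Y (tnth tr i))).
have bG l : bmf (G ^~ l).
  apply: bmf_prod => i; case: (l.2 i); first exact: bmf_reg.
  by apply: bmfB; [exact: bmf_cst|exact: bmf_reg].
apply: (@le_trans _ _ (\int[Ptr]_tr (2 * Num.sqrt n%:R *
    \sum_(l <- L) KTratio (reg r y) l.1.1 l.1.2 * G tr l))).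
  apply: Rint_le.
  - apply: bmf_expR; apply: bmfZ; apply: (@bmf_klr_reg _ _ _ _ (fun tr => n%:R^-1 * \sum_(i < n) Y (tnth tr i)) (fun=> y)) => //.
      by apply: bmfZ; exact: bmf_sum.
    exact: bmf_cst.
  - by apply: bmfZ; apply: bmf_sum => l; apply: bmfZ.
  - move=> tr.
    have := @expR_klr_le R [seq reg r x | x <- [seq Y (tnth tr i) | i <- e]]
      (reg r (n%:R^-1 * \sum_(i < n) Y (tnth tr i))) (reg r y).
    rewrite !size_map se => H; apply: le_trans (H _ _ _ _ _) _ => //.
    + apply/allP => _ /mapP[x /(allP (all01 tr)) x01 ->]; exact: reg01.
    + by rewrite reg_mean ?size_map se// sumE.
    + exact: reg_gt0.
    + rewrite ler_wpM2l ?mulr_ge0 ?sqrtr_ge0// -map_comp.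
      rewrite (LE _ (fun i => reg r (Y (tnth tr i)))).
      by apply: ler_sum => l _; rewrite /G eprod.
rewrite RintZ; last by apply: bmf_sum => l; apply: bmfZ.
rewrite ler_piMr ?mulr_ge0 ?sqrtr_ge0//.
rewrite Rint_sum; last by move=> l; apply: bmfZ.
apply: (@le_trans _ _ (pb (KTratio (reg r y)) [seq reg r y | i <- e])); last first.
  apply: pb_KTratio_le1 => //.
    by apply/allP => _ /mapP[i _ ->]; exact: reg01.
  by rewrite big_map size_map se esum big_const_ord iter_addr_0 mulr_natl.
rewrite LE le_eqVlt; apply/orP; left; apply/eqP; apply: eq_bigr => l _.
rewrite RintZ//; congr (_ * _); rewrite /G eprod/=.
rewrite (@tuple_rule _ _ _ tau _ Ptr Ptr_prod (fun i t => if l.2 i then reg r (Y t) else 1 - reg r (Y t))).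
- apply: eq_bigr => i _; have E : \int[tau]_t reg r (Y t) = reg r y.
    rewrite RintD; [|exact: bmfZ|exact: bmf_cst].
    rewrite (RintZ _ _ _ tau (1 - r) Y bY).
    by rewrite /reg -/y; congr GRing.add; exact: Rint_cst_prob.
  case: (l.2 i) => //; rewrite RintB; [|exact: bmf_cst|exact: bmf_reg].
  by rewrite E; congr GRing.add; exact: Rint_cst_prob.
- move=> i; case: (l.2 i); first exact: (bmf_reg _ _ _ _ bY).1.
  by apply: measurable_funB => //; exact: (bmf_reg _ _ _ _ bY).1.
- move=> i t; have /andP[a b] := reg01 _ _ r01 (Y01 t); case: (l.2 i); first by rewrite a.
  by rewrite subr_ge0 b gerBl.
Qed.

End iid_mgf.
(** [reg r] keeps the parameter at distance [r / 2] from 0 and 1, which supplies the uniform bound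
    demanded by [grid_ext]. *)
Lemma KTratio_bound (R : realType) (r : R) k b (x : R) : 0 < r < 1 -> 0 <= x <= 1 ->
  `|KTratio (reg r x) k b| <= KT k b / ((r / 2) ^+ k * (r / 2) ^+ b).
Proof.
move=> r01 x01; have /andP[a0 a1] := reg_itv _ _ r01 x01; have /andP[r0 r1] := r01.
have r20 : 0 < r / 2 by rewrite divr_gt0.
rewrite ger0_norm; last by apply: KTratio_ge0; exact: reg01.
rewrite /KTratio ler_wpM2l ?KT_ge0// lef_pV2 ?posrE ?mulr_gt0 ?exprn_gt0//; last 2 first.
- exact: lt_le_trans a0.
- by rewrite subr_gt0; apply: le_lt_trans a1 _; rewrite ltrBlDr ltrDl.
apply: ler_pM; rewrite ?exprn_ge0 ?(ltW r20)//; apply: lerXn2r; rewrite ?nnegrE ?(ltW r20)//.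
- by apply: le_trans a0; exact: ltW.
- by rewrite subr_ge0; apply: le_trans a1 _; rewrite lerBlDr lerDl ltW.
- by rewrite lerBrDr -lerBrDl.
Qed.

Lemma cvg_exprn (R : realType) (u_ : nat -> R) (u : R) k :
  u_ L @[L --> \oo] --> u -> u_ L ^+ k @[L --> \oo] --> u ^+ k.
Proof.
move=> cu; elim: k => [|k IH]; first by under eq_cvg do rewrite expr0; rewrite expr0; exact: cvg_cst.
by under eq_cvg do rewrite exprS; rewrite exprS; exact: cvgM.
Qed.

Lemma cvg_KTratio (R : realType) (r : R) k b (x_ : nat -> R) (x : R) : 0 < r < 1 -> 0 <= x <= 1 ->
  x_ L @[L --> \oo] --> x ->
  KTratio (reg r (x_ L)) k b @[L --> \oo] --> KTratio (reg r x) k b.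
Proof.
move=> r01 x01 cx; have /andP[a0 a1] := reg_gt0 _ _ r01 x01.
have cr : reg r (x_ L) @[L --> \oo] --> reg r x.
  by apply: cvgD; [apply: cvgM => //; exact: cvg_cst|exact: cvg_cst].
apply: cvgM; first exact: cvg_cst.
apply: cvgV; first by rewrite mulf_neq0// expf_neq0// gt_eqF// subr_gt0.
apply: cvgM; first exact: cvg_exprn.
by apply: cvg_exprn; apply: cvgB => //; exact: cvg_cst.
Qed.

Section sample_mgf.
Context (R : realType) dZ (Z : measurableType dZ) dT (Tsk : measurableType dT).
Variables (tD : Tsk -> giry Z R) (tm : Tsk -> nat) (tS : nat -> Tsk -> Z).
Hypotheses (mtD : measurable_fun [set: Tsk] tD) (mtm : measurable_fun [set: Tsk] tm)
  (mtS : forall j, measurable_fun [set: Tsk] (tS j)).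
Variables (n mmax : nat).
Implicit Types (m : 'I_n -> nat) (u : 'I_n -> Z -> R) (tr : n.-tuple Tsk).

Definition sample_size m : nat := (\sum_i m i)%N.

(** The sizes [m] are an argument, not read off the tasks, so that expectations can be taken with
    the sizes frozen. *)
Definition sample_mean m u tr : R :=
  (sample_size m)%:R^-1 * \sum_(i < n) \sum_(j < mmax | (j < m i)%N) u i (tS j (tnth tr i)).

Definition true_mean m u tr : R :=
  (sample_size m)%:R^-1 * \sum_(i < n) (m i)%:R * \int[tD (tnth tr i)]_z u i z.

(** The normalisation sits inside because the total sample size is random; the expectation is then
    at most 1 for every vector of sizes. *)
Definition kl_weight r m u tr : R :=
  expR ((sample_size m)%:R * klr (reg r (sample_mean m u tr)) (reg r (true_mean m u tr))) /
  (2 * Num.sqrt (sample_size m)%:R).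

Definition good_tasks : set (n.-tuple Tsk) :=
  [set tr | forall i, tD (tnth tr i) [set: Z] = 1%E /\ (0 < tm (tnth tr i) <= mmax)%N].

Definition sized_tasks m : set (n.-tuple Tsk) :=
  [set tr | forall i, tD (tnth tr i) [set: Z] = 1%E /\ tm (tnth tr i) = m i].

Definition sizes tr : 'I_n -> nat := fun i => tm (tnth tr i).

Lemma measurable_tuple_forall (A : 'I_n -> set Tsk) : (forall i, measurable (A i)) ->
  measurable [set tr : n.-tuple Tsk | forall i, A i (tnth tr i)].
Proof.
move=> mA; rewrite [X in measurable X](_ : _ =
    \bigcap_(i in [set: 'I_n]) ((fun tr : n.-tuple Tsk => tnth tr i) @^-1` A i)).
  apply: fin_bigcap_measurable => // i _; rewrite -[X in measurable X]setTI.
  exact: measurable_tnth.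
by apply/seteqP; split => t /= h i; [move=> _|]; apply: h.
Qed.

Lemma measurable_prob_task : measurable [set t | tD t [set: Z] = 1%E].
Proof.
have m : measurable_fun setT (fun t => tD t [set: Z]).
  by apply: (@measurableT_comp _ _ _ _ _ _ (giry_ev ^~ [set: Z])) => //; exact: measurable_giry_ev.
by have := m measurableT _ (emeasurable_set1 1%E); rewrite setTI.
Qed.

Lemma measurable_sized_tasks m : measurable (sized_tasks m).
Proof.
apply: (measurable_tuple_forall (fun i => [set t | tD t [set: Z] = 1%E /\ tm t = m i])) => i.
apply: measurableI; first exact: measurable_prob_task.
by have := mtm measurableT [set m i] I; rewrite setTI.
Qed.

Lemma measurable_good_tasks : measurable good_tasks.
Proof.
apply: (measurable_tuple_forall (fun _ => [set t | tD t [set: Z] = 1%E /\ (0 < tm t <= mmax)%N])) => i.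
apply: measurableI; first exact: measurable_prob_task.
by have := mtm measurableT [set m | (0 < m <= mmax)%N] I; rewrite setTI.
Qed.

(** Only the term with [m] equal to the actual sizes survives, which trades the random sample size
    for finitely many frozen ones. *)
Lemma good_tasks_split (G : ('I_n -> nat) -> R) tr :
  \1_good_tasks tr * G (sizes tr) =
  \sum_(m : {ffun 'I_n -> 'I_mmax.+1} | [forall i, (0 < m i)%N]) \1_(sized_tasks (fun i => m i)) tr * G (fun i => m i).
Proof.
have [gt|gt] := pselect (good_tasks tr); last first.
  rewrite indicE memNset// mul0r big1// => m /forallP mpos.
  rewrite indicE memNset ?mul0r// => h; apply: gt => i.
  by have [-> ->] := h i; split => //; rewrite mpos -ltnS ltn_ord.
rewrite indicE mem_set// mul1r.
have tlt i : (tm (tnth tr i) < mmax.+1)%N by have [_ /andP[]] := gt i.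
pose m0 := [ffun i => Ordinal (tlt i)].
have m0E : (fun i => m0 i : nat) = sizes tr by apply/funext => i; rewrite ffunE.
rewrite (bigD1 m0)/=; last by apply/forallP => i; rewrite ffunE /=; have [_ /andP[]] := gt i.
rewrite [X in _ + X]big1 ?addr0.
  rewrite m0E indicE mem_set ?mul1r// => i; split => //; exact: (gt i).1.
move=> m /andP[_ mm0]; rewrite indicE memNset ?mul0r// => h.
move/eqP : mm0; apply; apply/ffunP => i; apply/val_inj; rewrite ffunE /=.
by have [_ ->] := h i.
Qed.

Section bounds.
Variables (m : 'I_n -> nat) (u : 'I_n -> Z -> R).
Hypotheses (m_le : forall i, (m i <= mmax)%N) (u01 : forall i z, 0 <= u i z <= 1)
  (mu_ : forall i, measurable_fun setT (u i)).

Lemma sum_ltn_sized i : \sum_(j < mmax | (j < m i)%N) (1 : R) = (m i)%:R.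
Proof. by rewrite -(big_ord_widen _ (fun=> 1) (m_le i)) sumr_const card_ord. Qed.

Lemma sample_sizeE : (sample_size m)%:R = \sum_i (m i)%:R :> R.
Proof. by rewrite /sample_size natr_sum. Qed.

Lemma normalised01 (x : R) : 0 <= x -> x <= (sample_size m)%:R -> 0 <= (sample_size m)%:R^-1 * x <= 1.
Proof.
move=> x0 xN; rewrite mulr_ge0 ?invr_ge0//=.
(* An empty sample gives 0 because [0^-1 = 0]. *)
have [N0|N0] := eqVneq (sample_size m)%:R (0 : R); first by rewrite N0 invr0 mul0r.
by rewrite ler_pdivrMl ?mulr1// lt_def N0 ler0n.
Qed.

Lemma sample_mean01 tr : 0 <= sample_mean m u tr <= 1.
Proof.
apply: normalised01.
  by apply: sumr_ge0 => i _; apply: sumr_ge0 => j _; case/andP: (u01 i (tS j (tnth tr i))).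
rewrite sample_sizeE; apply: ler_sum => i _; rewrite -sum_ltn_sized.
by apply: ler_sum => j _; case/andP: (u01 i (tS j (tnth tr i))).
Qed.

Lemma true_mean01 tr : 0 <= true_mean m u tr <= 1.
Proof.
have h i : 0 <= \int[tD (tnth tr i)]_z u i z <= 1 by exact: Rint01.
apply: normalised01.
  by apply: sumr_ge0 => i _; rewrite mulr_ge0//; case/andP: (h i).
by rewrite sample_sizeE; apply: ler_sum => i _; rewrite ler_piMr//; case/andP: (h i).
Qed.

End bounds.

Lemma bmf_kl_weight dX (X : measurableType dX) (g : X -> n.-tuple Tsk)
    (U : 'I_n -> X * Z -> R) r m : 0 < r < 1 -> (forall i, (m i <= mmax)%N) ->
  measurable_fun setT g -> (forall i, measurable_fun setT (U i)) ->
  (forall i p, 0 <= U i p <= 1) ->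
  bmf (fun x => kl_weight r m (fun i z => U i (x, z)) (g x)).
Proof.
move=> r01 mle mg mU U01; rewrite /kl_weight.
have bU i : bmf (U i) by exact: bmf01.
have mgi i : measurable_fun setT (fun x => tnth (g x) i).
  by apply: (@measurableT_comp _ _ _ _ _ _ (fun t : n.-tuple Tsk => tnth t i)) => //; exact: measurable_tnth.
have mUx i x : measurable_fun setT (fun z => U i (x, z)) by exact: measurableT_comp.
apply: bmfM; last exact: bmf_cst.
apply: bmf_expR; apply: bmfZ; apply: (@bmf_klr_reg _ _ _ _
  (fun x => sample_mean m (fun i z => U i (x, z)) (g x)) (fun x => true_mean m (fun i z => U i (x, z)) (g x))) => //.
- apply: bmfZ; apply: bmf_sum => i; apply: bmf_sum => j.
  apply: (@bmf_comp _ _ X _ R (U i) (fun x => (x, tS j (tnth (g x) i)))) => //.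
  by apply: measurable_fun_pair => //; exact: measurableT_comp.
- apply: bmfZ; apply: bmf_sum => i; apply: bmfZ.
  apply: (@bmf_kernel_Rint _ _ X Z R (fun x => tD (tnth (g x) i)) (U i)) => //; first exact: measurableT_comp.
  by move=> p; case/andP: (U01 i p).
- by move=> x; apply: sample_mean01.
- by move=> x; apply: true_mean01.
Qed.

Lemma bmf_good_kl_weight dX (X : measurableType dX) (g : X -> n.-tuple Tsk)
    (U : 'I_n -> X * Z -> R) r : 0 < r < 1 ->
  measurable_fun setT g -> (forall i, measurable_fun setT (U i)) ->
  (forall i p, 0 <= U i p <= 1) ->
  bmf (fun x => \1_good_tasks (g x) * kl_weight r (sizes (g x)) (fun i z => U i (x, z)) (g x)).
Proof.
move=> r01 mg mU U01.
have -> : (fun x => \1_good_tasks (g x) * kl_weight r (sizes (g x)) (fun i z => U i (x, z)) (g x)) =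
  fun x => \sum_(m : {ffun 'I_n -> 'I_mmax.+1} | [forall i, (0 < m i)%N])
     \1_(sized_tasks (fun i => m i)) (g x) * kl_weight r (fun i => m i) (fun i z => U i (x, z)) (g x).
  by apply/funext => x; rewrite (good_tasks_split (fun m => kl_weight r m (fun i z => U i (x, z)) (g x))).
apply: bmf_sum => m; apply: bmfM; last by apply: bmf_kl_weight => // i; rewrite -ltnS ltn_ord.
apply: (@bmf_comp _ _ X _ R (\1_(sized_tasks (fun i => m i))) g) => //.
by apply: bmf_indic; exact: measurable_sized_tasks.
Qed.

End sample_mgf.

Arguments tkey {R dZ Z dT Tsk} tD tm t.
Arguments sample_size {n} m.
Arguments sample_mean {R dZ Z dT Tsk} tS {n} mmax m u tr.
Arguments true_mean {R dZ Z dT Tsk} tD {n} m u tr.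
Arguments kl_weight {R dZ Z dT Tsk} tD tS {n} mmax r m u tr.
Arguments good_tasks {R dZ Z dT Tsk} tD tm n mmax _.
Arguments sized_tasks {R dZ Z dT Tsk} tD tm {n} m _.
Arguments sizes {dT Tsk} tm {n} tr _.

Section sample_kl_mgf.
Context (R : realType) dZ (Z : measurableType dZ) dT (Tsk : measurableType dT).
Variables (tD : Tsk -> giry Z R) (tm : Tsk -> nat) (tS : nat -> Tsk -> Z).
Hypotheses (mtD : measurable_fun [set: Tsk] tD) (mtm : measurable_fun [set: Tsk] tm)
  (mtS : forall j, measurable_fun [set: Tsk] (tS j)).
Variable tau : probability Tsk R.
Hypothesis tau_iid : forall (B : set (giry Z R * nat)%type) (K : nat)
       (C : 'I_K -> set Z), measurable B -> (forall j, measurable (C j)) ->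
     tau ([set t | B (tD t, tm t)] `&` [set t | forall j : 'I_K, C j (tS j t)])
     = (\int[tau]_(t in [set t | B (tD t, tm t)])
          \big[*%E/1%E]_(j < K) tD t (C j))%E.
Variables (n mmax : nat) (n_gt0 : (0 < n)%N) (Ptr : probability (n.-tuple Tsk) R).
Hypothesis Ptr_prod : forall E : 'I_n -> set Tsk, (forall i, measurable (E i)) ->
     Ptr (tbox E) = \big[*%E/1%E]_(i < n) tau (E i).
Variables (u : 'I_n -> Z -> R) (r : R).
Hypotheses (r01 : 0 < r < 1) (u01 : forall i z, 0 <= u i z <= 1)
  (mu_ : forall i, measurable_fun setT (u i)).

Let factor (e : bool) (x : R) := if e then reg r x else 1 - reg r x.

Let bmf_factor d (T : measurableType d) e (f : T -> R) : bmf f -> bmf (fun x => factor e (f x)).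
Proof. by move=> bf; case: e; [exact: bmf_reg|apply: bmfB; [exact: bmf_cst|exact: bmf_reg]]. Qed.

Let factor01 e x : 0 <= x <= 1 -> 0 <= factor e x <= 1.
Proof. by move=> x01; have /andP[a b] := reg01 _ _ r01 x01; case: e; rewrite /factor ?a// subr_ge0 b gerBl. Qed.

Let bu i : bmf (u i). Proof. exact: bmf01. Qed.
Let bI m : bmf (\1_(@sized_tasks R dZ Z dT Tsk tD tm n m) : n.-tuple Tsk -> R).
Proof. by apply: bmf_indic; exact: measurable_sized_tasks. Qed.

Let v i (tr : n.-tuple Tsk) := \int[tD (tnth tr i)]_z u i z.

Let bv i : bmf (v i).
Proof.
apply: (@bmf_Rint_giry _ _ R _ Z 'I_n (fun i (tr : n.-tuple Tsk) => tD (tnth tr i)) _ (u i) i) => //.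
  by move=> j; apply: measurableT_comp => //; exact: measurable_tnth.
by move=> z; case/andP: (u01 i z).
Qed.

Let v01 i tr : 0 <= v i tr <= 1. Proof. exact: Rint01. Qed.

Let bX i j : bmf (fun tr : n.-tuple Tsk => u i (tS j (tnth tr i))).
Proof.
apply: (@bmf_comp _ _ _ _ _ (u i)) => //; apply: measurableT_comp => //.
exact: measurable_tnth.
Qed.

(* Conditionally on the distributions and the sample sizes, samples may be
   replaced by their means in multi-affine expressions. *)
Lemma conditional_rule (m : 'I_n -> nat) (e : 'I_n -> 'I_mmax -> bool) (c : ('I_n -> R) -> R) K :
  (forall i, (m i <= mmax)%N) ->
  (forall w : 'I_n -> R, (forall i, 0 <= w i <= 1) -> `|c w| <= K) ->
  (forall (w_ : nat -> 'I_n -> R) (w : 'I_n -> R), (forall L i, 0 <= w_ L i <= 1) ->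
    (forall i, 0 <= w i <= 1) -> (forall i, w_ L i @[L --> \oo] --> w i) ->
    c (w_ L) @[L --> \oo] --> c w) ->
  measurable_fun setT (fun tr => c (v ^~ tr)) /\
  \int[Ptr]_tr (\1_(sized_tasks tD tm m) tr *
     \prod_i \prod_(j < mmax | (j < m i)%N) factor (e i j) (u i (tS j (tnth tr i))) * c (v ^~ tr)) =
  \int[Ptr]_tr (\1_(sized_tasks tD tm m) tr *
     \prod_i \prod_(j < mmax | (j < m i)%N) factor (e i j) (v i tr) * c (v ^~ tr)).
Proof.
move=> mle cK cc.
apply: (@grid_ext _ _ R Ptr 'I_n v _ _ c K) => //.
- by move=> i; exact: (bv i).1.
- by apply: bmfM => //; apply: bmf_prod => i; apply: bmf_prod => j; exact: bmf_factor.
- by apply: bmfM => //; apply: bmf_prod => i; apply: bmf_prod => j; exact: bmf_factor.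
move=> A mA.
(* The mean of [u i] is a function of the task's distribution, so the event that it lies in [A i] is
   part of the condition on the key and survives the replacement of the samples. *)
pose B i := [set p : giry Z R * nat | p.1 [set: Z] = 1%E /\ p.2 = m i /\ A i (\int[p.1]_z u i z)].
have mB i : measurable (B i).
  apply: measurableI.
    have h : measurable_fun setT (fun p : giry Z R * nat => p.1 [set: Z]).
      by apply: (@measurableT_comp _ _ _ _ _ _ (giry_ev ^~ [set: Z])) => //; exact: measurable_giry_ev.
    by have := h measurableT _ (emeasurable_set1 1%E); rewrite setTI.
  apply: measurableI.
    by have := @measurable_snd _ _ (giry Z R) nat measurableT [set m i] I; rewrite setTI.
  have [h _] : bmf (fun p : giry Z R * nat => \int[p.1]_z u i z).
    apply: (@bmf_Rint_giry _ _ R _ Z unit (fun _ p => p.1) _ (u i) tt) => // [_|z].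
      exact: measurable_fst.
    by case/andP: (u01 i z).
  by have := h measurableT _ (mA i); rewrite setTI.
(* Stream positions from [m i] on get the factor 1, so that all tasks share the length [mmax]. *)
pose h i (j : 'I_mmax) : Z -> R := if (j < m i)%N then (fun z => factor (e i j) (u i z)) else cst 1.
have mh i j : measurable_fun setT (h i j).
  by rewrite /h; case: ifP => _; [exact: (bmf_factor _ _ _ _ (bu i)).1|exact: measurable_cst].
have h01 i j z : 0 <= h i j z <= 1 by rewrite /h; case: ifP => _; [exact: factor01|rewrite ler01 lexx].
have IE tr : \1_(sized_tasks tD tm m) tr * \prod_i \1_(A i) (v i tr) =
    \prod_i \1_(B i) (tkey tD tm (tnth tr i)) :> R.
  rewrite (prod_indic _ _ _ _ (fun i => [set tr | A i (v i tr)])).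
  rewrite (prod_indic _ _ _ _ (fun i => [set tr : n.-tuple Tsk | B i (tkey tD tm (tnth tr i))])).
  transitivity (\1_(sized_tasks tD tm m `&` [set y | forall j : 'I_n, [set tr | A j (v j tr)] y]) tr : R); first by rewrite indicI.
  congr (\1_ _ _); apply/seteqP; split => x /=.
    by move=> [h1 h2] i; have [a b] := h1 i; split => //; split => //; exact: h2.
  by move=> h1; split => i; have [a [b c']] := h1 i.
have -> : \int[Ptr]_x (\1_(sized_tasks tD tm m) x *
     \prod_i \prod_(j < mmax | (j < m i)%N) factor (e i j) (u i (tS j (tnth x i))) * \prod_i \1_(A i) (v i x)) =
   \int[Ptr]_tr \prod_i (\1_(B i) (tkey tD tm (tnth tr i)) * \prod_j h i j (tS j (tnth tr i))).
  apply: eq_Rintegral => tr _; rewrite big_split/= -IE mulrAC; congr (_ * _).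
  apply: eq_bigr => i _; rewrite big_mkcond; apply: eq_bigr => j _.
  by rewrite /h; case: ifP.
rewrite (@sample_rule _ _ Z _ Tsk tD tm tS mtD mtm mtS tau tau_iid n Ptr Ptr_prod mmax B h mB mh h01).
apply: eq_Rintegral => tr _; rewrite big_split/= -IE [RHS]mulrAC.
have [st|st] := pselect (sized_tasks tD tm m tr); last by rewrite indicE memNset// !mul0r.
congr (_ * _); apply: eq_bigr => i _; rewrite [RHS]big_mkcond; apply: eq_bigr => j _.
(* Elements of [giry] may have mass below one; mass one on [sized_tasks] makes the affine map
   [reg r] commute with the integral. *)
have [D1 _] := st i.
have C (a : R) : \int[tD (tnth tr i)]_z a = a.
  by rewrite Rintegral_cst// -[RHS]mulr1; congr (_ * _); rewrite -[RHS]/(fine 1%E); congr fine.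
have E : \int[tD (tnth tr i)]_z reg r (u i z) = reg r (v i tr).
  rewrite RintD; [|exact: bmfZ|exact: bmf_cst].
  by rewrite (RintZ _ _ _ _ (1 - r) (u i) (bu i)) C.
rewrite /h; case: ifP => _; last exact: C.
rewrite /factor; case: (e i j); first exact: E.
by rewrite RintB; [rewrite C E|exact: bmf_cst|exact: bmf_reg].
Qed.

Lemma sized_kl_mgf (m : 'I_n -> nat) : (forall i, (0 < m i <= mmax)%N) ->
  \int[Ptr]_tr (\1_(sized_tasks tD tm m) tr * kl_weight tD tS mmax r m u tr) <=
  \int[Ptr]_tr \1_(sized_tasks tD tm m) tr.
Proof.
move=> mpos; have mle i : (m i <= mmax)%N by case/andP: (mpos i).
set N := sample_size m.
have N0 : (0 < N)%N.
  by rewrite /N /sample_size (bigD1 (Ordinal n_gt0))//= addn_gt0; case/andP: (mpos (Ordinal n_gt0)) => ->.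
have NR : 0 < N%:R :> R by rewrite ltr0n.
have [rl [url srl prl sml]] : exists rl : seq ('I_n * 'I_mmax), [/\ uniq rl, size rl = N,
    forall F : 'I_n * 'I_mmax -> R, \prod_(p <- rl) F p = \prod_i \prod_(j < mmax | (j < m i)%N) F (i, j) &
    forall F : 'I_n * 'I_mmax -> R, \sum_(p <- rl) F p = \sum_i \sum_(j < mmax | (j < m i)%N) F (i, j)].
  exists (enum [pred p : 'I_n * 'I_mmax | (p.2 < m p.1)%N]); split.
  - exact: enum_uniq.
  - rewrite -cardE -sum1_card /N /sample_size.
    rewrite (eq_bigr (fun i => \sum_(j < mmax | (j < m i)%N) 1)%N); last first.
      by move=> i _; rewrite -(big_ord_widen _ (fun=> 1%N) (mle i)) sum1_card card_ord.
    by rewrite pair_big_dep.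
  - by move=> F; rewrite big_enum pair_big_dep; apply: eq_bigr => -[].
  - by move=> F; rewrite big_enum pair_big_dep; apply: eq_bigr => -[].
have [L [Ls LE]] := @pb_expand R _ rl url.
pose X (tr : n.-tuple Tsk) (p : 'I_n * 'I_mmax) := u p.1 (tS p.2 (tnth tr p.1)).
pose V (tr : n.-tuple Tsk) (p : 'I_n * 'I_mmax) := v p.1 tr.
have qE tr : sample_mean tS mmax m u tr = N%:R^-1 * \sum_(x <- [seq X tr p | p <- rl]) x.
  by rewrite big_map sml.
have pE tr : true_mean tD m u tr = N%:R^-1 * \sum_(x <- [seq V tr p | p <- rl]) x.
  rewrite big_map sml; congr (_ * _); apply: eq_bigr => i _.
  rewrite -(sum_ltn_sized R n mmax m mle) mulr_suml; apply: eq_bigr => j _.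
  by rewrite mul1r.
have X01 tr : all in01 [seq X tr p | p <- rl] by apply/allP => _ /mapP[p _ ->]; exact: u01.
have V01 tr : all in01 [seq V tr p | p <- rl] by apply/allP => _ /mapP[p _ ->]; exact: v01.
have R01 s : all in01 s -> all in01 [seq reg r x | x <- s].
  by move=> s01; apply/allP => _ /mapP[x /(allP s01) x01 ->]; exact: reg01.
have p01 tr : 0 <= true_mean tD m u tr <= 1 by rewrite pE -srl -(size_map (V tr)); exact: mean01.
have q01 tr : 0 <= sample_mean tS mmax m u tr <= 1 by rewrite qE -srl -(size_map (X tr)); exact: mean01.
(* On [0,1]-valued vectors of means this coefficient is bounded and continuous, as
   [conditional_rule] requires. *)
pose c k b (w : 'I_n -> R) := KTratio (reg r (N%:R^-1 * \sum_i (m i)%:R * w i)) k b.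
pose PX (l : nat * nat * ('I_n * 'I_mmax -> bool)) (tr : n.-tuple Tsk) :=
  \prod_i \prod_(j < mmax | (j < m i)%N) factor (l.2 (i, j)) (u i (tS j (tnth tr i))).
pose PV (l : nat * nat * ('I_n * 'I_mmax -> bool)) (tr : n.-tuple Tsk) :=
  \prod_i \prod_(j < mmax | (j < m i)%N) factor (l.2 (i, j)) (v i tr).
have XE tr : pb (KTratio (reg r (true_mean tD m u tr))) [seq reg r x | x <- [seq X tr p | p <- rl]] =
    \sum_(l <- L) c l.1.1 l.1.2 (v ^~ tr) * PX l tr.
  rewrite -map_comp (LE _ (fun p => reg r (X tr p))); apply: eq_bigr => l _.
  by congr (_ * _); rewrite prl.
have VE tr : pb (KTratio (reg r (true_mean tD m u tr))) [seq reg r x | x <- [seq V tr p | p <- rl]] =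
    \sum_(l <- L) c l.1.1 l.1.2 (v ^~ tr) * PV l tr.
  rewrite -map_comp (LE _ (fun p => reg r (V tr p))); apply: eq_bigr => l _.
  by congr (_ * _); rewrite prl.
have w01 (w : 'I_n -> R) : (forall i, 0 <= w i <= 1) -> 0 <= N%:R^-1 * \sum_i (m i)%:R * w i <= 1.
  move=> h; apply: normalised01.
    by apply: sumr_ge0 => i _; rewrite mulr_ge0//; case/andP: (h i).
  by rewrite sample_sizeE; apply: ler_sum => i _; rewrite ler_piMr//; case/andP: (h i).
have CR (l : nat * nat * ('I_n * 'I_mmax -> bool)) :=
  @conditional_rule m (fun i j => l.2 (i, j)) (c l.1.1 l.1.2) (KT l.1.1 l.1.2 / ((r / 2) ^+ l.1.1 * (r / 2) ^+ l.1.2)) mle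
   (fun w h => KTratio_bound R r l.1.1 l.1.2 _ r01 (w01 w h)).
have {}CR l : measurable_fun setT (fun tr => c l.1.1 l.1.2 (v ^~ tr)) /\
    \int[Ptr]_tr (\1_(sized_tasks tD tm m) tr * PX l tr * c l.1.1 l.1.2 (v ^~ tr)) =
    \int[Ptr]_tr (\1_(sized_tasks tD tm m) tr * PV l tr * c l.1.1 l.1.2 (v ^~ tr)).
  apply: CR => w_ w w_01 w01' cw; apply: cvg_KTratio => //; first exact: w01.
  apply: cvgM; first exact: cvg_cst.
  by apply: cvg_sumr => i; apply: cvgM; [exact: cvg_cst|exact: cw].
have bc (l : nat * nat * ('I_n * 'I_mmax -> bool)) : bmf (fun tr => c l.1.1 l.1.2 (v ^~ tr)).
  split; first exact: (CR l).1.
  by eexists => tr; apply: (KTratio_bound R r l.1.1 l.1.2 _ r01); exact: w01.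
have bPX l : bmf (PX l) by apply: bmf_prod => i; apply: bmf_prod => j; exact: bmf_factor.
have bPV l : bmf (PV l) by apply: bmf_prod => i; apply: bmf_prod => j; exact: bmf_factor.
have bS (P : _ -> n.-tuple Tsk -> R) : (forall l, bmf (P l)) ->
    bmf (fun tr => \1_(sized_tasks tD tm m) tr * \sum_(l <- L) c l.1.1 l.1.2 (v ^~ tr) * P l tr).
  by move=> bP; apply: bmfM => //; apply: bmf_sum => l; exact: bmfM.
have ES (P : _ -> n.-tuple Tsk -> R) : (forall l, bmf (P l)) ->
    \int[Ptr]_tr (\1_(sized_tasks tD tm m) tr * \sum_(l <- L) c l.1.1 l.1.2 (v ^~ tr) * P l tr) =
    \sum_(l <- L) \int[Ptr]_tr (\1_(sized_tasks tD tm m) tr * P l tr * c l.1.1 l.1.2 (v ^~ tr)).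
  move=> bP; rewrite -Rint_sum; last by move=> l; apply: bmfM => //; exact: bmfM.
  by apply: eq_Rintegral => tr _; rewrite mulr_sumr; apply: eq_bigr => l _; rewrite mulrA mulrAC.
apply: (@le_trans _ _ (\int[Ptr]_tr (\1_(sized_tasks tD tm m) tr * \sum_(l <- L) c l.1.1 l.1.2 (v ^~ tr) * PX l tr))).
  apply: Rint_le.
  - apply: bmfM => //; apply: (@bmf_kl_weight _ _ Z _ Tsk tD tS mtD mtS n mmax _ _ id (fun i p => u i p.2)) => // i.
    exact: measurableT_comp.
  - exact: bS.
  move=> tr; apply: ler_wpM2l; first by rewrite indicE ler0n.
  rewrite -XE /kl_weight -/N ler_pdivrMr ?mulr_gt0 ?sqrtr_gt0// [leRHS]mulrC.
  have := @expR_klr_le R [seq reg r x | x <- [seq X tr p | p <- rl]]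
    (reg r (sample_mean tS mmax m u tr)) (reg r (true_mean tD m u tr)).
  rewrite !size_map srl; apply => //.
  - exact: R01.
  - by rewrite reg_mean ?size_map srl// -qE.
  - exact: reg_gt0.
  - exact: reg_gt0.
(* Each product of sample factors becomes a product of their means, while the coefficient, a
   function of the means alone, stays. The resulting sum is at most 1 for every [tr]. *)
rewrite ES// (eq_bigr _ (fun l _ => (CR l).2)) -ES//.
apply: Rint_le => //; first exact: bS.
move=> tr; rewrite -VE -[leRHS]mulr1; apply: ler_wpM2l; first by rewrite indicE ler0n.
apply: pb_KTratio_le1; [exact: R01|exact: reg_gt0|].
by rewrite reg_mean ?size_map srl// -pE.
Qed.

Lemma sample_kl_mgf :
  \int[Ptr]_tr (\1_(good_tasks tD tm n mmax) tr * kl_weight tD tS mmax r (sizes tm tr) u tr) <= 1.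
Proof.
under eq_Rintegral do rewrite (good_tasks_split _ _ Z _ Tsk tD tm n mmax (fun m => kl_weight tD tS mmax r m u _)).
have bW (m : 'I_n -> nat) : (forall i, (m i <= mmax)%N) -> bmf (fun tr => \1_(sized_tasks tD tm m) tr * kl_weight tD tS mmax r m u tr).
  move=> mle; apply: bmfM => //; apply: (@bmf_kl_weight _ _ Z _ Tsk tD tS mtD mtS n mmax _ _ id (fun i p => u i p.2)) => // i.
  exact: measurableT_comp.
have mle (m : {ffun 'I_n -> 'I_mmax.+1}) i : (m i <= mmax)%N by rewrite -ltnS ltn_ord.
rewrite Rint_sum; last by move=> m; exact: bW.
apply: (@le_trans _ _ (\sum_(m : {ffun 'I_n -> 'I_mmax.+1} | [forall i, (0 < m i)%N]) \int[Ptr]_tr \1_(sized_tasks tD tm (fun i => m i)) tr)).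
  by apply: ler_sum => m /forallP mp; apply: sized_kl_mgf => i; rewrite mp mle.
rewrite -Rint_sum// -[leRHS](Rint_cst_prob _ _ _ Ptr).
apply: Rint_le; [exact: bmf_sum|exact: bmf_cst|move=> tr].
have := good_tasks_split _ _ Z _ Tsk tD tm n mmax (fun=> 1 : R) tr; rewrite mulr1.
under eq_bigr do rewrite mulr1.
by move=> <-; rewrite indicE lern1 leq_b1.
Qed.

End sample_kl_mgf.

(** * Kernels, Markov bounds and change of measure *)

Section box_kernels.
Context (R : realType) dX (X : measurableType dX) dY (Y : measurableType dY)
  dF (F : measurableType dF) (n : nat).

Definition boxes : set (set (Y * n.-tuple F)) :=
  [set E | exists B C, [/\ measurable B, (forall i, measurable (C i)) & E = B `*` tbox (C : 'I_n -> set F)]].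

Lemma measurable_tbox (C : 'I_n -> set F) : (forall i, measurable (C i)) -> measurable (tbox C).
Proof. exact: measurable_tuple_forall. Qed.

Lemma measurable_boxes : @measurable _ (Y * n.-tuple F)%type = <<s boxes >>.
Proof.
apply/seteqP; split; last first.
  apply: smallest_sub; first exact: sigma_algebra_measurable.
  by move=> _ [B [C [mB mC ->]]]; apply: measurableX => //; exact: measurable_tbox.
have h : measurable_fun [set: g_sigma_algebraType boxes]
    (fun x : g_sigma_algebraType boxes => x : (Y * n.-tuple F)%type).
  apply/measurable_fun_pairP; split.
    move=> _ B mB; rewrite setTI; apply: sub_sigma_algebra; exists B, (fun=> setT); split => //.
    by apply/seteqP; split => -[y t] /=; [|case].
  apply/measurable_fun_tnthP => i _ A mA; rewrite setTI; apply: sub_sigma_algebra.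
  exists setT, (fun j => if j == i then A else setT); split => //.
    by move=> j; case: ifP.
  apply/seteqP; split => -[y t] /=; last by move=> [_ /(_ i)]; rewrite eqxx.
  by move=> At; split => // j; case: eqP => // ->.
by move=> E mE; have := h measurableT _ mE; rewrite setTI.
Qed.

Lemma setI_closed_boxes : setI_closed boxes.
Proof.
move=> _ _ [B [C [mB mC ->]]] [B' [C' [mB' mC' ->]]].
exists (B `&` B'), (fun i => C i `&` C' i); split; [exact: measurableI|by move=> i; exact: measurableI|].
apply/seteqP; split => -[y t] /=.
  by move=> [[By Ct] [B'y C't]]; split => // i; split.
by move=> [[By B'y] CC]; split; split => // i; have [] := CC i.
Qed.

(** The induced priors are specified on boxes only. These form a generating pi-system, and Dynkin
    induction extends measurability of the kernel to all measurable sets. *)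
Lemma measurable_box_kernel (kappa : X -> probability (Y * n.-tuple F)%type R) :
  (forall B C, measurable B -> (forall i, measurable (C i)) ->
    measurable_fun setT (fun x => kappa x (B `*` tbox C))) ->
  measurable_fun setT (fun x => kappa x : giry (Y * n.-tuple F)%type R).
Proof.
move=> H; apply: measurable_giry_codensity => // E mE.
rewrite measurable_boxes in mE; move: E mE.
apply: (dynkin_induction measurable_boxes setI_closed_boxes).
- have := H setT (fun=> setT) measurableT (fun=> measurableT).
  suff -> : [set: Y] `*` tbox (fun=> [set: F]) = [set: Y * n.-tuple F] by [].
  by apply/seteqP; split => // -[y t] _; split.
- by move=> _ [B [C [mB mC ->]]]; exact: H.
- move=> S mS HS.
  apply: (eq_measurable_fun (fun x => 1 - kappa x S)%E) => [x _|].
    by rewrite -probability_setC.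
  exact: emeasurable_funB.
- move=> S mS tS HS.
  apply: (eq_measurable_fun (fun x => \sum_(0 <= k <oo) kappa x (S k))%E) => [x _|].
    by rewrite measure_semi_bigcup//; exact: bigcup_measurable.
  by apply: ge0_emeasurable_sum => // k _; exact: HS.
Qed.

Lemma measurable_iid_kernel (HP : X -> giry (giry F R) R)
    (kappa : X -> probability (giry F R * n.-tuple F)%type R) : measurable_fun setT HP ->
  (forall x (B : set (giry F R)) (C : 'I_n -> set F), measurable B -> (forall i, measurable (C i)) ->
    kappa x (B `*` tbox C) = (\int[HP x]_(P in B) \big[*%E/1%E]_(i < n) P (C i))%E) ->
  forall B C, measurable B -> (forall i, measurable (C i)) ->
    measurable_fun setT (fun x => kappa x (B `*` tbox C)).
Proof.
move=> mHP H B C mB mC; under eq_fun do rewrite H// integral_mkcond.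
apply: (@measurableT_comp _ _ _ _ _ _ (fun m => giry_int m _)) => //.
have p0 (P : giry F R) : (0 <= \big[*%E/1%E]_(i < n) P (C i))%E.
  by elim/big_ind: _ => // a b a0 b0; exact: mule_ge0.
apply: measurable_giry_int; last by move=> P; rewrite patchE; case: ifP.
apply/measurable_restrict => //; apply: measurable_funTS.
rewrite (_ : (fun P : giry F R => _) = (fun P => (\prod_(i < n) fine (P (C i)))%:E)); last first.
  by apply/funext => P; rewrite (fine_prode _ _ (fun i => P (C i)))// => i; exact: fin_num_measure.
apply/measurable_EFinP; apply: (bmf_prod _ _ _ _ _ _ _ _).1 => i.
apply: bmf01.
  by apply: measurableT_comp => //; exact: (measurable_giry_ev (mC i)).
move=> P; rewrite fine_ge0//= -lee_fin fineK ?fin_num_measure//.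
by apply: le_trans (@sprobability_setT _ _ _ P); apply: le_measure; rewrite ?inE.
Qed.

Lemma Rint_marginal (mu : probability (Y * n.-tuple F)%type R) (nu : giry F R) (i : 'I_n) (f : F -> R) :
  (forall D, measurable D -> mu ([set: Y] `*` tbox (fun j => if j == i then D else setT)) = nu D) ->
  measurable_fun setT f -> (forall x, 0 <= f x) ->
  \int[mu]_w f (tnth w.2 i) = \int[nu]_x f x.
Proof.
move=> H mf f0; rewrite /Rintegral; congr fine.
have mg : measurable_fun setT (fun w : Y * n.-tuple F => tnth w.2 i).
  by apply: (@measurableT_comp _ _ _ _ _ _ (fun t : n.-tuple F => tnth t i)) => //; exact: measurable_tnth.
rewrite -(@ge0_integral_pushforward _ _ _ _ R _ mg mu setT (EFin \o f)) //=; last 2 first.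
- exact/measurable_EFinP.
- by move=> x _; rewrite lee_fin.
apply: eq_measure_integral => D mD _; rewrite /= /pushforward -H//; congr (mu _).
apply/seteqP; split => -[y t] /=; last by move=> [_ /(_ i)]; rewrite eqxx.
by move=> At; split => // j; case: eqP => // ->.
Qed.

End box_kernels.

Section pac_bayes.
Context (R : realType).

Lemma markov_mixture dO (Omega : measurableType dO) (P : probability Omega R)
    dX (X : measurableType dX) (nu : giry X R) (g : Omega * X -> R) (c : R) :
  0 < c -> bmf g -> (forall p, 0 <= g p) ->
  (forall x, \int[P]_w g (w, x) <= 1) ->
  measurable [set w | \int[nu]_x g (w, x) <= c] /\
  ((1 - c^-1)%:E <= P [set w | (\int[nu]_x g (w, x) <= c)%R])%E.
Proof.
move=> c0 bg g0 H.
have bI : bmf (fun w => \int[nu]_x g (w, x)).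
  by apply: (@bmf_kernel_Rint _ _ Omega X R (fun=> nu) g) => //; exact: measurable_cst.
set A := [set w | _]; have mA : measurable A.
  have := bI.1 measurableT _ (measurable_itv `]-oo, c]); rewrite setTI.
  by congr measurable; apply/seteqP; split => w /=; rewrite in_itv.
split=> //; have mAC : measurable (~` A) by exact: measurableC.
have bgx x : bmf (fun w => g (w, x)).
  by split; [exact: measurableT_comp bg.1 _|case: bg => _ [K gK]; exists K].
have bgw w : bmf (fun x => g (w, x)).
  by split; [exact: measurableT_comp bg.1 _|case: bg => _ [K gK]; exists K].
have I1 : (\int[P]_w (\int[nu]_x g (w, x))%:E <= 1)%E.
  have mgE : measurable_fun setT (EFin \o g) by apply/measurable_EFinP; exact: bg.1.
  have -> : (\int[P]_w (\int[nu]_x g (w, x))%:E = \int[P]_w \int[nu]_x (EFin \o g) (w, x))%E.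
    by apply: eq_integral => w _; rewrite EFin_Rint.
  have := @fubini_tonelli _ _ Omega X R P nu (EFin \o g) mgE.
  rewrite /fubini_F /fubini_G => ->; last by move=> p; rewrite lee_fin.
  apply: (@le_trans _ _ (\int[nu]_x cst 1 x)%E).
    by apply: le_integral_total => x; rewrite -EFin_Rint// lee_fin.
  by rewrite integral_cst// mul1e; exact: sprobability_setT.
have cAC : c * fine (P (~` A)) <= 1.
  rewrite -lee_fin; apply: le_trans I1.
  rewrite -Rint_indic// -RintZ; last exact: bmf_indic.
  rewrite EFin_Rint; last by apply: bmfZ; exact: bmf_indic.
  apply: le_integral_total => w; rewrite lee_fin indicE.
  have [Aw|Aw] := pselect (A w).
    by rewrite memNset ?mulr0 ?Rintegral_ge0//; move=> /(_ Aw).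
  by rewrite mem_set// mulr1 ltW// ltNge; apply/negP.
have PAfin : P A \is a fin_num by exact: fin_num_measure.
have PC : fine (P (~` A)) = 1 - fine (P A) by rewrite probability_setC// fineB.
rewrite -[P A]fineK// lee_fin lerBlDr -lerBlDl -PC -[c^-1]mulr1 ler_pdivlMl//.
Qed.

Definition infinitely_often {T} (E : nat -> set T) : set T :=
  [set x | forall N, exists2 k, (N <= k)%N & E k x].

(** The unions over [k >= N] decrease to the limsup event and each has probability at least [1 - a];
    continuity from above keeps this bound, so using countably many [k] costs no confidence. *)
Lemma infinitely_often_prob d (T : measurableType d) (P : probability T R) (E : nat -> set T) (a : R) :
  (forall k, measurable (E k)) -> (forall k, ((1 - a)%:E <= P (E k))%E) ->
  measurable (infinitely_often E) /\ ((1 - a)%:E <= P (infinitely_often E))%E.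
Proof.
move=> mE PE.
pose F N := \bigcup_(k in [set k | (N <= k)%N]) E k.
have mF N : measurable (F N) by apply: bigcup_measurable.
have IF : infinitely_often E = \bigcap_N F N.
  apply/seteqP; split => x /= h.
    by move=> N _; have [k Nk Ekx] := h N; exists k.
  by move=> N; have [k /= Nk Ekx] := h N I; exists k.
have mI : measurable (\bigcap_N F N) by apply: bigcap_measurableType.
rewrite IF; split => //.
have cv : P \o F @ \oo --> P (\bigcap_N F N).
  apply: nonincreasing_cvg_mu => //.
    by rewrite ltey_eq fin_num_measure.
  by move=> M N MN; apply/subsetPset => x [k /= Nk Ekx]; exists k => //=; exact: leq_trans Nk.
rewrite -(cvg_lim _ cv)//; apply: lime_ge; first by apply/cvg_ex; eexists; exact: cv.
apply: nearW => N; apply: le_trans (PE N) _; apply: le_measure; rewrite ?inE//.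
by move=> x Ex; exists N => /=.
Qed.

(* The exponent psi may differ from the dominating phi: only the latter's
   exponential moment is needed. *)
Lemma pac_bayes_two_level dA (Alg : measurableType dA) dW (W : measurableType dW)
    (rho pi : probability Alg R) (fP fQ : Alg -> probability W R)
    (mfP : measurable_fun setT (fun A => fP A : giry W R))
    (phi psi : W -> R) (l : Alg -> R) (C : R) :
  bmf phi -> bmf psi -> bmf l -> (forall w, psi w <= phi w) ->
  (forall A, l A = \int[fQ A]_w psi w) ->
  \int[pi]_A \int[fP A]_w expR (phi w) <= C ->
  ((\int[rho]_A l A)%:E <= KL rho pi + \int[rho]_A KL (fQ A) (fP A) + (ln C)%:E)%E.
Proof.
move=> bphi bpsi bl psi_phi lE IC.
pose G A := \int[fP A]_w expR (phi w).
have bphi' := bmf_expR _ _ _ _ bphi.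
have bG : bmf G.
  apply: (@bmf_kernel_Rint _ _ Alg W R fP (fun p => expR (phi p.2))) => //.
    by apply: (@bmf_comp _ _ _ _ _ (fun w => expR (phi w)) snd) => //; exact: measurable_snd.
have [_ [K phiK]] := bphi.
have Gge A : expR (- K) <= G A.
  rewrite -[leLHS](Rint_cst_prob _ _ _ (fP A)); apply: Rint_le => //; first exact: bmf_cst.
  by move=> w; rewrite ler_expR lerNl (le_trans _ (phiK w))// -normrN ler_norm.
have G0 A : 0 < G A by apply: lt_le_trans (Gge A); rewrite expR_gt0.
have blnG : bmf (fun A => ln (G A)).
  split; first by apply: measurableT_comp => //; exact: bG.1.
  have [_ [K' GK']] := bG; exists (Num.max K `|ln K'|) => A.
  rewrite ler_norml; apply/andP; split.
    rewrite lerNl le_max; apply/orP; left.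
    by rewrite lerNl -[leLHS]expRK ler_ln ?posrE ?expR_gt0.
  rewrite le_max; apply/orP; right; apply: le_trans (ler_norm _).
  have GA := le_trans (ler_norm _) (GK' A).
  by rewrite ler_ln ?posrE// (lt_le_trans (G0 A) GA).
have C0 : 0 < C.
  apply: lt_le_trans IC; apply: (@lt_le_trans _ _ (\int[pi]_A expR (- K))).
    by rewrite Rint_cst_prob expR_gt0.
  by apply: Rint_le => //; exact: bmf_cst.
have fiber A : ((l A - ln (G A))%:E <= KL (fQ A) (fP A))%E.
  have := donsker_varadhan _ _ _ (fQ A) (fP A) psi bpsi; rewrite -lE EFinB => h.
  have P1 := Rint_expR_gt0 _ _ _ (fP A) psi bpsi.
  have LE : \int[fP A]_w expR (psi w) <= G A.
    by apply: Rint_le; [exact: bmf_expR|exact: bphi'|move=> w; rewrite ler_expR; exact: psi_phi].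
  have LN : ln (\int[fP A]_w expR (psi w)) <= ln (G A).
    by rewrite ler_ln; [exact: LE|rewrite posrE; exact: P1|rewrite posrE; exact: G0].
  rewrite leeBlDr; last by [].
  by apply: le_trans h _; apply: leeD2l; rewrite lee_fin; exact: LN.
have base := donsker_varadhan _ _ _ rho pi _ blnG.
have base' : ((\int[rho]_A ln (G A))%:E <= KL rho pi + (ln C)%:E)%E.
  apply: le_trans base _; rewrite leeD2l// lee_fin.
  have -> : \int[pi]_A expR (ln (G A)) = \int[pi]_A G A.
    by apply: eq_Rintegral => A _; rewrite lnK ?posrE.
  rewrite ler_ln ?posrE//; apply: (@lt_le_trans _ _ (\int[pi]_A expR (- K))).
    by rewrite Rint_cst_prob expR_gt0.
  by apply: Rint_le => //; exact: bmf_cst.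
have top : ((\int[rho]_A l A - \int[rho]_A ln (G A))%:E <= \int[rho]_A KL (fQ A) (fP A))%E.
  rewrite -RintB// EFin_Rint; last exact: bmfB.
  exact: le_integral_total.
(* The integral of [ln G] is controlled by the change of measure between algorithms, the remainder
   by the averaged change of measure between hypotheses. *)
have -> : \int[rho]_A l A = \int[rho]_A ln (G A) + (\int[rho]_A l A - \int[rho]_A ln (G A)) by rewrite addrC subrK.
by rewrite EFinD addeAC; apply: leeD.
Qed.

Lemma kl_aff_reg (c d q p r : R) : kl_aff c d (reg r q) (reg r p) =
  (1 - r) * kl_aff c d q p + r * kl_aff c d (1 / 2) (1 / 2).
Proof. by rewrite /kl_aff /reg; field. Qed.

(** The offset two keeps [shrink 0 = 1/2] strictly below one. *)
Definition shrink k : R := k.+2%:R^-1.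

Lemma shrink01 k : 0 < shrink k < 1.
Proof. by rewrite /shrink invr_gt0 ltr0n invf_lt1 ?ltr0n// ltr1n. Qed.

(** [reg r] mixes its argument with 1/2 and [kl_aff] is affine in the pair, so the error is exactly
    [shrink k * N * (a - b)]; arbitrarily large [k] make it negligible. *)
Lemma kl_aff_limit (N : nat) (c d q p : R) (B : \bar R) :
  (forall K, exists2 k, (K <= k)%N & ((N%:R * kl_aff c d (reg (shrink k) q) (reg (shrink k) p))%:E <= B)%E) ->
  ((N%:R * kl_aff c d q p)%:E <= B)%E.
Proof.
case: B => [B|_|H]; [|by rewrite leey|by have [k _] := H 0%N].
move=> H; rewrite lee_fin; apply/ler_addgt0Pr => e e0.
set a := kl_aff c d q p; set b := kl_aff c d (1 / 2) (1 / 2).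
have y0 : 0 <= N%:R * `|a - b| / e by rewrite divr_ge0 ?mulr_ge0// ltW.
have /andP[_ yK] := truncn_itv y0.
have [k Kk] := H (Num.truncn (N%:R * `|a - b| / e)); rewrite lee_fin kl_aff_reg -/a -/b => h.
have h2 : N%:R * `|a - b| < e * k.+2%:R.
  rewrite [ltRHS]mulrC -ltr_pdivrMr//; apply: lt_le_trans yK _.
  by rewrite ler_nat; lia.
have h3 : shrink k * (N%:R * (a - b)) <= e.
  rewrite /shrink ler_pdivrMl// [leRHS]mulrC; apply: ltW; apply: le_lt_trans h2.
  by rewrite ler_wpM2l// ler_norm.
by move: h h3; lra.
Qed.

End pac_bayes.

(** * The two high-probability events *)

Arguments shrink {R} k.
Arguments shrink01 {R} k.
Lemma Rint_swap (R : realType) dX (X : measurableType dX) dY (Y : measurableType dY)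
    (mu : giry X R) (nu : giry Y R) (g : X * Y -> R) : bmf g -> (forall p, 0 <= g p) ->
  \int[mu]_x \int[nu]_y g (x, y) = \int[nu]_y \int[mu]_x g (x, y).
Proof.
move=> bg g0; have mgE : measurable_fun setT (EFin \o g) by apply/measurable_EFinP; exact: bg.1.
have bgx x : bmf (fun y => g (x, y)).
  by split; [exact: measurableT_comp bg.1 _|case: bg => _ [K gK]; exists K].
have bgy y : bmf (fun x => g (x, y)).
  by split; [exact: measurableT_comp bg.1 _|case: bg => _ [K gK]; exists K].
have := @fubini_tonelli _ _ X Y R mu nu (EFin \o g) mgE.
rewrite /fubini_F /fubini_G => H.
rewrite /Rintegral; congr fine.
have -> : (\int[mu]_x (fine (\int[nu]_y (g (x, y))%:E))%:E = \int[mu]_x \int[nu]_y (EFin \o g) (x, y))%E.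
  by apply: eq_integral => x _; rewrite -[RHS](EFin_Rint _ _ _ nu (fun y => g (x, y))).
rewrite H; last by move=> p; rewrite lee_fin.
by apply: eq_integral => y _; rewrite -[LHS](EFin_Rint _ _ _ mu (fun x => g (x, y))).
Qed.

Lemma Rint_bind (R : realType) dX (X : measurableType dX) dY (Y : measurableType dY)
    (mu : giry X R) (f : X -> giry Y R) (mf : measurable_fun setT f) (g : Y -> R) :
  bmf g -> (forall y, 0 <= g y) ->
  \int[giry_bind mu mf]_y g y = \int[mu]_x \int[f x]_y g y.
Proof.
move=> bg g0; rewrite /Rintegral; congr fine.
have := @giry_int_bind _ _ X Y R mu f mf (EFin \o g).
rewrite /giry_int => -> //.
- by apply: eq_integral => x _; rewrite -[LHS](EFin_Rint _ _ _ (f x) g).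
- by apply/measurable_EFinP; exact: bg.1.
Qed.

Lemma Rint_cst1 (R : realType) d (T : measurableType d) (mu : {finite_measure set T -> \bar R}) (a : R) :
  mu setT = 1%E -> \int[mu]_x a = a.
Proof.
move=> mu1; rewrite Rintegral_cst// -[RHS]mulr1; congr (_ * _).
by rewrite -[RHS]/(fine 1%E); congr fine; exact: mu1.
Qed.

Section affine_expectation.
Context (R : realType) d (T : measurableType d) (mu : {finite_measure set T -> \bar R}).
Hypothesis mu1 : mu setT = 1%E.

Lemma Rint_reg r (q : T -> R) : bmf q -> \int[mu]_x reg r (q x) = reg r (\int[mu]_x q x).
Proof.
move=> bq; rewrite RintD; [|exact: bmfZ|exact: bmf_cst].
by rewrite (RintZ _ _ _ mu (1 - r) q bq) (Rint_cst1 _ _ _ _ _ mu1).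
Qed.

Lemma Rint_kl_aff (N c d' : R) (q p : T -> R) : bmf q -> bmf p ->
  bmf (fun x => N * kl_aff c d' (q x) (p x)) /\
  \int[mu]_x (N * kl_aff c d' (q x) (p x)) = N * kl_aff c d' (\int[mu]_x q x) (\int[mu]_x p x).
Proof.
move=> bq bp.
have E x : N * kl_aff c d' (q x) (p x) =
   (N * (ln c - ln d')) * q x + ((N * (d' - c)) * p x + N * (ln d' - d' + 1)).
  by rewrite /kl_aff; ring.
have b1 := bmfZ _ _ _ (N * (ln c - ln d')) _ bq.
have b2 := bmfZ _ _ _ (N * (d' - c)) _ bp.
have b3 := bmf_cst _ T _ (N * (ln d' - d' + 1)).
have b23 := bmfD _ _ _ _ _ b2 b3.
split; first by under eq_fun do rewrite E; exact: bmfD.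
under eq_Rintegral do rewrite E.
rewrite RintD// RintD// (RintZ _ _ _ mu _ q bq) (RintZ _ _ _ mu _ p bp) (Rint_cst1 _ _ _ _ _ mu1).
by rewrite /kl_aff; ring.
Qed.

End affine_expectation.

Section meta_learning.
Context (R : realType) dZ (Z : measurableType dZ) dF (F : measurableType dF)
  dA (Alg : measurableType dA).
Variable loss : F -> Z -> R.
Hypotheses (mloss : measurable_fun [set: (F * Z)%type] (fun p => loss p.1 p.2))
  (loss01 : forall f z, 0 <= loss f z <= 1).
Variable algo : Alg -> seq Z -> giry F R.
Hypothesis malgo : forall m : nat, measurable_fun [set: (Alg * m.-tuple Z)%type]
       (fun p => algo p.1 (tval p.2)).
Variable mmax : nat.
Hypothesis mmax_gt0 : (0 < mmax)%N.
Context dT (Tsk : measurableType dT).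
Variables (tD : Tsk -> giry Z R) (tm : Tsk -> nat) (tS : nat -> Tsk -> Z).
Hypotheses (mtD : measurable_fun [set: Tsk] tD) (mtm : measurable_fun [set: Tsk] tm)
  (mtS : forall j, measurable_fun [set: Tsk] (tS j)).
Variable tau : probability Tsk R.

Definition post_loss A S z : R := \int[algo A S]_f loss f z.

Definition task_loss A t : R := \int[tD t]_z post_loss A (dataset tm tS t) z.

(* The cut-off at mmax only matters on a tau-null set; it makes the task risk
   bounded everywhere. *)
Definition task_weight (m : nat) : R := if (m <= mmax)%N then m%:R / mmax%:R else 0.

Definition task_risk A t : R := task_weight (tm t) * task_loss A t.

Lemma task_weight01 m : 0 <= task_weight m <= 1.
Proof.
rewrite /task_weight; case: leqP => mm; last by rewrite lexx ler01.
by rewrite divr_ge0//= ler_pdivrMr ?ltr0n// mul1r ler_nat.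
Qed.

Lemma bmf_loss : bmf (fun p : F * Z => loss p.1 p.2).
Proof. exact: bmf01. Qed.

Lemma mloss1 f : measurable_fun setT (loss f).
Proof. exact: (measurableT_comp mloss (measurable_pair1 f)). Qed.

Lemma mloss2 z : measurable_fun setT (loss ^~ z).
Proof. exact: (measurableT_comp mloss (measurable_pair2 z)). Qed.

Lemma post_loss01 A S z : 0 <= post_loss A S z <= 1.
Proof. by apply: Rint01 => //; exact: mloss2. Qed.

Lemma lossQE A S z : lossQ loss z (algo A S) = (post_loss A S z)%:E.
Proof. by rewrite /lossQ EFin_Rint//; apply: bmf01 => //; exact: mloss2. Qed.

(** Measurability of [algo] is given for each sample size separately; the preimage is cut along the
    countably many values of [tm]. *)
Lemma measurable_algo_dataset :
  measurable_fun setT (fun p : Alg * Tsk => algo p.1 (dataset tm tS p.2)).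
Proof.
pose h m (p : Alg * Tsk) : giry F R := algo p.1 (tval [tuple tS i p.2 | i < m]).
have mh m : measurable_fun setT (h m).
  apply: (measurableT_comp (malgo m) (g := fun p : Alg * Tsk => (p.1, [tuple tS i p.2 | i < m]))).
  apply: measurable_fun_pair; first exact: measurable_fst.
  apply/measurable_fun_tnthP => i; rewrite (_ : _ \o _ = tS i \o snd); last first.
    by apply/funext => p /=; rewrite tnth_mktuple.
  exact: measurableT_comp.
move=> _ E mE; rewrite setTI.
rewrite (_ : _ @^-1` _ = \bigcup_m ((snd @^-1` (tm @^-1` [set m])) `&` (h m @^-1` E))).
  apply: bigcup_measurable => m _; apply: measurableI; last by rewrite -[X in measurable X]setTI; exact: mh.
  have mm : measurable (tm @^-1` [set m]) by rewrite -[X in measurable X]setTI; exact: mtm.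
  by rewrite -[X in measurable X]setTI; exact: measurable_snd.
have dsE p : dataset tm tS p.2 = tval [tuple tS i p.2 | i < tm p.2].
  by rewrite /dataset /mkseq -val_enum_ord -map_comp.
apply/seteqP; split => p /=; rewrite dsE; first by move=> Ep; exists (tm p.2).
by move=> [m _ [<-]].
Qed.

Lemma bmf_post_loss : bmf (fun p : (Alg * Tsk) * Z => post_loss p.1.1 (dataset tm tS p.1.2) p.2).
Proof.
apply: (@bmf_kernel_Rint _ _ ((Alg * Tsk) * Z)%type F R
  (fun p => algo p.1.1 (dataset tm tS p.1.2)) (fun q => loss q.2 q.1.2)).
- exact: (measurableT_comp measurable_algo_dataset measurable_fst).
- apply: (@bmf_comp _ _ _ _ _ (fun p : F * Z => loss p.1 p.2) (fun q : ((Alg * Tsk) * Z) * F => (q.2, q.1.2))).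
    exact: bmf_loss.
  apply: measurable_fun_pair; first exact: measurable_snd.
  exact: (measurableT_comp measurable_snd measurable_fst).
- by move=> q; case/andP: (loss01 q.2 q.1.2).
Qed.

Lemma bmf_task_loss : bmf (fun p : Alg * Tsk => task_loss p.1 p.2).
Proof.
apply: (@bmf_kernel_Rint _ _ (Alg * Tsk)%type Z R (fun p => tD p.2)
  (fun q => post_loss q.1.1 (dataset tm tS q.1.2) q.2)).
- exact: (measurableT_comp mtD measurable_snd).
- exact: bmf_post_loss.
- by move=> q; case/andP: (post_loss01 q.1.1 (dataset tm tS q.1.2) q.2).
Qed.

Lemma post_loss_measurable A t : measurable_fun setT (post_loss A (dataset tm tS t)).
Proof. exact: (measurableT_comp bmf_post_loss.1 (measurable_pair1 (A, t))). Qed.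

Lemma task_loss01 A t : 0 <= task_loss A t <= 1.
Proof. by apply: Rint01 => [|z]; [exact: post_loss_measurable|exact: post_loss01]. Qed.

Lemma task_risk01 A t : 0 <= task_risk A t <= 1.
Proof.
have /andP[a b] := task_weight01 (tm t); have /andP[c d] := task_loss01 A t.
by rewrite mulr_ge0// mulr_ile1.
Qed.

Lemma bmf_task_risk : bmf (fun p : Alg * Tsk => task_risk p.1 p.2).
Proof.
apply: bmfM; last exact: bmf_task_loss.
apply: bmf01 => [|p]; last exact: task_weight01.
by apply: (measurableT_comp (g := fun p : Alg * Tsk => tm p.2) (f := task_weight)) => //;
  exact: (measurableT_comp mtm measurable_snd).
Qed.

Lemma bmf_task_riskA A : bmf (task_risk A).
Proof. by apply: bmf01 => [|t]; [exact: (measurableT_comp bmf_task_risk.1 (measurable_pair1 A))|exact: task_risk01]. Qed.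

Lemma bmf_mean_task_risk : bmf (fun A => \int[tau]_t task_risk A t).
Proof.
apply: (@bmf_kernel_Rint _ _ Alg Tsk R (fun=> tau : giry Tsk R) (fun q => task_risk q.1 q.2)).
- exact: measurable_cst.
- exact: bmf_task_risk.
- by move=> q; case/andP: (task_risk01 q.1 q.2).
Qed.

Hypothesis tau_ae : {ae tau, forall t, tD t [set: Z] = 1%E /\ (0 < tm t <= mmax)%N}.

Lemma meta_riskE (rho : probability Alg R) :
  meta_risk loss algo tau tD tm tS mmax rho = (\int[rho]_A \int[tau]_t task_risk A t)%:E.
Proof.
rewrite EFin_Rint; last exact: bmf_mean_task_risk.
apply: eq_integral => A _; rewrite EFin_Rint; last exact: bmf_task_riskA.
have bA : bmf (task_loss A).
  by apply: bmf01 => [|t]; [exact: (measurableT_comp bmf_task_loss.1 (measurable_pair1 A))|exact: task_loss01].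
have E t : (\int[tD t]_z (((tm t)%:R / mmax%:R)%:E * lossQ loss z (algo A (dataset tm tS t))))%E =
    ((tm t)%:R / mmax%:R * task_loss A t)%:E.
  have bp : bmf (post_loss A (dataset tm tS t)).
    by apply: bmf01 => [|z]; [exact: post_loss_measurable|exact: post_loss01].
  rewrite /task_loss -RintZ// EFin_Rint; last exact: bmfZ.
  by apply: eq_integral => z _; rewrite lossQE EFinM.
under eq_integral do rewrite E.
have m1 : measurable_fun setT (fun t => ((tm t)%:R / mmax%:R * task_loss A t)%:E).
  apply/measurable_EFinP; apply: measurable_funM; last exact: bA.1.
  have mn : measurable_fun [set: nat] (fun m : nat => m%:R / mmax%:R : R) by [].
  exact: (measurableT_comp mn mtm).
have m2 : measurable_fun setT (fun t => (task_risk A t)%:E).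
  by apply/measurable_EFinP; exact: (bmf_task_riskA A).1.
apply: ae_eq_integral => //; move: tau_ae; apply: filterS => t [_ /andP[_ tmax]] _.
by rewrite /task_risk /task_weight tmax.
Qed.

Variables (n : nat) (Ptr : probability (n.-tuple Tsk) R).
Hypothesis n_gt0 : (0 < n)%N.
Hypothesis Ptr_prod : forall E : 'I_n -> set Tsk, (forall i, measurable (E i)) ->
     Ptr (tbox E) = \big[*%E/1%E]_(i < n) tau (E i).
Variables (pi : probability Alg R) (delta : R).
Hypothesis delta_gt0 : 0 < delta.

Definition mean_task_risk (A : Alg) (tr : n.-tuple Tsk) : R :=
  n%:R^-1 * \sum_(i < n) task_risk A (tnth tr i).

Lemma bmf_mean_task_risk2 dX (X : measurableType dX) (f : X -> Alg) (g : X -> n.-tuple Tsk) :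
  measurable_fun setT f -> measurable_fun setT g ->
  bmf (fun x => mean_task_risk (f x) (g x)).
Proof.
move=> mf mg; apply: bmfZ; apply: bmf_sum => i.
apply: (@bmf_comp _ _ X _ R (fun p : Alg * Tsk => task_risk p.1 p.2) (fun x => (f x, tnth (g x) i))).
  exact: bmf_task_risk.
apply: measurable_fun_pair => //.
by apply: (measurableT_comp (f := fun t : n.-tuple Tsk => tnth t i) (g := g)) => //; exact: measurable_tnth.
Qed.

Lemma mean_task_risk01 A tr : 0 <= mean_task_risk A tr <= 1.
Proof.
have := mean01 [seq task_risk A (tnth tr i) | i <- enum 'I_n].
rewrite size_map size_enum_ord big_map big_enum; apply.
by apply/allP => _ /mapP[i _ ->]; exact: task_risk01.
Qed.

Lemma mean_tau_risk01 A : 0 <= \int[tau]_t task_risk A t <= 1.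
Proof. by apply: Rint01 => [|t]; [exact: (bmf_task_riskA A).1|exact: task_risk01]. Qed.

Lemma half_confidence : 1 - (2 / delta)^-1 = 1 - delta / 2.
Proof. by rewrite invf_div. Qed.

(** For a fixed [A], a task together with its dataset is a single observation, so [iid_kl_mgf]
    applies to [task_risk A] even though [algo A] is trained on that dataset. [G] can be chosen
    before [rho], [c] and [d] since the mixture involves only [pi]. *)
Lemma task_level_event : exists G : set (n.-tuple Tsk),
  [/\ measurable G, ((1 - delta / 2)%:E <= Ptr G)%E & forall tr, G tr ->
    forall (rho : probability Alg R) (c d : R), 0 < c -> 0 < d ->
    ((n%:R * kl_aff c d (\int[rho]_A mean_task_risk A tr) (\int[rho]_A \int[tau]_t task_risk A t))%:E
      <= KL rho pi + (ln (2 * Num.sqrt n%:R * (2 / delta)))%:E)%E].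
Proof.
have nR : 0 < n%:R :> R by rewrite ltr0n.
have s0 : 0 < 2 * Num.sqrt n%:R :> R by rewrite mulr_gt0 ?sqrtr_gt0.
pose phi k (tr : n.-tuple Tsk) A :=
  n%:R * klr (reg (shrink k) (mean_task_risk A tr)) (reg (shrink k) (\int[tau]_t task_risk A t)).
have bphi dX (X : measurableType dX) k (f : X -> Alg) (g : X -> n.-tuple Tsk) :
    measurable_fun setT f -> measurable_fun setT g -> bmf (fun x => phi k (g x) (f x)).
  move=> mf mg; apply: bmfZ; apply: (@bmf_klr_reg _ _ _ _ (fun x => mean_task_risk (f x) (g x))
    (fun x => \int[tau]_t task_risk (f x) t)); first exact: shrink01.
  - exact: bmf_mean_task_risk2.
  - exact: (bmf_comp _ _ _ _ _ _ _ bmf_mean_task_risk mf).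
  - by move=> x; exact: mean_task_risk01.
  - by move=> x; exact: mean_tau_risk01.
pose g k (p : n.-tuple Tsk * Alg) := (2 * Num.sqrt n%:R)^-1 * expR (phi k p.1 p.2).
have bg k : bmf (g k) by apply: bmfZ; apply: bmf_expR; apply: bphi; [exact: measurable_snd|exact: measurable_fst].
have gle k A : \int[Ptr]_tr g k (tr, A) <= 1.
  rewrite RintZ; last by apply: bmf_expR; apply: (bphi _ _ k (fun=> A) id) => //; exact: measurable_cst.
  rewrite ler_pdivrMl// mulr1.
  exact: (@iid_kl_mgf R _ Tsk tau n Ptr Ptr_prod (shrink k) (task_risk A) n_gt0 (shrink01 k) (bmf_task_riskA A).1 (task_risk01 A)).
have d0 : 0 < 2 / delta by rewrite divr_gt0.
have g0 k p : 0 <= g k p by rewrite mulr_ge0 ?invr_ge0 ?expR_ge0// ltW.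
have MK k := markov_mixture R _ _ Ptr _ Alg pi (g k) (2 / delta) d0 (bg k) (g0 k) (gle k).
have [mG PG] := infinitely_often_prob R _ _ Ptr (fun k => [set tr | \int[pi]_A g k (tr, A) <= 2 / delta]) (delta / 2)
  (fun k => (MK k).1) ltac:(by move=> k; rewrite -half_confidence; exact: (MK k).2).
eexists; split; [exact: mG|exact: PG|move=> tr Gtr rho c d' c0 d'0].
apply: kl_aff_limit => K; have [k Kk Ek] := Gtr K; exists k => //.
have bq : bmf (fun A => mean_task_risk A tr).
  by apply: (bmf_mean_task_risk2 _ _ id (fun=> tr)) => //; exact: measurable_cst.
have bp : bmf (fun A => \int[tau]_t task_risk A t) := bmf_mean_task_risk.
have rho1 : (rho : {finite_measure set Alg -> \bar R}) setT = 1%E by exact: probability_setT.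
have bphik : bmf (phi k tr) by apply: (bphi _ _ k id (fun=> tr)) => //; exact: measurable_cst.
have [bl lE] := Rint_kl_aff R _ _ _ rho1 n%:R c d' _ _ (bmf_reg _ _ (shrink k) _ bq) (bmf_reg _ _ (shrink k) _ bp).
rewrite !(Rint_reg _ _ _ _ rho1)// in lE; rewrite -lE.
apply: le_trans (donsker_varadhan _ _ _ rho pi _ bl) _; apply: leeD2l; rewrite lee_fin.
rewrite ler_ln ?posrE ?(mulr_gt0 s0 d0) ?Rint_expR_gt0//.
apply: (@le_trans _ _ (\int[pi]_A expR (phi k tr A))).
  apply: Rint_le; [exact: bmf_expR|exact: bmf_expR|move=> A; rewrite ler_expR ler_pM2l//].
  apply: kl_aff_le_klr => //; apply: reg_gt0; rewrite ?shrink01 ?mean_task_risk01//; exact: mean_tau_risk01.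
move: Ek; rewrite /= /g RintZ; last exact: bmf_expR.
by rewrite ler_pdivrMl// mulrC.
Qed.

Hypothesis tau_iid : forall (B : set (giry Z R * nat)%type) (K : nat)
       (C : 'I_K -> set Z), measurable B -> (forall j, measurable (C j)) ->
     tau ([set t | B (tD t, tm t)] `&` [set t | forall j : 'I_K, C j (tS j t)])
     = (\int[tau]_(t in [set t | B (tD t, tm t)])
          \big[*%E/1%E]_(j < K) tD t (C j))%E.
Variable fP : Alg -> probability (giry F R * n.-tuple F)%type R.
Hypothesis mfP : measurable_fun setT (fun A => fP A : giry (giry F R * n.-tuple F)%type R).

Local Notation W := (giry F R * n.-tuple F)%type.

Definition drawn_loss (w : W) (i : 'I_n) (z : Z) : R := loss (tnth w.2 i) z.

Definition posterior_loss A (tr : n.-tuple Tsk) (i : 'I_n) (z : Z) : R :=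
  post_loss A (dataset tm tS (tnth tr i)) z.

Lemma measurable_drawn_loss dX (X : measurableType dX) (f : X -> W) i :
  measurable_fun setT f -> measurable_fun setT (fun p : X * Z => drawn_loss (f p.1) i p.2).
Proof.
move=> mf; apply: (measurableT_comp (f := fun p : F * Z => loss p.1 p.2)
  (g := fun p : X * Z => (tnth (f p.1).2 i, p.2))) => //.
apply: measurable_fun_pair; last exact: measurable_snd.
apply: (measurableT_comp (f := fun t : n.-tuple F => tnth t i) (g := fun p : X * Z => (f p.1).2)).
  exact: measurable_tnth.
apply: (measurableT_comp (f := snd) (g := fun p : X * Z => f p.1)); first exact: measurable_snd.
exact: (measurableT_comp mf measurable_fst).
Qed.

Lemma posterior_sample_mean (tr : n.-tuple Tsk) A (m : 'I_n -> nat) (mu : probability W R) :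
  (forall i (f : F -> R), measurable_fun setT f -> (forall x, 0 <= f x) ->
     \int[mu]_w f (tnth w.2 i) = \int[algo A (dataset tm tS (tnth tr i))]_x f x) ->
  \int[mu]_w sample_mean tS mmax m (drawn_loss w) tr = sample_mean tS mmax m (posterior_loss A tr) tr.
Proof.
move=> H.
have bl i z : bmf (fun w : W => drawn_loss w i z).
  apply: bmf01 => [|w]; last exact: loss01.
  apply: (measurableT_comp (g := fun w : W => (w, z)) (measurable_drawn_loss _ _ id i (@measurable_id _ _ _))).
  exact: measurable_pair2.
rewrite RintZ; last by apply: bmf_sum => i; apply: bmf_sum.
rewrite Rint_sum; last by move=> i; apply: bmf_sum.
congr (_ * _); apply: eq_bigr => i _; rewrite Rint_sum//; apply: eq_bigr => j _.
by apply: (H i (loss ^~ (tS j (tnth tr i)))) => [|x]; [exact: mloss2|case/andP: (loss01 x (tS j (tnth tr i)))].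
Qed.

Lemma posterior_true_mean (tr : n.-tuple Tsk) A (m : 'I_n -> nat) (mu : probability W R) :
  (forall i (f : F -> R), measurable_fun setT f -> (forall x, 0 <= f x) ->
     \int[mu]_w f (tnth w.2 i) = \int[algo A (dataset tm tS (tnth tr i))]_x f x) ->
  \int[mu]_w true_mean tD m (drawn_loss w) tr = true_mean tD m (posterior_loss A tr) tr.
Proof.
move=> H.
have bl i : bmf (fun w : W => \int[tD (tnth tr i)]_z drawn_loss w i z).
  apply: (@bmf_kernel_Rint _ _ W Z R (fun=> tD (tnth tr i)) (fun p => drawn_loss p.1 i p.2)).
  - exact: measurable_cst.
  - by apply: bmf01 => [|p]; [exact: (measurable_drawn_loss _ _ id i (@measurable_id _ _ _))|exact: loss01].
  - by move=> p; case/andP: (loss01 (tnth p.1.2 i) p.2).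
rewrite RintZ; last by apply: bmf_sum => i; exact: bmfZ.
rewrite Rint_sum; last by move=> i; exact: bmfZ.
congr (_ * _); apply: eq_bigr => i _; rewrite RintZ//; congr (_ * _).
have bi : bmf (fun f : F => \int[tD (tnth tr i)]_z loss f z).
  apply: (@bmf_kernel_Rint _ _ F Z R (fun=> tD (tnth tr i)) (fun p => loss p.1 p.2)).
  - exact: measurable_cst.
  - exact: bmf_loss.
  - by move=> p; case/andP: (loss01 p.1 p.2).
rewrite [LHS](H i (fun f => \int[tD (tnth tr i)]_z loss f z) bi.1); last first.
  by move=> x; apply: Rintegral_ge0 => z _; case/andP: (loss01 x z).
rewrite (Rint_swap _ _ _ _ _ _ (tD (tnth tr i)) (fun p => loss p.1 p.2))//; first exact: bmf_loss.
by move=> p; case/andP: (loss01 p.1 p.2).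
Qed.

(** For hypotheses fixed in advance [sample_kl_mgf] applies. The posteriors enter only after the
    change of measure, and only through one-coordinate marginals, because the sample and true means
    are sums of terms each involving a single hypothesis. *)
Lemma sample_level_event : exists G : set (n.-tuple Tsk),
  [/\ measurable G, ((1 - delta / 2)%:E <= Ptr G)%E & forall tr, G tr -> good_tasks tD tm n mmax tr ->
    forall (rho : probability Alg R) (fQ : Alg -> probability W R),
    (forall A i (f : F -> R), measurable_fun setT f -> (forall x, 0 <= f x) ->
       \int[fQ A]_w f (tnth w.2 i) = \int[algo A (dataset tm tS (tnth tr i))]_x f x) ->
    forall c d : R, 0 < c -> 0 < d ->
    (((sample_size (sizes tm tr))%:R *
       kl_aff c d (\int[rho]_A sample_mean tS mmax (sizes tm tr) (posterior_loss A tr) tr)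
                  (\int[rho]_A true_mean tD (sizes tm tr) (posterior_loss A tr) tr))%:E
      <= KL rho pi + \int[rho]_A KL (fQ A) (fP A) +
         (ln (2 * Num.sqrt (sample_size (sizes tm tr))%:R * (2 / delta)))%:E)%E].
Proof.
have d0 : 0 < 2 / delta by rewrite divr_gt0.
pose g k (p : n.-tuple Tsk * W) := \1_(good_tasks tD tm n mmax) p.1 *
  kl_weight tD tS mmax (shrink k) (sizes tm p.1) (drawn_loss p.2) p.1.
have mid : measurable_fun setT (@id W) by exact: measurable_id.
have bg k : bmf (g k).
  apply: (@bmf_good_kl_weight _ _ Z _ Tsk tD tm tS mtD mtm mtS n mmax _ (n.-tuple Tsk * W)%type fst
    (fun i q => drawn_loss q.1.2 i q.2) _ (shrink01 k)).
  - exact: measurable_fst.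
  - by move=> i; apply: (measurable_drawn_loss _ _ snd); exact: measurable_snd.
  - by move=> i q; exact: loss01.
have kw0 (r : R) m (u : 'I_n -> Z -> R) (tr : n.-tuple Tsk) : 0 <= kl_weight tD tS mmax r m u tr.
  by rewrite /kl_weight divr_ge0 ?expR_ge0// mulr_ge0 ?sqrtr_ge0.
have g0 k p : 0 <= g k p by rewrite mulr_ge0// indicE.
have gle k w : \int[Ptr]_tr g k (tr, w) <= 1.
  apply: (@sample_kl_mgf R _ Z _ Tsk tD tm tS mtD mtm mtS tau tau_iid n mmax n_gt0 Ptr Ptr_prod
    (drawn_loss w) (shrink k) (shrink01 k)) => [i z|i]; first exact: loss01.
  exact: mloss1.
(* The weight depends on [w] but not on the algorithm, so Markov's inequality uses the [pi]-mixture
   of the [fP A]; [Rint_bind] later recovers the nested integral. *)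
pose Pbar : giry W R := giry_bind (pi : giry Alg R) mfP.
have MK k := markov_mixture R _ _ Ptr _ W Pbar (g k) (2 / delta) d0 (bg k) (g0 k) (gle k).
have [mG PG] := infinitely_often_prob R _ _ Ptr (fun k => [set tr | \int[Pbar]_w g k (tr, w) <= 2 / delta]) (delta / 2)
  (fun k => (MK k).1) ltac:(by move=> k; rewrite -half_confidence; exact: (MK k).2).
eexists; split; [exact: mG|exact: PG|move=> tr Gtr gt rho fQ HfQ c d' c0 d'0].
apply: kl_aff_limit => K; have [k Kk Ek] := Gtr K; exists k => //.
set m := sizes tm tr; set M := sample_size m.
have mpos i : (0 < m i <= mmax)%N by exact: (gt i).2.
have mle i : (m i <= mmax)%N by case/andP: (mpos i).
have M0 : (0 < M)%N.
  by rewrite /M /sample_size (bigD1 (Ordinal n_gt0))//= addn_gt0; case/andP: (mpos (Ordinal n_gt0)) => ->.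
have MR : 0 < M%:R :> R by rewrite ltr0n.
have s0 : 0 < 2 * Num.sqrt M%:R :> R by rewrite mulr_gt0 ?sqrtr_gt0.
pose qW w := sample_mean tS mmax m (drawn_loss w) tr.
pose pW w := true_mean tD m (drawn_loss w) tr.
pose qA A := sample_mean tS mmax m (posterior_loss A tr) tr.
pose pA A := true_mean tD m (posterior_loss A tr) tr.
have mdl i : measurable_fun setT (fun p : W * Z => drawn_loss p.1 i p.2) by exact: (measurable_drawn_loss _ _ id i mid).
have mdw w i : measurable_fun setT (drawn_loss w i) by exact: mloss1.
have mpl A i : measurable_fun setT (posterior_loss A tr i) by exact: post_loss_measurable.
have qW01 w : 0 <= qW w <= 1 by apply: sample_mean01 => // i z; exact: loss01.
have pW01 w : 0 <= pW w <= 1 by apply: true_mean01 => // i z; exact: loss01.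
have bqW : bmf qW.
  apply: bmfZ; apply: bmf_sum => i; apply: bmf_sum => j.
  apply: bmf01 => [|w]; last exact: loss01.
  by apply: (measurableT_comp (g := fun w : W => (w, _)) (mdl i)); exact: measurable_pair2.
have bpW : bmf pW.
  apply: bmfZ; apply: bmf_sum => i; apply: bmfZ.
  apply: (@bmf_kernel_Rint _ _ W Z R (fun=> tD (tnth tr i)) (fun p => drawn_loss p.1 i p.2)).
  - exact: measurable_cst.
  - by apply: bmf01 => [|p]; [exact: mdl|exact: loss01].
  - by move=> p; case/andP: (loss01 (tnth p.1.2 i) p.2).
have bpl i : bmf (fun p : Alg * Z => posterior_loss p.1 tr i p.2).
  apply: (@bmf_comp _ _ _ _ _ (fun p : (Alg * Tsk) * Z => post_loss p.1.1 (dataset tm tS p.1.2) p.2)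
    (fun p : Alg * Z => ((p.1, tnth tr i), p.2))).
    exact: bmf_post_loss.
  apply: measurable_fun_pair; last exact: measurable_snd.
  by apply: measurable_fun_pair; [exact: measurable_fst|exact: measurable_cst].
have bqA : bmf qA.
  apply: bmfZ; apply: bmf_sum => i; apply: bmf_sum => j.
  by apply: (@bmf_comp _ _ _ _ _ (fun p : Alg * Z => posterior_loss p.1 tr i p.2) (fun A => (A, _))) => //; exact: measurable_pair2.
have bpA : bmf pA.
  apply: bmfZ; apply: bmf_sum => i; apply: bmfZ.
  apply: (@bmf_kernel_Rint _ _ Alg Z R (fun=> tD (tnth tr i)) (fun p => posterior_loss p.1 tr i p.2)) => //.
  by move=> p; case/andP: (post_loss01 p.1 (dataset tm tS (tnth tr i)) p.2).
have rho1 : (rho : {finite_measure set Alg -> \bar R}) setT = 1%E by exact: probability_setT.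
have fQ1 A : (fQ A : {finite_measure set W -> \bar R}) setT = 1%E by exact: probability_setT.
pose phi w := M%:R * klr (reg (shrink k) (qW w)) (reg (shrink k) (pW w)).
have bphi : bmf phi by apply: bmfZ; apply: bmf_klr_reg => //; exact: shrink01.
(* Only boundedness of the integrand is extracted, so the posterior at an arbitrary [point] serves
   as the measure. *)
have [bpsi _] := Rint_kl_aff R _ _ _ (fQ1 point) M%:R c d' _ _ (bmf_reg _ _ (shrink k) _ bqW) (bmf_reg _ _ (shrink k) _ bpW).
have [bl lE] := Rint_kl_aff R _ _ _ rho1 M%:R c d' _ _ (bmf_reg _ _ (shrink k) _ bqA) (bmf_reg _ _ (shrink k) _ bpA).
rewrite !(Rint_reg _ _ _ _ rho1)// in lE; rewrite -lE.
apply: (pac_bayes_two_level R _ Alg _ W rho pi fP fQ mfP phi _ _ _ bphi bpsi bl).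
- move=> w; rewrite ler_pM2l//; apply: kl_aff_le_klr => //; apply: reg_gt0 => //; exact: shrink01.
- move=> A.
  have [_ ->] := Rint_kl_aff R _ _ _ (fQ1 A) M%:R c d' _ _ (bmf_reg _ _ (shrink k) _ bqW) (bmf_reg _ _ (shrink k) _ bpW).
  rewrite !(Rint_reg _ _ _ _ (fQ1 A))//.
  by rewrite (posterior_sample_mean _ A _ _ (HfQ A)) (posterior_true_mean _ A _ _ (HfQ A)).
move: Ek; rewrite /= /Pbar Rint_bind; last 2 first.
- by apply: (@bmf_comp _ _ _ _ _ (g k) (fun w => (tr, w))) => //; exact: measurable_pair1.
- by move=> w; exact: g0.
have gE w : g k (tr, w) = (2 * Num.sqrt M%:R)^-1 * expR (phi w).
  by rewrite /g indicE mem_set// mul1r /kl_weight mulrC.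
have bI : bmf (fun A => \int[fP A]_w expR (phi w)).
  apply: (@bmf_kernel_Rint _ _ Alg W R fP (fun p => expR (phi p.2))).
  - exact: mfP.
  - apply: (@bmf_comp _ _ _ _ _ (fun w => expR (phi w)) snd); [exact: bmf_expR|exact: measurable_snd].
  - by move=> p; exact: expR_ge0.
have -> : \int[pi]_A \int[fP A]_w g k (tr, w) = (2 * Num.sqrt M%:R)^-1 * \int[pi]_A \int[fP A]_w expR (phi w).
  rewrite -RintZ//; apply: eq_Rintegral => A _; rewrite -RintZ; last exact: bmf_expR.
  by apply: eq_Rintegral => w _; exact: gE.
by rewrite ler_pdivrMl// mulrC.
Qed.

End meta_learning.

(** * Combination of the two events *)

Lemma probability_setI_ge (R : realType) d (T : measurableType d) (P : probability T R) (A B : set T) (a b : R) :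
  measurable A -> measurable B -> ((1 - a)%:E <= P A)%E -> ((1 - b)%:E <= P B)%E ->
  ((1 - (a + b))%:E <= P (A `&` B))%E.
Proof.
move=> mA mB; have mI := measurableI _ _ mA mB; have mC := measurableC mB.
have : (P A <= P (A `&` B) + P (~` B))%E.
  apply: le_trans (measureU2 _ mI mC); apply: le_measure; rewrite ?inE//.
    exact: measurableU.
  by move=> x Ax; have [Bx|Bx] := pselect (B x); [left|right].
rewrite probability_setC// -[P A]fineK ?fin_num_measure// -[P B]fineK ?fin_num_measure//.
rewrite -[P (A `&` B)]fineK ?fin_num_measure// -EFinB -EFinD !lee_fin; lra.
Qed.

Lemma klinv_le1 (R : realType) N (q : R) b : klinv N q b <= 1.
Proof.
rewrite /klinv; set S := [set p | _]; have [[x Sx]|S0] := pselect (S !=set0).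
  by apply: ge_sup; [exists x|move=> y [/andP[]]].
(* The supremum of the empty set is 0. *)
by rewrite (_ : S = set0) ?sup0//; apply/seteqP; split => // x Sx; apply: S0; exists x.
Qed.

Lemma good_tasks_prob (R : realType) dZ (Z : measurableType dZ) dT (Tsk : measurableType dT)
    (tD : Tsk -> giry Z R) (tm : Tsk -> nat) (tau : probability Tsk R)
    (n mmax : nat) (Ptr : probability (n.-tuple Tsk) R) :
  measurable_fun setT tD -> measurable_fun setT tm ->
  {ae tau, forall t, tD t [set: Z] = 1%E /\ (0 < tm t <= mmax)%N} ->
  (forall E : 'I_n -> set Tsk, (forall i, measurable (E i)) ->
     Ptr (tbox E) = \big[*%E/1%E]_(i < n) tau (E i)) ->
  Ptr (good_tasks tD tm n mmax) = 1%E.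
Proof.
move=> mtD mtm ae Ptr_prod.
pose B := [set t | tD t [set: Z] = 1%E /\ (0 < tm t <= mmax)%N].
have mB : measurable B.
  apply: measurableI; first exact: measurable_prob_task.
  by have := mtm measurableT [set m | (0 < m <= mmax)%N] I; rewrite setTI.
have tB : tau B = 1%E.
  have : tau (~` B) = 0%E by apply/negligibleP; [exact: measurableC|exact: ae].
  rewrite probability_setC// -[tau B]fineK ?fin_num_measure// -EFinB => -[].
  by move=> /eqP; rewrite subr_eq0 => /eqP <-.
rewrite -[LHS]/(Ptr (tbox (fun=> B))) Ptr_prod//.
by rewrite big1.
Qed.

Lemma sum_dataset (R : realType) dT (Tsk : measurableType dT) dZ (Z : measurableType dZ)
    (tm : Tsk -> nat) (tS : nat -> Tsk -> Z) (mmax : nat) (f : Z -> \bar R) (t : Tsk) :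
  (tm t <= mmax)%N ->
  (\sum_(z <- dataset tm tS t) f z = \sum_(j < mmax | (j < tm t)%N) f (tS j t))%E.
Proof.
move=> tle; rewrite /dataset /mkseq big_map.
rewrite (_ : iota 0 (tm t) = index_iota 0 (tm t)); last by rewrite /index_iota subn0.
by rewrite big_mkord (big_ord_widen _ (fun j => f (tS j t)) tle).
Qed.

Theorem theorem6
  (R : realType)
  (* data space Z, hypothesis space F, set of algorithms Alg *)
  (dZ : measure_display) (Z : measurableType dZ)
  (dF : measure_display) (F : measurableType dF)
  (dA : measure_display) (Alg : measurableType dA)
  (* loss l : F x Z -> [0,1] *)
  (loss : F -> Z -> R)
  (mloss : measurable_fun [set: (F * Z)%type] (fun p => loss p.1 p.2))
  (loss01 : forall f z, 0 <= loss f z <= 1)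
  (* algorithms: A maps a dataset S to a posterior A(S) in M(F) *)
  (algo : Alg -> seq Z -> giry F R)
  (algo1 : forall A S, algo A S [set: F] = 1%E)
  (malgo : forall m : nat,
     measurable_fun [set: (Alg * m.-tuple Z)%type]
       (fun p => algo p.1 (tval p.2)))
  (* environment tau over tasks (D, m, S) *)
  (mmax : nat) (mmax_gt0 : (0 < mmax)%N)
  (dT : measure_display) (Tsk : measurableType dT)
  (tD : Tsk -> giry Z R) (tm : Tsk -> nat) (tS : nat -> Tsk -> Z)
  (mtD : measurable_fun [set: Tsk] tD)
  (mtm : measurable_fun [set: Tsk] tm)
  (mtS : forall j, measurable_fun [set: Tsk] (tS j))
  (tau : probability Tsk R)
  (tau_ae : {ae tau, forall t, tD t [set: Z] = 1%E /\ (0 < tm t <= mmax)%N})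
  (tau_iid : forall (B : set (giry Z R * nat)%type) (K : nat)
       (C : 'I_K -> set Z), measurable B -> (forall j, measurable (C j)) ->
     tau ([set t | B (tD t, tm t)] `&` [set t | forall j : 'I_K, C j (tS j t)])
     = (\int[tau]_(t in [set t | B (tD t, tm t)])
          \big[*%E/1%E]_(j < K) tD t (C j))%E)
  (* n training tasks, i.i.d. from tau *)
  (n : nat) (n_gt0 : (0 < n)%N)
  (Ptr : probability (n.-tuple Tsk) R)
  (Ptr_prod : forall E : 'I_n -> set Tsk, (forall i, measurable (E i)) ->
     Ptr (tbox E) = \big[*%E/1%E]_(i < n) tau (E i))
  (* fixed meta-prior pi *)
  (pi : probability Alg R)
  (* fixed hyper-priors P(A), and the induced frak P(A):
     P ~ P(A), then f_1, ..., f_n i.i.d. ~ P *)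
  (HP : Alg -> giry (giry F R) R)
  (mHP : measurable_fun [set: Alg] HP)
  (HP1 : forall A, HP A [set: giry F R] = 1%E)
  (HPprob : forall A, HP A [set P : giry F R | P [set: F] = 1%E] = 1%E)
  (fP : Alg -> probability (giry F R * n.-tuple F)%type R)
  (fP_def : forall A (B : set (giry F R)) (C : 'I_n -> set F),
     measurable B -> (forall i, measurable (C i)) ->
     fP A (B `*` tbox C)
     = (\int[HP A]_(P in B) \big[*%E/1%E]_(i < n) P (C i))%E)
  (delta : R) (delta_gt0 : 0 < delta) :
  exists E : set (n.-tuple Tsk),
    [/\ measurable E, (Ptr E >= (1 - delta)%:E)%E &
    forall tr, E tr ->
    let S := fun i : 'I_n => dataset tm tS (tnth tr i) in
    let M := Mtot tm tr in
    forall (rho : probability Alg R)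
      (HQ : Alg -> giry (giry F R) R),
      measurable_fun [set: Alg] HQ ->
      (forall A, HQ A [set: giry F R] = 1%E) ->
      (forall A, HQ A [set P : giry F R | P [set: F] = 1%E] = 1%E) ->
    forall (fQ : Alg -> probability (giry F R * n.-tuple F)%type R),
      (forall A (B : set (giry F R)) (C : 'I_n -> set F),
         measurable B -> (forall i, measurable (C i)) ->
         fQ A (B `*` tbox C)
         = (HQ A B * \big[*%E/1%E]_(i < n) algo A (S i) (C i))%E) ->
    let Crho := (KL rho pi + \int[rho]_A KL (fQ A) (fP A)
                 + (ln (2 / delta))%:E)%E in
    let c2 := ln (2 * Num.sqrt (M%:R)) in
    (meta_risk loss algo tau tD tm tS mmax rho
     <= (klinv n
          (M%:R / (n%:R * mmax%:R)
             * klinv M (fine (emp_risk loss algo tm tS tr rho))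
                 (Crho + c2%:E)%E)
          (KL rho pi + (ln (4 * Num.sqrt (n%:R) / delta))%:E)%E)%:E)%E].
Proof.
(* For [delta >= 1] the empty event is enough; otherwise the logarithms are non-negative, and so are
   both right-hand sides, as [le_klinv] requires. *)
have [d1|d1] := leP 1 delta.
  exists set0; split; [exact: measurable0| |by []].
  by rewrite measure0 lee_fin subr_le0.
have mfP := measurable_box_kernel _ _ _ _ _ _ _ _ fP
  (measurable_iid_kernel _ _ _ _ _ _ HP fP mHP fP_def).
have [G1 [mG1 PG1 HG1]] := sample_level_event _ _ _ _ _ _ _ loss mloss loss01 algo malgo mmax
  _ _ tD tm tS mtD mtm mtS tau n Ptr n_gt0 Ptr_prod pi delta delta_gt0 tau_iid fP mfP.
have [G2 [mG2 PG2 HG2]] := task_level_event _ _ _ _ _ _ _ loss mloss loss01 algo malgo mmax mmax_gt0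
  _ _ tD tm tS mtD mtm mtS tau n Ptr n_gt0 Ptr_prod pi delta delta_gt0.
have Pgood := good_tasks_prob _ _ _ _ _ tD tm tau n mmax Ptr mtD mtm tau_ae Ptr_prod.
have mgood := measurable_good_tasks _ _ Z _ _ tD tm mtD mtm n mmax.
exists (good_tasks tD tm n mmax `&` (G1 `&` G2)); split.
- by apply: measurableI => //; exact: measurableI.
- have P12 := probability_setI_ge _ _ _ _ _ _ _ _ mG1 mG2 PG1 PG2.
  have := probability_setI_ge _ _ _ _ _ _ 0 _ mgood (measurableI _ _ mG1 mG2) _ P12.
  rewrite add0r -splitr; apply; by rewrite subr0 Pgood.
move=> tr [gt [G1tr G2tr]] S M rho HQ _ HQ1 _ fQ fQE; cbv zeta.
pose m := sizes tm tr.
have mpos i : (0 < m i <= mmax)%N by exact: (gt i).2.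
have mle i : (m i <= mmax)%N by case/andP: (mpos i).
have M0 : (0 < M)%N.
  by rewrite /M /Mtot (bigD1 (Ordinal n_gt0))//= addn_gt0; case/andP: (mpos (Ordinal n_gt0)) => ->.
have MR : 0 < M%:R :> R by rewrite ltr0n.
have nR : 0 < n%:R :> R by rewrite ltr0n.
have xR : 0 < mmax%:R :> R by rewrite ltr0n.
have Mle : M%:R <= n%:R * mmax%:R :> R.
  rewrite -natrM ler_nat /M /Mtot -[X in (_ <= X * _)%N]card_ord -sum_nat_const.
  by apply: leq_sum => i _; exact: mle.
(* In a box that constrains one coordinate, all other factors have mass one by [HQ1] and [algo1]. *)
have marg A i (f : F -> R) : measurable_fun setT f -> (forall x, 0 <= f x) ->
    \int[fQ A]_w f (tnth w.2 i) = \int[algo A (dataset tm tS (tnth tr i))]_x f x.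
  apply: Rint_marginal => D mD.
  rewrite fQE//; last by move=> j; case: ifP.
  rewrite HQ1 mul1e (bigD1 i)//= eqxx big1 ?mule1// => j ji.
  by rewrite (negbTE ji) algo1.
pose qA A := sample_mean tS mmax m (posterior_loss _ _ _ _ _ _ _ loss algo _ _ tm tS n A tr) tr.
pose pA A := true_mean tD m (posterior_loss _ _ _ _ _ _ _ loss algo _ _ tm tS n A tr) tr.
have bpl i : bmf (fun x : Alg * Z => posterior_loss _ _ _ _ _ _ _ loss algo _ _ tm tS n x.1 tr i x.2).
  apply: (@bmf_comp _ _ _ _ _ (fun x : (Alg * Tsk) * Z => post_loss _ _ _ _ _ _ _ loss algo x.1.1 (dataset tm tS x.1.2) x.2)
    (fun x : Alg * Z => ((x.1, tnth tr i), x.2))).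
    exact: bmf_post_loss.
  apply: measurable_fun_pair; last exact: measurable_snd.
  by apply: measurable_fun_pair; [exact: measurable_fst|exact: measurable_cst].
have pl01 A i z : 0 <= posterior_loss _ _ _ _ _ _ _ loss algo _ _ tm tS n A tr i z <= 1 by exact: post_loss01.
have mpl A i : measurable_fun setT (posterior_loss _ _ _ _ _ _ _ loss algo _ _ tm tS n A tr i).
  exact: (measurableT_comp (bpl i).1 (measurable_pair1 A)).
have bqA : bmf qA.
  apply: bmfZ; apply: bmf_sum => i; apply: bmf_sum => j.
  apply: (@bmf_comp _ _ _ _ _ _ (fun A => (A, tS j (tnth tr i))) (bpl i)); exact: measurable_pair2.
have qA01 A : 0 <= qA A <= 1 by exact: sample_mean01.
have pA01 A : 0 <= pA A <= 1 by exact: true_mean01.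
(* The two levels meet here: the weight [m_i / (n mmax)] of a task loss is [M / (n mmax)] times its
   weight [m_i / M] in the true mean. *)
have pE A : mean_task_risk _ _ _ _ _ _ _ loss algo mmax _ _ tD tm tS n A tr =
    M%:R / (n%:R * mmax%:R) * pA A.
  rewrite /mean_task_risk /pA /true_mean -[sample_size m]/M mulrA.
  rewrite [M%:R / _ / _](_ : _ = n%:R^-1 * mmax%:R^-1); last by field; rewrite !gt_eqF.
  rewrite -mulrA; congr (_ * _); rewrite mulr_sumr; apply: eq_bigr => i _.
  by rewrite /task_risk /task_weight mle /m /sizes /task_loss /posterior_loss; ring.
have bmean : bmf (fun A => mean_task_risk _ _ _ _ _ _ _ loss algo mmax _ _ tD tm tS n A tr).
  by apply: (bmf_mean_task_risk2 _ _ _ _ _ _ _ loss mloss loss01 algo malgo mmax mmax_gt0 _ _ tD tm tS mtD mtm mtS n _ Alg id (fun=> tr)) => //; exact: measurable_cst.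
have bpA : bmf pA.
  have -> : pA = fun A => (n%:R * mmax%:R / M%:R) * mean_task_risk _ _ _ _ _ _ _ loss algo mmax _ _ tD tm tS n A tr.
    by apply/funext => A; rewrite pE; field; rewrite !gt_eqF.
  exact: bmfZ.
set q := \int[rho]_A qA A; set p := \int[rho]_A pA A.
have q01 : 0 <= q <= 1 by apply: Rint01 => //; exact: bqA.1.
have p01 : 0 <= p <= 1 by apply: Rint01 => //; exact: bpA.1.
have /andP[q0 q1] := q01.
have empE : fine (emp_risk loss algo tm tS tr rho) = q.
  rewrite /q /Rintegral; congr fine; apply: eq_integral => A _.
  rewrite /qA /sample_mean EFinM; congr (_ * _)%E; rewrite -sumEFin; apply: eq_bigr => i _.
  rewrite (sum_dataset _ _ _ _ _ _ _ _ _ _ (mle i)) -sumEFin; apply: eq_bigr => j _.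
  by rewrite lossQE.
set r := \int[rho]_A \int[tau]_t task_risk _ _ _ _ _ _ _ loss algo mmax _ _ tD tm tS A t.
have r01 : 0 <= r <= 1.
  apply: Rint01 => [|A]; last exact: mean_tau_risk01.
  exact: (bmf_mean_task_risk _ _ _ _ _ _ _ loss mloss loss01 algo malgo mmax mmax_gt0 _ _ tD tm tS mtD mtm mtS tau).1.
rewrite (meta_riskE _ _ _ _ _ _ _ loss mloss loss01 algo malgo mmax mmax_gt0 _ _ tD tm tS mtD mtm mtS tau tau_ae) -/r.
rewrite lee_fin empE.
have s1 (k : nat) : (0 < k)%N -> 1 <= Num.sqrt k%:R :> R.
  by move=> k0; rewrite -[leLHS]sqrtr1 ler_sqrt ?ltr0n// ler1n.
have ln2 : 0 <= ln (2 / delta) by rewrite ln_ge0// ler_pdivlMr// mul1r (le_trans (ltW d1))// ler1n.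
have lM : (0 : R) <= ln (2 * Num.sqrt M%:R).
  by apply: ln_ge0; apply: le_trans (s1 _ M0) _; rewrite ler_peMl ?sqrtr_ge0 ?ler1n.
have K0 : (0 <= KL rho pi)%E by exact: KL_ge0.
have I0 : (0 <= \int[rho]_A KL (fQ A) (fP A))%E by apply: integral_ge0 => A _; exact: KL_ge0.
have sM : 0 < 2 * Num.sqrt M%:R :> R by rewrite mulr_gt0// (lt_le_trans ltr01)// s1.
have sn : 0 < 2 * Num.sqrt n%:R :> R by rewrite mulr_gt0// (lt_le_trans ltr01)// s1.
have d0 : 0 < 2 / delta by rewrite divr_gt0.
have B0 : (0 <= KL rho pi + \int[rho]_A KL (fQ A) (fP A) + (ln (2 / delta))%:E + (ln (2 * Num.sqrt M%:R))%:E)%E.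
  apply: adde_ge0; last by rewrite lee_fin.
  by apply: adde_ge0; [exact: adde_ge0|rewrite lee_fin].
have pk : p <= klinv M q (KL rho pi + \int[rho]_A KL (fQ A) (fP A) + (ln (2 / delta))%:E + (ln (2 * Num.sqrt M%:R))%:E)%E.
  apply: (@le_klinv _ _ q) => //.
  move=> c d /andP[c0 _] d1'; apply: le_trans (HG1 tr G1tr gt rho fQ marg c d c0 (lt_le_trans ltr01 d1')) _.
  rewrite -[sample_size (sizes tm tr)]/M lnM ?posrE// EFinD.
  by rewrite [X in (_ + X <= _)%E]addeC addeA.
set k1 := klinv M q _ in pk *.
have k1le : k1 <= 1 by exact: klinv_le1.
have /andP[p0 p1] := p01.
have MN : 0 < M%:R / (n%:R * mmax%:R) :> R by rewrite divr_gt0// mulr_gt0.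
have MN1 : M%:R / (n%:R * mmax%:R) <= 1 :> R by rewrite ler_pdivrMr ?mulr_gt0// mul1r.
(* The task-level bound concerns [M / (n mmax) * p], while the goal has [k1] in place of [p];
   [p <= k1] suffices because [le_klinv] lets this argument be raised. *)
apply: (@le_klinv _ _ (M%:R / (n%:R * mmax%:R) * p)) => //.
- by rewrite mulr_ge0// ltW.
- by rewrite ler_pM2l.
- by rewrite mulr_ile1// (le_trans p0).
- apply: adde_ge0 => //; rewrite lee_fin; apply: ln_ge0; rewrite ler_pdivlMr// mul1r.
  by apply: le_trans (ltW d1) _; have := s1 _ n_gt0; lra.
move=> c d /andP[c0 _] d1'.
have := HG2 tr G2tr rho c d c0 (lt_le_trans ltr01 d1').
rewrite -/r (_ : 2 * Num.sqrt n%:R * (2 / delta) = 4 * Num.sqrt n%:R / delta); last by ring.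
rewrite (_ : \int[rho]_A mean_task_risk _ _ _ _ _ _ _ _ _ _ _ _ _ _ _ _ A tr = M%:R / (n%:R * mmax%:R) * p) //.
by rewrite /p -RintZ//; apply: eq_Rintegral => A _; rewrite pE.
Qed.
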